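(* Let $\omega,L\in(0,\infty)$. (i) Sticky Brownian motion on $[0,L]$ with parameter $\omega$ has a unique invariant probability measure, given by $$\mu=\frac1{2+\omega L}\delta_0+\frac{\omega}{2+\omega L}\,dx+\frac1{2+\omega L}\delta_L .$$ (ii) Its $C^0$-generator $(\mathcal L_{C^0},\mathrm{Dom}(\mathcal L_{C^0}))$ is a core of its $L^2(\mu)$-generator $(\mathcal L,\mathrm{Dom}(\mathcal L))$. (iii) The jamming RTP process on $[0,L]$ with parameter $\omega$ is a second-order lift of sticky Brownian motion on $[0,L]$ with parameter $\omega$ (with respect to the projection $\pi(x,v)=x$).
   Context: Sticky Brownian motion on $[0,L]$ with parameter $\omega$ is the $[0,L]$-valued Feller process whose generator on $C^0([0,L])$ is $\mathcal L_{C^0}f=f''$ with $\mathrm{Dom}(\mathcal L_{C^0})=\{f\in C^2([0,L]):f''(0)=\omega f'(0),\ f''(L)=-\omega f'(L)\}$. Its $L^2(\mu)$-generator is the generator of the strongly continuous semigroup on $L^2(\mu)$ extending its transition semigroup. Jamming RTP (run-and-tumble particle) process on $[0,L]$ with parameter $\omega$: for an initial state $(x_0,v_0)\in[0,L]\times\{-2,0,2\}$, $v(t)$ is the Markov jump process on $\{-2,0,2\}$ started at $v_0$ with jump rates $2\to0$: $2\omega$; $0\to2$: $\omega$; $0\to-2$: $\omega$; $-2\to0$: $2\omega$ (other rates zero). Let $0=T_0<T_1<\cdots$ be its jump times. Then $x(0)=x_0$ and recursively $x(t)=\max[0,\min[L,x(T_n)+v(T_n)(t-T_n)]]$ for $t\in[T_n,T_{n+1})$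 (with $x$ continuous). The process is $(x(t),v(t))$ with values in $[0,L]\times\{-2,0,2\}$. Its unique invariant probability measure is known to be $\hat\mu=\sum_{v}(d_v^0\delta_0+a_v\,dx+d_v^L\delta_L)\otimes\delta_v$ with, after multiplication by $2+\omega L$: $d_2^0=0$, $d_0^0=d_{-2}^0=\frac12$; $a_2=a_{-2}=\frac\omega4$, $a_0=\frac\omega2$; $d_2^L=d_0^L=\frac12$, $d_{-2}^L=0$. Then $\hat\mu\circ\pi^{-1}=\mu$. Let $(\hat{\mathcal L},\mathrm{Dom}(\hat{\mathcal L}))$ be its generator in $L^2(\hat\mu)$. Second-order lift: a Markov process with invariant probability measure $\hat\mu$ and $L^2(\hat\mu)$-generator $\hat{\mathcal L}$ is a second-order lift of a reversible diffusion with invariant probability measure $\mu=\hat\mu\circ\pi^{-1}$ and $L^2(\mu)$-generator $\mathcal L$ if there is a core $D$ of $\mathcal L$ such that $f\circ\pi\in\mathrm{Dom}(\hat{\mathcal L})$ for all $f\in D$ and, for all $f,g\in D$, $\langle\hat{\mathcal L}(f\circ\pi),g\circ\pi\rangle_{L^2(\hat\mu)}=0$ and $\frac12\langle\hat{\mathcal L}(f\circ\pi),\hat{\mathcal L}(g\circ\pi)\rangle_{L^2(\hat\mu)}=-\langle f,\mathcal Lg\rangle_{L^2(\mu)}$. *)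

(* Defs.v *)
From HB Require Import structures.
From mathcomp Require Import all_boot all_order all_algebra.
From mathcomp Require Import all_classical all_reals all_analysis.
From mathcomp Require Import measurable_realfun.
Import Order.TTheory GRing.Theory Num.Theory.
Import numFieldNormedType.Exports.

Set Implicit Arguments.
Unset Strict Implicit.
Unset Printing Implicit Defensive.

Local Open Scope classical_set_scope.
Local Open Scope ring_scope.

(* A state space is a measurable subset [S] of an
   ambient measurable type [E].  The transition semigroup of a Markov process is
   given by its action [P t f x] on functions [f : E -> R]; its values are only
   meaningful for [t >= 0] and [x] in [S]. *)

Section markov.
Context d (E : measurableType d) (R : realType).
Implicit Types (S : set E) (mu : {measure set E -> \bar R}) (f g : E -> R)
  (P T : R -> (E -> R) -> (E -> R)).

Definition bounded_measurable f :=
  measurable_fun setT f /\ exists M : R, forall x, `|f x| <= M.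

Definition invariant_probability S mu P :=
  [/\ mu setT = 1%E, mu (~` S) = 0%E &
   forall t f, 0 <= t -> bounded_measurable f ->
     \int[mu]_(x in S) P t f x = \int[mu]_(x in S) f x].

Definition reversible S mu P :=
  forall t f g, 0 <= t -> bounded_measurable f -> bounded_measurable g ->
    \int[mu]_(x in S) (f x * P t g x) = \int[mu]_(x in S) (g x * P t f x).

(* Elements of L^2(mu) are represented by functions in [Lfun mu 2]; equality in
   L^2(mu) is equality mu-almost everywhere. *)

Definition L2_norm mu f : \bar R := 'N[mu]_(2%:E)[EFin \o f]%E.

Definition L2_dist mu f g : \bar R := L2_norm mu (fun x => f x - g x).

Definition L2_inner mu f g : R := \int[mu]_x (f x * g x).

(* That [T t] respects almost everywhere equality follows from linearity and
   boundedness. *)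
Definition strongly_continuous_semigroup mu T :=
  [/\ forall t f, 0 <= t -> f \in Lfun mu 2%:E -> T t f \in Lfun mu 2%:E,
      forall t (a : R) f g, 0 <= t ->
        f \in Lfun mu 2%:E -> g \in Lfun mu 2%:E ->
        T t (fun x => a * f x + g x) =
          (fun x => a * T t f x + T t g x) %[ae mu],
      forall t, 0 <= t -> exists C : R, forall f, f \in Lfun mu 2%:E ->
        (L2_norm mu (T t f) <= C%:E * L2_norm mu f)%E,
      (forall f, f \in Lfun mu 2%:E -> T 0 f = f %[ae mu]) /\
      (forall s t f, 0 <= s -> 0 <= t -> f \in Lfun mu 2%:E ->
        T (s + t) f = T s (T t f) %[ae mu]) &
      forall f, f \in Lfun mu 2%:E ->
        L2_dist mu (T t f) f @[t --> 0^'+] --> 0%E].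

Definition L2_semigroup mu P T :=
  strongly_continuous_semigroup mu T /\
  forall t f, 0 <= t -> bounded_measurable f -> T t f = P t f %[ae mu].

(* Graph of the generator: [f] is in the domain and its image is (the class
   of) [g]. *)
Definition L2_generator mu T f g :=
  [/\ f \in Lfun mu 2%:E, g \in Lfun mu 2%:E &
   L2_dist mu (fun x => (T t f x - f x) / t) g @[t --> 0^'+] --> 0%E].

Definition is_core mu (A : (E -> R) -> (E -> R) -> Prop) (D : set (E -> R)) :=
  [/\ D (fun=> 0),
      forall (a : R) f g, D f -> D g -> D (fun x => a * f x + g x),
      forall f, D f -> exists g, A f g &
      forall f g, A f g -> forall e : R, 0 < e ->
        exists f' g', [/\ D f', A f' g',
          (L2_dist mu f' f <= e%:E)%E &
          (L2_dist mu g' g <= e%:E)%E]].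

End markov.

(* The process with invariant probability [muh], state space [Sh], transition
   semigroup [Ph] and L^2-generator [Ah] lifts the reversible one given by
   [mu], [S], [P], [A], with respect to the projection [pi]. *)
Definition second_order_lift (R : realType) d d' (Eh : measurableType d)
    (E : measurableType d')
    (muh : {measure set Eh -> \bar R}) (Sh : set Eh)
    (Ph : R -> (Eh -> R) -> (Eh -> R)) (Ah : (Eh -> R) -> (Eh -> R) -> Prop)
    (mu : {measure set E -> \bar R}) (S : set E)
    (P : R -> (E -> R) -> (E -> R)) (A : (E -> R) -> (E -> R) -> Prop)
    (pi : Eh -> E) :=
  [/\ invariant_probability Sh muh Ph,
      invariant_probability S mu P,
      reversible S mu P,
      forall B, measurable B -> muh (pi @^-1` B) = mu B &
      exists D : set (E -> R),
        [/\ is_core mu A D,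
            forall f, D f -> exists h, Ah (f \o pi) h,
            forall f g h, D f -> D g -> Ah (f \o pi) h ->
              L2_inner muh h (g \o pi) = 0 &
            forall f g hf hg Ag, D f -> D g ->
              Ah (f \o pi) hf -> Ah (g \o pi) hg -> A g Ag ->
              2^-1 * L2_inner muh hf hg = - L2_inner mu f Ag]].

Section feller.
Context (R : realType).
Implicit Types (S : set R) (f g : R -> R)
  (p : R -> R -> probability (measurableTypeR R) R).

Definition transition S p (t : R) f (x : R) : R := \int[p t x]_(y in S) f y.

Record feller_process S p : Prop := {
  feller_support : forall t x, 0 <= t -> S x -> p t x S = 1%E ;
  feller_measurable : forall t B, 0 <= t -> measurable B ->
    measurable_fun S (fun x => p t x B) ;
  feller_start : forall x B, S x -> measurable B -> p 0 x B = \d_x B ;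
  feller_chapman_kolmogorov : forall (s t x : R) B,
    0 <= s -> 0 <= t -> S x -> measurable B ->
    p (s + t) x B = (\int[p s x]_(y in S) p t y B)%E ;
  feller_continuous : forall t f, 0 <= t ->
    {within S, continuous f} -> {within S, continuous (transition S p t f)} ;
  feller_strongly_continuous : forall f, {within S, continuous f} ->
    {uniform S, transition S p t f @[t --> 0^'+] --> f} }.

Definition C0_generator S p f g :=
  [/\ {within S, continuous f}, {within S, continuous g} &
   {uniform S, (fun x => (transition S p t f x - f x) / t) @[t --> 0^'+] --> g}].

(* One-sided derivative at the endpoints when [S] is a closed interval. *)
Definition derivative_on S f f' :=
  forall x, S x -> (f y - f x) / (y - x) @[y --> within S x^'] --> f' x.

(* Graph of the operator f |-> g = f'' with the sticky boundary conditions. *)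
Definition sticky_operator (omega L : R) f g :=
  exists f', [/\ derivative_on `[0, L] f f', derivative_on `[0, L] f' g,
    {within `[0, L], continuous g},
    g 0 = omega * f' 0 & g L = - omega * f' L].

Definition sticky_brownian_motion (omega L : R) p :=
  feller_process `[0, L] p /\
  forall f g, C0_generator `[0, L] p f g <-> sticky_operator omega L f g.

End feller.

Section measures.
Context (R : realType).

Definition atoms_and_lebesgue (L : R) (a b c : {nonneg R}) :
    {measure set (measurableTypeR R) -> \bar R} :=
  measure_add (measure_add
    (mscale a \d_(0 : measurableTypeR R))
    (mscale b (mrestr lebesgue_measure (measurable_itv `[0, L]))))
    (mscale c \d_(L : measurableTypeR R)).

Definition at_velocity (v : R)
    (m : {measure set (measurableTypeR R) -> \bar R}) :
    {measure set (measurableTypeR R * measurableTypeR R) -> \bar R} :=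
  (m \x \d_(v : measurableTypeR R))%E.

Variables omega L : {posnum R}.

Let Z : {posnum R} := (2 + omega%:num * L%:num)%:pos.

Definition sticky_measure : {measure set (measurableTypeR R) -> \bar R} :=
  atoms_and_lebesgue L%:num
    (Z%:num^-1)%:nng (omega%:num / Z%:num)%:nng (Z%:num^-1)%:nng.

Definition rtp_measure :
    {measure set (measurableTypeR R * measurableTypeR R) -> \bar R} :=
  measure_add (measure_add
    (at_velocity 2 (atoms_and_lebesgue L%:num
       0%:nng (omega%:num / 4 / Z%:num)%:nng (2^-1 / Z%:num)%:nng))
    (at_velocity 0 (atoms_and_lebesgue L%:num
       (2^-1 / Z%:num)%:nng (omega%:num / 2 / Z%:num)%:nng
       (2^-1 / Z%:num)%:nng)))
    (at_velocity (- 2) (atoms_and_lebesgue L%:num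
       (2^-1 / Z%:num)%:nng (omega%:num / 4 / Z%:num)%:nng 0%:nng)).

End measures.

Section rtp.
Context (R : realType) d (Omega : measurableType d).
Implicit Types (P : R -> probability Omega R) (v : R -> Omega -> R)
  (tau : nat -> Omega -> R) (x : R -> R -> Omega -> R).

(* Markov jump process with state space [vs] and jump rates [q], described by
   its jump chain and holding times: [P v0] is the law under which it starts at
   [v0], and [tau n] is the [n]-th jump time, with [tau 0 = 0].  Given the chain
   [v (tau i)], whose transition probabilities are [q a b / exit_rate a], the
   holding times [tau i.+1 - tau i] are independent and exponential of
   parameter [exit_rate (v (tau i))]. *)

Definition exit_rate (vs : seq R) (q : R -> R -> R) (a : R) : R :=
  \sum_(b <- vs) q a b.

Record markov_jump_process (vs : seq R) (q : R -> R -> R) P v tau : Prop := {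
  mjp_measurable_time : forall n, measurable_fun setT (tau n) ;
  mjp_measurable_chain : forall n, measurable_fun setT (fun w => v (tau n w) w) ;
  mjp_time0 : forall w, tau 0%N w = 0 ;
  mjp_time_lt : forall n w, tau n w < tau n.+1 w ;
  mjp_time_cvg : forall w, tau n w @[n --> \oo] --> +oo ;
  mjp_state : forall n w, v (tau n w) w \in vs ;
  mjp_jump : forall n w, v (tau n.+1 w) w != v (tau n w) w ;
  mjp_constant : forall n t w, tau n w <= t < tau n.+1 w ->
    v t w = v (tau n w) w ;
  mjp_law : forall (v0 : R) (n : nat) (y s : nat -> R), v0 \in vs ->
    (forall i, y i \in vs) -> (forall i, 0 <= s i) ->
    P v0 [set w | (forall i, (i <= n)%N -> v (tau i w) w = y i) /\
                  (forall i, (i < n)%N -> s i < tau i.+1 w - tau i w)] =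
    ((y 0%N == v0)%:R * \prod_(i < n)
       (q (y i) (y i.+1) / exit_rate vs q (y i) *
        expR (- (exit_rate vs q (y i) * s i))))%:E }.

Definition rtp_velocities : seq R := [:: 2; 0; - 2].

Definition rtp_rate (omega a b : R) : R :=
  if (a == 2) && (b == 0) then 2 * omega
  else if (a == 0) && (b == 2) then omega
  else if (a == 0) && (b == - 2) then omega
  else if (a == - 2) && (b == 0) then 2 * omega
  else 0.

(* [x x0 t] is the position at time [t] of the process started at [x0]; the
   initial velocity enters through the law [P v0]. *)
Record jamming_rtp (omega L : R) P v tau x : Prop := {
  rtp_velocity : markov_jump_process rtp_velocities (rtp_rate omega) P v tau ;
  rtp_start : forall (x0 : R) w, x0 \in `[0, L] -> x x0 0 w = x0 ;
  rtp_motion : forall (x0 : R) (n : nat) (t : R) w, x0 \in `[0, L] ->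
    tau n w <= t < tau n.+1 w ->
    x x0 t w = Num.max 0 (Num.min L
      (x x0 (tau n w) w + v (tau n w) w * (t - tau n w))) ;
  rtp_continuous : forall (x0 : R) w, x0 \in `[0, L] ->
    {within `[0, +oo[, continuous (fun t => x x0 t w)} }.

Definition rtp_space (L : R) : set (R * R) :=
  `[0, L] `*` [set` rtp_velocities].

Definition rtp_transition P v x (t : R) (f : R * R -> R) (z : R * R) : R :=
  \int[P z.2]_w f (x z.1 t w, v t w).

End rtp.

(* Main.v *)
(** Sticky Brownian motion.  Integration by parts and the boundary conditions
    make [f |-> f''] symmetric in [L^2(mu)], with Dirichlet form proportional to
    the integral of [f' g'].  Hence [s |-> <P_s f, P_(t-s) g>] is constant for [f]
    and [g] in the domain, so that the process is reversible and [mu] is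
    invariant.  An invariant probability annihilates all [f'']; as [f''] ranges
    over the continuous functions of [mu]-mean zero, it equals [mu].  The same
    solvability, combined with a Poincare inequality, yields the core property.

    Jamming process.  Its semigroup preserves Lipschitz functions, by coupling two
    positions with the same velocity path.  For a Lipschitz function, expanding
    up to one jump shows that the mean under [rtp_measure] changes by O(h^2) over
    a time step h, so that it is constant in time.  Its generator maps [f \o fst] to
    [f'] times the effective velocity, which is zero for a particle pushed against
    a wall; on the interior the velocity is symmetric with variance 2, so both
    lift identities reduce to the Dirichlet form above. *)
Require Import Defs.
From HB Require Import structures.
From mathcomp Require Import all_boot all_order all_algebra.
From mathcomp Require Import all_classical all_reals all_analysis.
From mathcomp Require Import measurable_realfun.
From mathcomp Require Import ring lra.
Import Order.TTheory GRing.Theory Num.Theory.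
Import numFieldNormedType.Exports HBNNSimple.

Set Implicit Arguments.
Unset Strict Implicit.
Unset Printing Implicit Defensive.

Local Open Scope classical_set_scope.
Local Open Scope ring_scope.

(** The obstacle throughout is that the semigroups are known only through integrals of bounded
    measurable functions, and only at points of the state space. Hence functions are cut off outside
    [S] or [Sh], and identities pass from smooth or Lipschitz functions to all bounded measurable
    ones mostly by monotone class arguments. Nothing is differentiated in time: a function of time
    is constant because its increments are uniformly o(h), and such a bound transfers from time 0 to
    all later times. For sticky Brownian motion the semigroup law is Chapman-Kolmogorov. For the
    jamming process it is borrowed from the L^2 semigroup extending the transition operators, hence
    holds almost everywhere, which is enough under an integral; the paths supply the law of the
    first two jumps, the displacement bound and the coupling. The core property avoids resolvents:
    k'' = w is solved explicitly with a bound, and by duality the same bound controls a mean zero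
    element of the L^2 domain by its image. *)

(** * Monotone class arguments for bounded measurable functions *)

Section bounded_measurable.
Context d (E : measurableType d) (R : realType).
Implicit Types (f g : E -> R) (H : set (E -> R)).

Lemma bounded_measurable_cst (c : R) : bounded_measurable (fun _ : E => c).
Proof. by split => //; exists `|c|. Qed.

Lemma bounded_measurable_indic (A : set E) : measurable A ->
  bounded_measurable (\1_A : E -> R).
Proof.
move=> mA; split => //; exists 1 => x; rewrite indicE.
by case: (x \in A); rewrite ?normr1 ?normr0.
Qed.

Lemma bounded_measurable_lin (a : R) f g : bounded_measurable f ->
  bounded_measurable g -> bounded_measurable (fun x => a * f x + g x).
Proof.
move=> [mf [M fM]] [mg [N gN]]; split.
  by apply: measurable_funD => //; exact: measurable_funM.
exists (`|a| * M + N) => x; rewrite (le_trans (ler_normD _ _))// lerD//.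
by rewrite normrM ler_wpM2l.
Qed.

Lemma bounded_measurableM f g : bounded_measurable f ->
  bounded_measurable g -> bounded_measurable (fun x => f x * g x).
Proof.
move=> [mf [M fM]] [mg [N gN]]; split; first exact: measurable_funM.
by exists (M * N) => x; rewrite normrM ler_pM.
Qed.

Lemma bounded_measurable_lim (u : (E -> R)^nat) f (M : R) :
  (forall n, bounded_measurable (u n)) -> (forall n x, `|u n x| <= M) ->
  (forall x, u n x @[n --> \oo] --> f x) -> bounded_measurable f.
Proof.
move=> bu uM uf; split.
  apply: (@measurable_fun_cvg _ _ _ _ u) => [n|x _]; [by case: (bu n)|exact: uf].
by exists M => x; apply: (cvgr_to_le (cvg_norm (uf x))); exact: nearW.
Qed.

(** Functional monotone class theorem. Dynkin's lemma gives all measurable indicators, linearity the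
    simple functions, bounded limits the nonnegative bounded functions; a general [f] bounded by [M]
    is reached from [f + M]. Linearity is asked for bounded measurable functions only, because the
    properties [H] of interest compare integrals. *)
Lemma bounded_measurable_induction (G : set (set E)) H :
  @measurable _ E = <<s G >> -> setI_closed G ->
  H (fun=> 1) -> (forall A, G A -> H \1_A) ->
  (forall (a : R) f g, bounded_measurable f -> bounded_measurable g ->
    H f -> H g -> H (fun x => a * f x + g x)) ->
  (forall (u : (E -> R)^nat) f (M : R), (forall n, bounded_measurable (u n)) ->
    (forall n, H (u n)) -> (forall n x, `|u n x| <= M) ->
    (forall x, u n x @[n --> \oo] --> f x) -> H f) ->
  forall f, bounded_measurable f -> H f.
Proof.
move=> mG GI H1 HG Hlin Hlim.
have b1 := bounded_measurable_cst 1.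
have H0 : H (fun=> 0).
  by have := Hlin (-1) _ _ b1 b1 H1 H1; congr H; apply/funext => x; rewrite mulr1 addNr.
have Hind A : measurable A -> H \1_A.
  rewrite mG; move: A; apply: (@dynkin_induction _ E G (fun A => H \1_A)) => //.
  - by rewrite (_ : \1__ = fun=> 1)//; apply/funext => x; rewrite indicE in_setT.
  - move=> A mA HA.
    have := Hlin (-1) _ _ (bounded_measurable_indic mA) b1 HA H1.
    congr H; apply/funext => x; rewrite !indicE in_setC.
    by case: (x \in A) => /=; rewrite ?mulr1 ?mulr0 ?add0r ?addNr.
  - move=> F mF tF HF.
    pose u n : E -> R := \1_(\big[setU/set0]_(i < n) F i).
    have mU n : measurable (\big[setU/set0]_(i < n) F i).
      exact: bigsetU_measurable.
    have bu n : bounded_measurable (u n) by exact: bounded_measurable_indic.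
    apply: (Hlim u _ 1) => //.
    + elim=> [|n IH].
        rewrite /u big_ord0 (_ : \1__ = fun=> 0)//.
        by apply/funext => x; rewrite indicE in_set0.
      have := Hlin 1 _ _ (bu n) (bounded_measurable_indic (mF n)) IH (HF n).
      congr H; apply/funext => x; rewrite mul1r /u big_ord_recr/= !indicE in_setU.
      have [xU|xU] := boolP (x \in \big[setU/set0]_(i < n) F i); last first.
        by rewrite add0r.
      rewrite orTb (_ : (x \in F n) = false) ?addr0//.
      apply/negbTE/negP => /set_mem xF; move/set_mem: xU; rewrite -bigcup_mkord.
      move=> [k /= kn xFk]; have knE : k = n by apply: tF => //; exists x.
      by move: kn; rewrite knE ltnn.
    + by move=> n x; rewrite /u indicE; case: (_ \in _); rewrite ?normr1 ?normr0.
    + move=> x; have [[k _ Fkx]|xF] := pselect ((\bigcup_k F k) x).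
        apply: cvg_near_cst; exists k.+1 => // n /= kn.
        have xn : (\big[setU/set0]_(i < n) F i) x by rewrite -bigcup_mkord; exists k.
        have xF : (\bigcup_k F k) x by exists k.
        by rewrite /u !indicE !mem_set.
      apply: cvg_near_cst; apply: nearW => n.
      have xn : ~ (\big[setU/set0]_(i < n) F i) x.
        by rewrite -bigcup_mkord => -[k _ Fkx]; apply: xF; exists k.
      by rewrite /u !indicE !memNset.
have Hsum (s : seq (R * set E)) : (forall i, i \in s -> measurable i.2) ->
    H (fun x => \sum_(i <- s) i.1 * \1_(i.2) x) /\
    bounded_measurable (fun x => \sum_(i <- s) i.1 * \1_(i.2) x).
  elim: s => [_|i s IH ms].
    rewrite (_ : (fun _ => _) = fun=> 0); last by apply/funext => x; rewrite big_nil.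
    by split => //; exact: bounded_measurable_cst.
  have [|Hs bs] := IH; first by move=> j js; apply: ms; rewrite in_cons js orbT.
  have mi : measurable i.2 by apply: ms; rewrite mem_head.
  have bi := bounded_measurable_indic mi.
  rewrite (_ : (fun _ => _) =
    fun x => i.1 * \1_(i.2) x + \sum_(i <- s) i.1 * \1_(i.2) x); last first.
    by apply/funext => x; rewrite big_cons.
  by split; [apply: Hlin => //; exact: Hind|exact: bounded_measurable_lin].
have Hnn (f : {nnsfun E >-> R}) : H (f : E -> R) /\ bounded_measurable (f : E -> R).
  have [s sm sE] : exists2 s : seq (R * set E), (forall i, i \in s -> measurable i.2) &
      forall x, f x = \sum_(i <- s) i.1 * \1_(i.2) x.
    exists [seq (y, f @^-1` [set y]) | y <- finmap.enum_fset (fset_set (range f))].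
      by move=> i /mapP[y _ ->] /=.
    by move=> x; rewrite big_map fimfunE fsbig_finite.
  have := Hsum s sm; rewrite (_ : (fun _ => _) = (f : E -> R))//.
  by apply/funext => x; rewrite sE.
have Hge0 f : bounded_measurable f -> (forall x, 0 <= f x) -> H f.
  move=> [mf [M fM]] f0.
  have mf' : measurable_fun setT (EFin \o f) by exact/measurable_EFinP.
  pose u n : E -> R := nnsfun_approx measurableT mf' n.
  have f0' x : setT x -> (0 <= (EFin \o f) x)%E by rewrite lee_fin.
  apply: (Hlim u _ M) => [n|n|n x|x]; [by case: (Hnn (nnsfun_approx measurableT mf' n))|by case: (Hnn (nnsfun_approx measurableT mf' n))| |].
    rewrite /u ger0_norm// nnsfun_approxE (le_trans _ (fM x))//.
    rewrite (le_trans _ (ler_norm _))// -lee_fin.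
    exact: (@le_approx _ _ _ setT (EFin \o f)).
  have /(_ Logic.I) := @cvg_nnsfun_approx _ _ _ setT measurableT _ mf' f0' x.
  by move/fine_cvgP => [].
move=> f bf; have [mf [M fM]] := bf.
have bM : bounded_measurable (fun x => 1 * f x + M).
  by apply: bounded_measurable_lin => //; exact: bounded_measurable_cst.
have HM : H (fun x => 1 * f x + M).
  by apply: Hge0 => // x; rewrite mul1r -lerBlDr sub0r; case/ler_normlP: (fM x); rewrite lerNl.
have := Hlin (- M) _ _ b1 bM H1 HM; congr H; apply/funext => x.
by rewrite mulr1 mul1r addrCA addNr addr0.
Qed.

End bounded_measurable.

(** Open right rays generate the Borel sets and are stable under intersection. They are preferred to
    general intervals because one increasing ramp or spline approximates the indicator of a ray. *)
Lemma bounded_measurable_ray_induction (R : realType)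
    (H : set (measurableTypeR R -> R)) :
  H (fun=> 1) -> (forall a, H \1_`]a, +oo[) ->
  (forall (a : R) f g, bounded_measurable f -> bounded_measurable g ->
    H f -> H g -> H (fun x => a * f x + g x)) ->
  (forall (u : (measurableTypeR R -> R)^nat) f (M : R),
    (forall n, bounded_measurable (u n)) ->
    (forall n, H (u n)) -> (forall n x, `|u n x| <= M) ->
    (forall x, u n x @[n --> \oo] --> f x) -> H f) ->
  forall f, bounded_measurable f -> H f.
Proof.
move=> H1 Hray Hlin Hlim.
apply: (@bounded_measurable_induction _ (measurableTypeR R) R (@RGenOInfty.G R) H _ _ H1 _ Hlin Hlim).
- exact: RGenOInfty.measurableE.
- move=> _ _ [a ->] [b ->]; exists (Num.max a b); apply/seteqP; split => x /=;
  by rewrite !in_itv/= !andbT gt_max => /andP.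
- by move=> _ [a ->].
Qed.

(** * Integration of bounded functions, and L^2 with a real-valued norm *)

Section finite_measure_on.
Context d (E : measurableType d) (R : realType).
Variables (mu : {measure set E -> \bar R}) (D : set E).
Hypotheses (mD : measurable D) (muD : (mu D < +oo)%E).
Implicit Types (f g h : E -> R).

Lemma integrable_le_cst f (M : R) : measurable_fun D f ->
  (forall x, D x -> `|f x| <= M) -> mu.-integrable D (EFin \o f).
Proof.
move=> mf fM; apply: measurable_bounded_integrable => //.
exists M; split; first exact: num_real.
by move=> r Mr x Dx /=; rewrite (le_trans (fM x Dx))// ltW.
Qed.

Lemma bounded_measurable_integrable_on f : bounded_measurable f ->
  mu.-integrable D (EFin \o f).
Proof.
move=> [mf [M fM]]; apply: (@integrable_le_cst _ M) => //.
exact: measurable_funTS.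
Qed.

Lemma Rintegral_bounded_cvg_on (u : (E -> R)^nat) f (M : R) :
  (forall n, measurable_fun D (u n)) ->
  (forall n x, D x -> `|u n x| <= M) ->
  (forall x, D x -> u n x @[n --> \oo] --> f x) ->
  \int[mu]_(x in D) u n x @[n --> \oo] --> \int[mu]_(x in D) f x.
Proof.
move=> mu_ uM uf.
have fM x : D x -> `|f x| <= M.
  move=> Dx; apply: (cvgr_to_le (cvg_norm (uf x Dx))).
  by apply: nearW => n; exact: uM.
have mf : measurable_fun D f.
  by apply: (@measurable_fun_cvg _ _ _ _ u) => // x Dx; exact: uf.
have If := @integrable_le_cst f M mf fM.
apply: fine_cvg; rewrite fineK; last exact: integrable_fin_num.
apply: (@dominated_cvg _ _ _ mu D mD _ _ (fun=> M%:E)) => //.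
- by move=> n; exact/measurable_EFinP.
- by move=> x Dx; apply: cvg_EFin; [exact: nearW|exact: uf].
- exact: (@integrable_le_cst (fun=> M) `|M|).
Qed.
End finite_measure_on.

Section finite_measure.
Context d (E : measurableType d) (R : realType).
Variable mu : {measure set E -> \bar R}.
Hypothesis muT : (mu setT < +oo)%E.
Implicit Types (f g h : E -> R) (D : set E).

Lemma finite_measure_lty D : measurable D -> (mu D < +oo)%E.
Proof. by move=> mD; rewrite (le_lt_trans _ muT)// le_measure ?inE. Qed.

Lemma bounded_measurable_integrable D f : measurable D -> bounded_measurable f ->
  mu.-integrable D (EFin \o f).
Proof.
by move=> mD; apply: bounded_measurable_integrable_on => //; exact: finite_measure_lty.
Qed.

Lemma Rintegral_bounded_cvg D (u : (E -> R)^nat) f (M : R) : measurable D ->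
  (forall n, measurable_fun D (u n)) ->
  (forall n x, D x -> `|u n x| <= M) ->
  (forall x, D x -> u n x @[n --> \oo] --> f x) ->
  \int[mu]_(x in D) u n x @[n --> \oo] --> \int[mu]_(x in D) f x.
Proof.
by move=> mD; apply: Rintegral_bounded_cvg_on => //; exact: finite_measure_lty.
Qed.

Lemma bounded_measurable_Lfun f : bounded_measurable f -> f \in Lfun mu 2%:E.
Proof.
move=> [mf [M fM]]; apply/andP; rewrite !inE; split => //=.
rewrite /finite_norm unlock poweR_lty//.
apply: (@le_lt_trans _ _ (\int[mu]_x (M `^ 2)%:E)%E).
  apply: ge0_le_integral => //=.
  - apply/measurable_EFinP.
    apply/(@measurableT_comp _ _ _ _ _ _ (fun x : R => x `^ 2)%R) => //.
    exact/measurableT_comp.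
  - move=> x _; rewrite lee_fin ge0_ler_powR// nnegrE//.
    by rewrite (le_trans _ (fM x)).
by rewrite integral_cst// lte_mul_pinfty// lee_fin powR_ge0.
Qed.

End finite_measure.

Section L2.
Context d (E : measurableType d) (R : realType).
Variable mu : {measure set E -> \bar R}.
Implicit Types (f g h : E -> R) (D : set E).

(** The real number behind [L2_norm] (see [L2_normE]), so that estimates and limits are carried out
    in [R] and not in the extended reals. *)
Definition L2_rnorm f : R := Num.sqrt (L2_inner mu f f).

Lemma Lfun_measurable f : f \in Lfun mu 2%:E -> measurable_fun setT f.
Proof. by case/andP => /[!inE]. Qed.

Lemma Lfun_lin (a : R) f g : f \in Lfun mu 2%:E -> g \in Lfun mu 2%:E ->
  (fun x => a * f x + g x) \in Lfun mu 2%:E.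
Proof.
have p1 : (1 <= 2%:E :> \bar R)%E by rewrite lee_fin ler1n.
move=> f2 g2; have := Lfun_submod_closed mu p1.
move=> [_ /(_ a f g f2 g2)].
by rewrite (_ : _ + _ = fun x => a * f x + g x).
Qed.

Lemma LfunB f g : f \in Lfun mu 2%:E -> g \in Lfun mu 2%:E ->
  (fun x => f x - g x) \in Lfun mu 2%:E.
Proof.
move=> f2 g2; have := Lfun_lin (-1) g2 f2.
by under eq_fun do rewrite mulN1r addrC.
Qed.

Lemma L2_integrable f g : f \in Lfun mu 2%:E -> g \in Lfun mu 2%:E ->
  mu.-integrable setT (EFin \o (fun x => f x * g x)).
Proof. by move=> f2 g2; apply/Lfun1_integrable; exact: Lfun2_mul_Lfun1. Qed.

Lemma L2_innerC f g : L2_inner mu f g = L2_inner mu g f.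
Proof. by apply: eq_Rintegral => x _; rewrite mulrC. Qed.

Lemma L2_inner_linl (a : R) f g h : f \in Lfun mu 2%:E -> g \in Lfun mu 2%:E ->
  h \in Lfun mu 2%:E ->
  L2_inner mu (fun x => a * f x + g x) h = a * L2_inner mu f h + L2_inner mu g h.
Proof.
move=> f2 g2 h2; have fh := L2_integrable f2 h2; have gh := L2_integrable g2 h2.
rewrite /L2_inner -RintegralZl// -RintegralD//; last first.
  have := integrableZl measurableT a fh.
  by congr (integrable _ _ _); apply/funext => x; rewrite /= EFinM.
by apply: eq_Rintegral => x _; rewrite mulrDl mulrA.
Qed.

Lemma L2_innerBl f g h : f \in Lfun mu 2%:E -> g \in Lfun mu 2%:E ->
  h \in Lfun mu 2%:E ->
  L2_inner mu (fun x => f x - g x) h = L2_inner mu f h - L2_inner mu g h.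
Proof.
move=> f2 g2 h2; have := L2_inner_linl (-1) g2 f2 h2.
by rewrite mulN1r addrC => <-; apply: eq_Rintegral => x _; rewrite mulN1r addrC.
Qed.

Lemma L2_inner_ge0 f : 0 <= L2_inner mu f f.
Proof. by apply: Rintegral_ge0 => x _; rewrite -expr2 sqr_ge0. Qed.

Lemma L2_normE f : f \in Lfun mu 2%:E -> L2_norm mu f = (L2_rnorm f)%:E.
Proof.
move=> f2; have If := L2_integrable f2 f2.
have -> : L2_norm mu f = ((\int[mu]_x (f x * f x)%:E) `^ 2^-1)%E.
  rewrite /L2_norm unlock; congr (_ `^ _)%E; apply: eq_integral => x _ /=.
  by rewrite powR_mulrn// -normrX ger0_norm ?sqr_ge0// expr2.
rewrite -(fineK (integrable_fin_num measurableT If)) poweR_EFin.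
by rewrite powR12_sqrt ?L2_inner_ge0.
Qed.

Lemma L2_rnorm_ge0 f : 0 <= L2_rnorm f.
Proof. exact: sqrtr_ge0. Qed.

Lemma sqr_L2_rnorm f : L2_rnorm f ^+ 2 = L2_inner mu f f.
Proof. by rewrite sqr_sqrtr ?L2_inner_ge0. Qed.

Lemma cauchy_schwarz_L2 f g : f \in Lfun mu 2%:E -> g \in Lfun mu 2%:E ->
  `|L2_inner mu f g| <= L2_rnorm f * L2_rnorm g.
Proof.
move=> f2 g2; rewrite -lee_fin EFinM -!L2_normE//.
rewrite (le_trans _ (@hoelder _ _ _ mu f g 2 2 _ _ _ _ _))//.
- rewrite Lnorm1 EFin_normr_Rintegral//; last exact: L2_integrable.
  apply: le_abse_integral => //; apply/measurable_EFinP.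
  by apply: measurable_funM; exact: Lfun_measurable.
- exact: Lfun_measurable.
- exact: Lfun_measurable.
- by rewrite [RHS]splitr !div1r.
Qed.

Lemma ler_L2_rnormD f g : f \in Lfun mu 2%:E -> g \in Lfun mu 2%:E ->
  L2_rnorm (fun x => f x + g x) <= L2_rnorm f + L2_rnorm g.
Proof.
move=> f2 g2; have fg : (fun x => f x + g x) \in Lfun mu 2%:E.
  by have := Lfun_lin 1 f2 g2; under eq_fun do rewrite mul1r.
rewrite -lee_fin EFinD -!L2_normE//.
by apply: minkowski_EFin; [exact: Lfun_measurable..|rewrite ler1n].
Qed.

Lemma L2_rnormN f : L2_rnorm (fun x => - f x) = L2_rnorm f.
Proof.
by congr Num.sqrt; apply: eq_Rintegral => x _; rewrite mulrNN.
Qed.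

Lemma ler_L2_rnormB f g h : f \in Lfun mu 2%:E -> g \in Lfun mu 2%:E ->
  h \in Lfun mu 2%:E ->
  L2_rnorm (fun x => f x - h x) <=
  L2_rnorm (fun x => f x - g x) + L2_rnorm (fun x => g x - h x).
Proof.
move=> f2 g2 h2; apply: le_trans (ler_L2_rnormD (LfunB f2 g2) (LfunB g2 h2)).
by rewrite le_eqVlt; apply/orP; left; apply/eqP; congr L2_rnorm; apply/funext => x; rewrite addrA subrK.
Qed.

Lemma L2_rnorm_eq0 f : f \in Lfun mu 2%:E -> L2_rnorm f = 0 -> f = (fun=> 0) %[ae mu].
Proof.
move=> f2 f0; have /Lnorm_eq0_eq0 : measurable_fun setT (EFin \o f).
  by apply/measurable_EFinP; exact: Lfun_measurable.
move=> /(_ mu 2%:E); rewrite lte_fin ltr0n -/(L2_norm mu f) L2_normE// f0.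
by move=> /(_ isT erefl); apply: filterS => x /(_ Logic.I) [].
Qed.

Lemma ae_eq_Rintegral (D : set E) f g : measurable D -> measurable_fun D f ->
  measurable_fun D g -> f = g %[ae mu] ->
  \int[mu]_(x in D) f x = \int[mu]_(x in D) g x.
Proof.
move=> mD mf mg fg; congr fine; apply: ae_eq_integral => //.
- exact/measurable_EFinP.
- exact/measurable_EFinP.
- by apply: filterS fg => x /(_ Logic.I) /= -> .
Qed.

Lemma ae_eq_L2_inner f f' g : f \in Lfun mu 2%:E -> f' \in Lfun mu 2%:E ->
  g \in Lfun mu 2%:E -> f = f' %[ae mu] -> L2_inner mu f g = L2_inner mu f' g.
Proof.
move=> f2 f'2 g2 ff'; apply: ae_eq_Rintegral => //.
- by apply: measurable_funM; exact: Lfun_measurable.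
- by apply: measurable_funM; exact: Lfun_measurable.
- by apply: filterS ff' => x /(_ Logic.I) /= -> .
Qed.

Lemma ae_eq_L2_rnorm f f' : f \in Lfun mu 2%:E -> f' \in Lfun mu 2%:E ->
  f = f' %[ae mu] -> L2_rnorm f = L2_rnorm f'.
Proof.
move=> f2 f'2 ff'; rewrite /L2_rnorm (ae_eq_L2_inner f2 f'2)// L2_innerC.
by rewrite (ae_eq_L2_inner f2 f'2).
Qed.

Lemma L2_dist_cvgP (F : R -> E -> R) g :
  (forall t, 0 < t -> F t \in Lfun mu 2%:E) -> g \in Lfun mu 2%:E ->
  L2_dist mu (F t) g @[t --> 0^'+] --> 0%E <->
  L2_rnorm (fun x => F t x - g x) @[t --> 0^'+] --> 0.
Proof.
move=> F2 g2.
have eqF : \forall t \near 0^'+, L2_dist mu (F t) g = (L2_rnorm (fun x => F t x - g x))%:E.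
  by near=> t; rewrite /L2_dist L2_normE//; apply: LfunB => //; apply: F2.
split.
  move=> /(cvg_trans (near_eq_cvg eqF)).
  by move=> /fine_cvgP[].
move=> H; apply: cvg_trans.
  by apply: near_eq_cvg; near do apply/esym; exact: eqF.
by apply: cvg_EFin => //; exact: nearW.
Unshelve. all: by end_near. Qed.

Lemma L2_cvg_unique (F : R -> E -> R) g g' :
  (forall t, 0 < t -> F t \in Lfun mu 2%:E) -> g \in Lfun mu 2%:E ->
  g' \in Lfun mu 2%:E ->
  L2_dist mu (F t) g @[t --> 0^'+] --> 0%E ->
  L2_dist mu (F t) g' @[t --> 0^'+] --> 0%E -> g = g' %[ae mu].
Proof.
move=> F2 g2 g'2 /(L2_dist_cvgP F2 g2) Fg /(L2_dist_cvgP F2 g'2) Fg'.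
have gg' : L2_rnorm (fun x => g x - g' x) = 0.
  apply/eqP; rewrite eq_le L2_rnorm_ge0 andbT.
  have FG : L2_rnorm (fun x => F t x - g x) + L2_rnorm (fun x => F t x - g' x)
      @[t --> 0^'+] --> (0 : R).
    by rewrite -[X in _ --> X]addr0; apply: cvgD.
  apply: (cvgr_to_ge FG).
  near=> t; have Ft : F t \in Lfun mu 2%:E by exact: F2.
  rewrite /= -[X in _ <= X + _]L2_rnormN.
  rewrite (le_trans (ler_L2_rnormB g2 Ft g'2))// lerD2r le_eqVlt; apply/orP; left.
  by apply/eqP; congr L2_rnorm; apply/funext => x; rewrite opprB.
have := L2_rnorm_eq0 (LfunB g2 g'2) gg'.
by apply: filterS => x /(_ Logic.I) /eqP; rewrite subr_eq0 => /eqP.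
Unshelve. all: by end_near. Qed.

End L2.

(** * Density of bounded and of continuous functions in L^2 *)

Lemma continuous_clamp (R : realType) (a b : R) :
  continuous (fun x : R => Num.max a (Num.min b x)).
Proof.
move=> x; apply: (@continuous_max R R (fun=> a) (fun x => Num.min b x)).
  exact: cvg_cst.
by apply: (@continuous_min R R (fun=> b) id); [exact: cvg_cst|exact: cvg_id].
Qed.

Section ramp.
Context (R : realType).
Implicit Types (a x y : R).

(** An [n]-Lipschitz approximation of the indicator of the open ray: it is 0 up to [a], point
    included, and reaches 1 at [a + 1/n]. Continuity serves the density in L^2, the Lipschitz
    property the invariance for the jamming process. *)
Definition ramp a (n : nat) x : R := Num.max 0 (Num.min 1 (n%:R * (x - a))).

Lemma ler_norm_ramp a n x : `|ramp a n x| <= 1.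
Proof.
rewrite ger0_norm /ramp; last by rewrite le_max lexx.
by rewrite ge_max ler01 ge_min lexx.
Qed.

Lemma continuous_ramp a n : continuous (ramp a n).
Proof.
move=> x; have cx : {for x, continuous (fun x => n%:R * (x - a))}.
  by apply: cvgM; [exact: cvg_cst|apply: cvgB; [exact: cvg_id|exact: cvg_cst]].
exact: (@continuous_comp R R R _ (fun y => Num.max 0 (Num.min 1 y)) x cx (@continuous_clamp R 0 1 _)).
Qed.

Lemma bounded_measurable_ramp a n : bounded_measurable (ramp a n : measurableTypeR R -> R).
Proof.
split; last by exists 1 => x; exact: ler_norm_ramp.
by apply: continuous_measurable_fun; exact: continuous_ramp.
Qed.

Lemma cvg_ramp a x : ramp a n x @[n --> \oo] --> (\1_`]a, +oo[ x : R).
Proof.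
apply: cvg_near_cst; have [xa|ax] := leP x a.
  apply: nearW => n; rewrite indicE memNset/= ?in_itv/= ?andbT ?ltNge ?xa//.
  have : n%:R * (x - a) <= 0 by rewrite mulr_ge0_le0//; lra.
  by move=> h; rewrite /ramp min_r ?max_l//; lra.
near=> n; rewrite indicE mem_set/= ?in_itv/= ?ax//.
have : (x - a)^-1 <= n%:R by near: n; exact: nbhs_infty_ger.
rewrite -div1r ler_pdivrMr ?subr_gt0// => h.
by rewrite /ramp min_l ?max_r//; lra.
Unshelve. all: by end_near. Qed.
End ramp.

Section L2_density.
Context d (E : measurableType d) (R : realType).
Variable mu : {measure set E -> \bar R}.
Hypothesis muT : (mu setT < +oo)%E.
Implicit Types (f g h : E -> R).

Lemma L2_rnormZ (a : R) f : f \in Lfun mu 2%:E ->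
  L2_rnorm mu (fun x => a * f x) = `|a| * L2_rnorm mu f.
Proof.
move=> f2; rewrite -sqrtr_sqr -sqrtrM ?sqr_ge0//; congr Num.sqrt.
rewrite -RintegralZl//; last exact: L2_integrable.
by apply: eq_Rintegral => x _; rewrite expr2 mulrACA.
Qed.

Lemma L2_rnorm_cvg0 (u : (E -> R)^nat) g :
  (forall n, measurable_fun setT (u n)) -> g \in Lfun mu 2%:E ->
  (forall n x, `|u n x| <= `|g x|) -> (forall x, u n x @[n --> \oo] --> 0) ->
  L2_rnorm mu (u n) @[n --> \oo] --> 0.
Proof.
move=> mu_ g2 ug u0; rewrite -(@sqrtr0 R).
apply: continuous_cvg; first exact: sqrt_continuous.
rewrite [X in _ --> X](_ : 0 = fine (\int[mu]_x 0%:E)%E); last by rewrite integral0.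
apply: fine_cvg; rewrite fineK; last by rewrite integral0.
apply: (@dominated_cvg _ _ _ mu setT measurableT _ _ (fun x => (g x * g x)%:E)) => //.
- by move=> n; apply/measurable_EFinP; exact: measurable_funM.
- move=> x _; apply: cvg_EFin; first exact: nearW.
  by rewrite -[X in _ --> X](mulr0 (0:R)); apply: cvgM.
- exact: L2_integrable.
- move=> n x _; rewrite lee_fin -!expr2 ger0_norm ?sqr_ge0//.
  by rewrite -(ger0_norm (sqr_ge0 (u n x))) -(ger0_norm (sqr_ge0 (g x))) !normrX lerXn2r ?nnegrE.
Qed.

Lemma L2_rnorm_bounded_cvg (u : (E -> R)^nat) f (M : R) :
  (forall n, bounded_measurable (u n)) -> (forall n x, `|u n x| <= M) ->
  (forall x, u n x @[n --> \oo] --> f x) ->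
  L2_rnorm mu (fun x => u n x - f x) @[n --> \oo] --> 0.
Proof.
move=> bu uM uf; have bf := bounded_measurable_lim bu uM uf.
have [mf _] := bf.
apply: (@L2_rnorm_cvg0 (fun n x => u n x - f x) (fun=> M + M)).
- by move=> n; apply: measurable_funB => //; case: (bu n).
- by apply: bounded_measurable_Lfun => //; exact: bounded_measurable_cst.
- move=> n x; rewrite (le_trans (ler_normB _ _))// (le_trans _ (ler_norm _))//.
  rewrite lerD//; apply: (cvgr_to_le (cvg_norm (uf x))); exact: nearW.
- by move=> x; rewrite -(subrr (f x)); apply: cvgB => //; exact: cvg_cst.
Qed.

(** Truncation at the levels [- n] and [n]: the error is dominated by [|f|] and vanishes at each
    point as soon as [n] exceeds [|f x|]. *)
Lemma L2_dense_bounded f (e : R) : f \in Lfun mu 2%:E -> 0 < e ->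
  exists2 w, bounded_measurable w & L2_rnorm mu (fun x => f x - w x) <= e.
Proof.
move=> f2 e0; have mf := Lfun_measurable f2.
pose w n x := Num.max (- n%:R) (Num.min n%:R (f x)).
have mw n : measurable_fun setT (w n).
  by apply: measurable_maxr => //; apply: measurable_minr.
have wE n x : `|f x| <= n%:R -> w n x = f x.
  by move=> /ler_normlP[fn1 fn2]; rewrite /w min_r// max_r// lerNl.
have fw n x : `|f x - w n x| <= `|f x|.
  have n0 : 0 <= n%:R :> R by [].
  rewrite /w; case: (leP n%:R (f x)) => [nf|/ltW nf].
    rewrite max_r; last by lra.
    by rewrite !ger0_norm; lra.
  case: (leP (- n%:R) (f x)) => [_|fn]; first by rewrite subrr normr0.
  by rewrite !ltr0_norm; lra.
have : L2_rnorm mu (fun x => f x - w n x) @[n --> \oo] --> 0.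
  apply: L2_rnorm_cvg0 f2 _ _ => //; first by move=> n; exact: measurable_funB.
  move=> x; apply: cvg_near_cst; near=> n; rewrite wE ?subrr//.
  by near: n; exact: nbhs_infty_ger.
move=> /cvgr_le /(_ e e0) [n _ /(_ n (leqnn n))] /= fwe.
exists (w n) => //; split => //; exists n%:R => x.
have n0 : 0 <= n%:R :> R by [].
by rewrite ler_norml /w le_max lexx/= ge_max ge_min lexx/= andbT; lra.
Unshelve. all: by end_near. Qed.

End L2_density.

(** After truncation, the functions approximable by bounded continuous ones are stable under linear
    combinations and bounded limits, so the monotone class argument leaves only rays, which ramps
    approximate. *)
Lemma L2_dense_continuous (R : realType)
    (mu : {measure set (measurableTypeR R) -> \bar R}) (f : measurableTypeR R -> R)
    (e : R) : (mu setT < +oo)%E -> f \in Lfun mu 2%:E -> 0 < e ->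
  exists w : R -> R, [/\ continuous w, bounded_measurable (w : measurableTypeR R -> R) &
    L2_rnorm mu (fun x => f x - w x) <= e].
Proof.
move=> muT; pose H (f : measurableTypeR R -> R) := forall e : R, 0 < e ->
  exists w : R -> R, [/\ continuous w, bounded_measurable (w : measurableTypeR R -> R) &
    L2_rnorm mu (fun x => f x - w x) <= e].
have bL := bounded_measurable_Lfun muT.
suff HH (g : measurableTypeR R -> R) : bounded_measurable g -> H g.
  move=> f2 e0; have e20 : 0 < e / 2 by rewrite divr_gt0.
  have [g bg fg] := L2_dense_bounded f2 e20.
  have [w [cw bw gw]] := HH g bg _ e20; exists w; split => //.
  by rewrite (le_trans (ler_L2_rnormB f2 (bL _ bg) (bL _ bw)))// [leRHS]splitr lerD.
clear f e; move: g; apply: bounded_measurable_ray_induction.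
- move=> e e0; exists (fun=> 1); split; [exact: cst_continuous|exact: bounded_measurable_cst|].
  rewrite (_ : (fun _ => _) = (fun=> 0 * 1)); last by apply/funext => x; rewrite subrr mul0r.
  rewrite L2_rnormZ ?normr0 ?mul0r ?ltW//.
  by apply: bL; exact: bounded_measurable_cst.
- move=> a e e0.
  have := L2_rnorm_bounded_cvg muT (bounded_measurable_ramp a) (ler_norm_ramp a) (@cvg_ramp R a).
  move=> /cvgr_le /(_ e e0) [n _ /(_ n (leqnn n))] /= we.
  exists (ramp a n); split; [exact: continuous_ramp|exact: bounded_measurable_ramp|]; rewrite (le_trans _ we)// -[leRHS]L2_rnormN.
  rewrite le_eqVlt; apply/orP; left; apply/eqP.
  by congr L2_rnorm; apply/funext => x; rewrite opprB.
- move=> a f g bf bg Hf Hg e e0.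
  have [w [cw bw fw]] := Hf (e / (`|a| + 1) / 2) ltac:(by rewrite !divr_gt0).
  have [w' [cw' bw' gw']] := Hg (e / 2) ltac:(by rewrite divr_gt0).
  exists (fun x => a * w x + w' x); split.
  + by move=> x; apply: cvgD; [apply: cvgM; [exact: cvg_cst|exact: cw]|exact: cw'].
  + exact: bounded_measurable_lin.
  have f2 := LfunB (bL _ bf) (bL _ bw); have g2 := LfunB (bL _ bg) (bL _ bw').
  rewrite (_ : (fun x => _) = (fun x => a * (f x - w x) + (g x - w' x))); last first.
    by apply/funext => x; ring.
  have af2 : (fun x => a * (f x - w x)) \in Lfun mu 2%:E.
    have := Lfun_lin a f2 (bL _ (bounded_measurable_cst _ 0)).
    by under eq_fun do rewrite addr0.
  rewrite (le_trans (ler_L2_rnormD af2 g2))// L2_rnormZ// [leRHS]splitr lerD//.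
  rewrite (le_trans (ler_wpM2l (normr_ge0 a) fw))//.
  rewrite (_ : _ * _ = `|a| / (`|a| + 1) * (e / 2)); last by ring.
  apply: ler_piMl; first by rewrite divr_ge0// ltW.
  by rewrite ler_pdivrMr// mul1r; lra.
- move=> u f M bu Hu uM uf e e0; have e20 : 0 < e / 2 by rewrite divr_gt0.
  have := L2_rnorm_bounded_cvg muT bu uM uf.
  move=> /cvgr_le /(_ _ e20) [n _ /(_ n (leqnn n))] /= un.
  have [w [cw bw uw]] := Hu n _ e20; exists w; split => //.
  have bf := bounded_measurable_lim bu uM uf.
  rewrite (le_trans (ler_L2_rnormB (bL _ bf) (bL _ (bu n)) (bL _ bw)))//.
  rewrite [leRHS]splitr lerD// (le_trans _ un)// -[leRHS]L2_rnormN.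
  rewrite le_eqVlt; apply/orP; left; apply/eqP.
  by congr L2_rnorm; apply/funext => x; rewrite opprB.
Unshelve. all: by end_near. Qed.

(** * Calculus on a closed interval with one-sided derivatives at the ends *)

Section derivative_on.
Context (R : realType).
Implicit Types (S : set R) (f g F : R -> R).

Lemma derivative_on_lin S (a : R) f f' g g' : derivative_on S f f' ->
  derivative_on S g g' ->
  derivative_on S (fun x => a * f x + g x) (fun x => a * f' x + g' x).
Proof.
move=> df dg x Sx.
rewrite (_ : (fun y => _) = fun y => a * ((f y - f x) / (y - x)) +
  (g y - g x) / (y - x)); last by apply/funext => y; ring.
by apply: cvgD; [apply: cvgM; [exact: cvg_cst|exact: df]|exact: dg].
Qed.

Lemma derivative_onW S S' f f' : S' `<=` S -> derivative_on S f f' ->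
  derivative_on S' f f'.
Proof.
move=> SS df x /SS /df; apply: cvg_trans; apply: cvg_app.
by apply: within_subset => y /SS.
Qed.

(** Multiplying out the quotient makes the estimate hold at [y = x] too, so that full neighbourhoods
    of [x] can be used. *)
Lemma derivative_on_near S f f' x (e : R) : derivative_on S f f' -> S x -> 0 < e ->
  \forall y \near x, S y -> `|f y - f x - f' x * (y - x)| <= e * `|y - x|.
Proof.
move=> df Sx e0; have /cvgrPdist_le /(_ e e0) := df x Sx.
rewrite !near_withinE; apply: filterS => y h Sy.
have [->|yx] := eqVneq y x; first by rewrite !subrr mulr0 subr0 normr0 mulr0.
have yx0 : y - x != 0 by rewrite subr_eq0.
rewrite -ler_pdivrMr ?normr_gt0// -normf_div.
apply: le_trans (h yx Sy); rewrite distrC le_eqVlt; apply/orP; left; apply/eqP.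
by congr (`|_|); field.
Qed.

Lemma derivative_on_cvg S f f' x : derivative_on S f f' -> S x ->
  f y @[y --> within S (nbhs x)] --> f x.
Proof.
move=> df Sx; apply/cvgrPdist_le => e e0.
have H := derivative_on_near df Sx ltr01.
rewrite near_withinE; near=> y.
have hS : S y -> `|f y - f x - f' x * (y - x)| <= 1 * `|y - x| by near: y.
have yxe : `|x - y| <= (`|f' x| + 1)^-1 * e.
  near: y; apply: cvgr_dist_le; first exact: cvg_id.
  by rewrite mulr_gt0 ?invr_gt0.
move=> /hS h; have h2 := ler_normD (f y - f x - f' x * (y - x)) (f' x * (y - x)).
have -> : `|f x - f y| = `|f y - f x - f' x * (y - x) + f' x * (y - x)|.
  by rewrite subrK distrC.
apply: le_trans h2 _; rewrite [X in _ + X]normrM.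
apply: le_trans (lerD h (lexx _)) _; rewrite -mulrDl addrC -ler_pdivlMl// distrC.
Unshelve. all: by end_near. Qed.

Lemma derivative_on_continuous S f f' : derivative_on S f f' ->
  {within S, continuous f}.
Proof. by move=> df; apply/subspace_continuousP => x; exact: derivative_on_cvg df. Qed.

Lemma derivative_onM S f f' g g' : derivative_on S f f' -> derivative_on S g g' ->
  derivative_on S (fun x => f x * g x) (fun x => f' x * g x + f x * g' x).
Proof.
move=> df dg x Sx.
rewrite (_ : (fun y => _) = fun y => (f y - f x) / (y - x) * g y +
  f x * ((g y - g x) / (y - x))); last by apply/funext => y; ring.
apply: cvgD; last by apply: cvgM; [exact: cvg_cst|exact: dg].
apply: cvgM; first exact: df.
apply: cvg_trans (derivative_on_cvg dg Sx); apply: cvg_app => A.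
by move=> H; exact: (nbhs_dnbhs H).
Qed.

Lemma is_derive1_cvgP f (x l : R) :
  is_derive x 1 f l <-> (f y - f x) / (y - x) @[y --> x^'] --> l.
Proof.
have E : (fun h => h^-1 *: (f (h *: (1 : R) + x) - f x)) =
    (fun y => (f y - f x) / (y - x)) \o (fun h => h + x).
  by apply/funext => h /=; rewrite addrK /GRing.scale/= mulr1 mulrC.
split.
- move=> [dfx dE]; move: dfx; rewrite /derivable => /cvg_ex[l' H].
  have l'l : l' = l.
    rewrite -dE /derive; apply/esym; exact: (cvg_lim _ H).
  move: H; rewrite /shift/= E l'l => H.
  apply/cvgrPdist_le => e e0; have /cvgrPdist_le /(_ e e0) := H.
  rewrite !near_withinE => /nbhs_ballP[d /= d0 Hd]; apply/nbhs_ballP; exists d => //= y.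
  rewrite /ball/= => xy yx.
  have := Hd (y - x); rewrite /ball/= sub0r opprB subrK => /(_ xy); apply.
  by rewrite subr_eq0.
- move=> H; have H' : h^-1 *: (f (h *: (1 : R) + x) - f x) @[h --> 0^'] --> l.
    rewrite E; apply/cvgrPdist_le => e e0; have /cvgrPdist_le /(_ e e0) := H.
    rewrite !near_withinE => /nbhs_ballP[d /= d0 Hd]; apply/nbhs_ballP; exists d => //= h.
    rewrite /ball/= sub0r normrN => hd h0.
    have := Hd (h + x); rewrite /ball/= opprD addrCA subrr addr0 normrN => /(_ hd); apply.
    by rewrite -subr_eq0 addrK.
  split; first by apply/cvg_ex; exists l.
  exact: (cvg_lim _ H').
Qed.

Lemma is_derive_derivative_on S f f' :
  (forall x : R, S x -> is_derive x 1 f (f' x)) -> derivative_on S f f'.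
Proof.
move=> df x /df /is_derive1_cvgP; exact: cvg_within_filter.
Qed.

Lemma derivative_on_is_derive f f' a b (x : R) : derivative_on `[a, b] f f' ->
  x \in `]a, b[ -> is_derive x 1 f (f' x).
Proof.
move=> df xab; apply/is_derive1_cvgP.
have Sx : `[a, b]%classic x by move: xab; rewrite /= !in_itv/= => /andP[/ltW -> /ltW ->].
apply/cvgrPdist_le => e e0; have /cvgrPdist_le /(_ e e0) := df x Sx.
rewrite !near_withinE => H; near=> y => yx.
have yab : y \in `]a, b[ by near: y; exact: near_in_itvoo.
suff : y != x -> `[a, b]%classic y -> `|f' x - (f y - f x) / (y - x)| <= e.
  by apply => //; move: yab; rewrite /= !in_itv/= => /andP[/ltW -> /ltW ->].
by near: y.
Unshelve. all: by end_near. Qed.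

Lemma derivative_on_mvt f f' a b x y : derivative_on `[a, b] f f' ->
  a <= x -> x <= y -> y <= b ->
  exists2 c, x <= c <= y & f y - f x = f' c * (y - x).
Proof.
move=> df ax xy yb.
have [|| c] := @MVT_segment R f f' x y xy.
- move=> z /[!in_itv]/= /andP[xz zy]; apply: derivative_on_is_derive df _.
  by rewrite in_itv/= (le_lt_trans ax xz) (lt_le_trans zy yb).
- apply: continuous_subspaceW (derivative_on_continuous df).
  by move=> z /=; rewrite !in_itv/= => /andP[xz zy]; rewrite (le_trans ax xz) (le_trans zy yb).
- by rewrite in_itv/= => cxy E; exists c.
Qed.

Lemma derivative_on_Rintegral f f' a b : a < b -> derivative_on `[a, b] f f' ->
  {within `[a, b], continuous f'} ->
  \int[lebesgue_measure]_(x in `[a, b]) f' x = f b - f a.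
Proof.
move=> ab df cf'; rewrite /Rintegral.
rewrite (@continuous_FTC2 R f' f a b ab cf')//.
- have /(continuous_within_itvP _ ab)[cf fa fb] := derivative_on_continuous df.
  split => // x xab.
  by have [] := derivative_on_is_derive df xab.
- move=> x xab; rewrite derive1E; have H := derivative_on_is_derive df xab.
  by rewrite derive_val.
Qed.
End derivative_on.

(** * The sticky operator: explicit solutions, Dirichlet form and test functions *)

Section sticky_operator.
Context (R : realType).
Implicit Types (f g : R -> R).

(** The primitive is the integral from [b], and it is differentiated only to the right of [b]. Each
    integration thus costs some room on the left. *)
Lemma continuous_antiderivative f (a b : R) : a < b ->
  (forall x, a < x -> {for x, continuous f}) ->
  exists F : R -> R, forall x : R, b < x -> is_derive x 1 F (f x).
Proof.
move=> ab cf; exists (fun x => \int[lebesgue_measure]_(t in `[b, x]) f t) => x bx.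
have x1 : x < x + 1 by rewrite ltrDl.
have If : lebesgue_measure.-integrable `[b, x + 1] (EFin \o f).
  apply: continuous_compact_integrable; first exact: segment_compact.
  apply: continuous_in_subspaceT => y /set_mem /=; rewrite in_itv/= => /andP[yb _].
  by apply: cf; exact: lt_le_trans yb.
have cfx : {for x, continuous f} by apply: cf; exact: lt_trans bx.
have [dF F'] := continuous_FTC1_closed x1 If bx cfx.
by apply: DeriveDef; [exact: dF|rewrite -derive1E; exact: F'].
Qed.

(** Integrate twice. The condition at 0 fixes the first constant of integration,
    [W 0 = w 0 / omega]; the condition at [L] then reads [w L = - (w 0 + omega * \int w)], which is
    the hypothesis that [w] has mean zero for the sticky measure. The bound follows from
    [|W| <= |w 0| / omega + \int |w|] and the mean value theorem, as [k 0 = 0]. *)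
Lemma sticky_solve (omega L : R) (w : R -> R) : 0 < omega -> 0 < L ->
  continuous w -> w 0 + w L + omega * \int[lebesgue_measure]_(x in `[0, L]) w x = 0 ->
  exists k, [/\ sticky_operator omega L k w, k 0 = 0 &
    forall x, x \in `[0, L] -> `|k x| <=
      L * (`|w 0| / omega + \int[lebesgue_measure]_(x in `[0, L]) `|w x|)].
Proof.
move=> o0 L0 cw w0.
(* The thresholds -2, -1, -1/2 leave room on the left for two integrations while keeping 0 interior,
   where two-sided derivatives are available. *)
have [I dI] : exists F : R -> R, forall x : R, -1 < x -> is_derive x 1 F (w x).
  by apply: (@continuous_antiderivative w (-2)) => [|x _]; [lra|exact: cw].
pose W (x : R) : R := I x + (w 0 / omega - I 0).
have dW (x : R) : -1 < x -> is_derive x 1 W (w x).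
  move=> x1; have := is_deriveD (dI x x1) (is_derive_cst (w 0 / omega - I 0) x 1).
  by rewrite addr0.
have [K dK] : exists F : R -> R, forall x : R, - 2^-1 < x -> is_derive x 1 F (W x).
  apply: (@continuous_antiderivative W (-1)) => [|x x1]; first by lra.
  by have [dWx _] := dW x x1; apply/differentiable_continuous/derivable1_diffP.
pose k (x : R) : R := 1 * K x + (- K 0).
have dk : derivative_on `[0, L] k W.
  have dKs : derivative_on `[0, L] K W.
    apply: is_derive_derivative_on => x /=; rewrite in_itv/= => /andP[x0 _].
    by apply: dK; lra.
  have dc : derivative_on `[0, L] (fun=> - K 0) (fun=> 0).
    apply: is_derive_derivative_on => x _; exact: is_derive_cst.
  have := derivative_on_lin (a := 1) dKs dc.
  rewrite (_ : (fun x => 1 * W x + 0) = W)//.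
  by apply/funext => x; rewrite mul1r addr0.
have dWs : derivative_on `[0, L] W w.
  apply: is_derive_derivative_on => x /=; rewrite in_itv/= => /andP[x0 _].
  by apply: dW; lra.
have cws x : {within `[0, x], continuous w} by exact: continuous_subspaceT.
have W0 : W 0 = w 0 / omega by rewrite /W; ring.
have WE (x : R) : 0 < x -> x <= L -> W x = w 0 / omega +
    \int[lebesgue_measure]_(x in `[0, x]) w x.
  move=> x0 xL; rewrite (@derivative_on_Rintegral _ W w 0 x)// ?W0; first by ring.
  apply: derivative_onW dWs => y /=; rewrite !in_itv/= => /andP[-> yx].
  exact: le_trans yx xL.
have Iw : lebesgue_measure.-integrable `[0, L] (EFin \o w).
  by apply: continuous_compact_integrable; [exact: segment_compact|exact: cws].
have Iaw : lebesgue_measure.-integrable `[0, L] (EFin \o (fun x => `|w x|)).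
  exact: integrable_norm.
pose B := `|w 0| / omega + \int[lebesgue_measure]_(x in `[0, L]) `|w x|.
have WB x : x \in `[0, L] -> `|W x| <= B.
  rewrite in_itv/= => /andP[]; rewrite le_eqVlt => /predU1P[<- _|x0 xL].
    rewrite W0 normrM normfV (gtr0_norm o0) lerDl; apply: Rintegral_ge0 => y _ //.
  rewrite WE// (le_trans (ler_normD _ _))// normrM normfV (gtr0_norm o0) lerD2l.
  have sub : `[0, x]%classic `<=` `[0, L]%classic.
    by move=> y /=; rewrite !in_itv/= => /andP[-> yx]; exact: le_trans yx xL.
  have Iwx : lebesgue_measure.-integrable `[0, x] (EFin \o w) by exact: integrableS Iw.
  rewrite (le_trans (le_normr_Rintegral _ Iwx))//.
  rewrite -lee_fin !fineK.
  - apply: ge0_subset_integral => //.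
    by apply/measurable_EFinP; case/integrableP: Iaw => /measurable_EFinP.
  - exact: integrable_fin_num Iaw.
  - by apply: integrable_fin_num => //; exact: integrableS Iaw.
exists k; split.
- exists W; split; [exact: dk|exact: dWs|exact: cws| |].
  + by rewrite W0; field; rewrite gt_eqF.
  + rewrite WE// mulNr mulrDr mulrCA divff ?gt_eqF// mulr1.
    by move: w0; set J := omega * _ => w0; lra.
- by rewrite /k; ring.
- move=> x /[dup] xL; rewrite in_itv/= => /andP[x0 xL'].
  have [c /andP[c0 cx] kE] := derivative_on_mvt dk (lexx 0) x0 xL'.
  have -> : k x = W c * x.
    by move: kE; rewrite subr0 => <-; rewrite /k; ring.
  rewrite normrM mulrC (ger0_norm x0) ler_pM// WB// in_itv/= c0.
  exact: le_trans cx xL'.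
Qed.

(** Exponents start at 2 so that the corner at [a] disappears: there the difference quotient is at
    most [|y - a|] once [|y - a| <= 1]. *)
Lemma is_derive_clampX (a : R) (n : nat) (x : R) :
  is_derive x 1 (fun y => Num.max 0 (y - a) ^+ n.+2)
    (n.+2%:R * Num.max 0 (x - a) ^+ n.+1).
Proof.
have [xa|ax|->] := ltgtP x a.
- rewrite max_l; last by lra.
  rewrite exprS mul0r mulr0.
  apply: (near_eq_is_derive _ (is_derive_cst (0 : R) x 1)).
  near=> y; rewrite max_l ?expr0n//= subr_le0 ltW//.
  by near: y; exact: lt_nbhsl.
- rewrite max_r; last by lra.
  have dx : is_derive x 1 (fun y : R => y - a) 1.
    by have := is_deriveB (is_derive_id x 1) (is_derive_cst a x 1); rewrite subr0.
  have dX : is_derive x 1 (fun y => (y - a) ^+ n.+2) (n.+2%:R * (x - a) ^+ n.+1).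
    by have := is_deriveX n.+2 dx; rewrite exprfctE /GRing.scale/= mulr1.
  apply: (near_eq_is_derive _ dX).
  near=> y; rewrite max_r// subr_ge0 ltW//.
  by near: y; exact: lt_nbhsr.
- rewrite subrr maxxx exprS mul0r mulr0; apply/is_derive1_cvgP.
  rewrite subrr maxxx [0 ^+ _]exprS mul0r.
  apply/cvgrPdist_le => e e0; near=> y.
  rewrite sub0r normrN subr0.
  have [->|ya] := eqVneq y a; first by rewrite subrr invr0 mulr0 normr0 ltW.
  have yae : `|a - y| <= e by near: y; apply: cvgr_dist_le => //; apply: nbhs_dnbhs; exact: cvg_id.
  have ya1 : `|a - y| <= 1.
    near: y. apply: cvgr_dist_le => //; apply: nbhs_dnbhs; exact: cvg_id.
  rewrite normrM normfV ler_pdivrMr ?normr_gt0 ?subr_eq0//.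
  rewrite distrC in yae ya1.
  have mle : `|Num.max 0 (y - a)| <= `|y - a|.
    by case: (leP 0 (y - a)) => [h|_]; rewrite ?normr0.
  rewrite normrX exprS exprS mulrCA.
  rewrite (le_trans _ (_ : `|y - a| * `|y - a| <= _))//; last by rewrite ler_wpM2r.
  rewrite ler_pM// ?mulr_ge0 ?exprn_ge0//.
  rewrite (le_trans _ mle)// ler_piMr// exprn_ile1//.
  exact: le_trans mle ya1.
Unshelve. all: by end_near. Qed.

End sticky_operator.

Section sticky_form.
Context (R : realType).
Implicit Types (f g : R -> R).

Lemma within_continuousD S f g : {within S, continuous f} -> {within S, continuous g} ->
  {within S, continuous (fun x => f x + g x)}.
Proof.
move=> /subspace_continuousP cf /subspace_continuousP cg.
by apply/subspace_continuousP => x Sx; apply: cvgD; [exact: cf|exact: cg].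
Qed.

Lemma within_continuousM S f g : {within S, continuous f} -> {within S, continuous g} ->
  {within S, continuous (fun x => f x * g x)}.
Proof.
move=> /subspace_continuousP cf /subspace_continuousP cg.
by apply/subspace_continuousP => x Sx; apply: cvgM; [exact: cf|exact: cg].
Qed.

Lemma within_continuous_lin S (a : R) f g : {within S, continuous f} ->
  {within S, continuous g} -> {within S, continuous (fun x => a * f x + g x)}.
Proof.
move=> cf cg; apply: within_continuousD cg; apply: within_continuousM cf.
by apply: continuous_subspaceT => x; exact: cst_continuous.
Qed.

Lemma within_continuous_integrable (a b : R) f : {within `[a, b], continuous f} ->
  lebesgue_measure.-integrable `[a, b] (EFin \o f).
Proof. by apply: continuous_compact_integrable; exact: segment_compact. Qed.

Variables (omega L : R).
Hypothesis L0 : 0 < L.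

Lemma sticky_operator_lin (a : R) f f2 g g2 : sticky_operator omega L f f2 ->
  sticky_operator omega L g g2 ->
  sticky_operator omega L (fun x => a * f x + g x) (fun x => a * f2 x + g2 x).
Proof.
move=> [f1 [df df1 cf2 f20 f2L]] [g1 [dg dg1 cg2 g20 g2L]].
exists (fun x => a * f1 x + g1 x); split.
- exact: derivative_on_lin.
- exact: derivative_on_lin.
- exact: within_continuous_lin.
- by rewrite f20 g20; ring.
- by rewrite f2L g2L; ring.
Qed.

Lemma sticky_operator_cst (c : R) : sticky_operator omega L (fun=> c) (fun=> 0).
Proof.
exists (fun=> 0); split; rewrite ?mulr0//.
- by apply: is_derive_derivative_on => x _; exact: is_derive_cst.
- by apply: is_derive_derivative_on => x _; exact: is_derive_cst.
- by apply: continuous_subspaceT => x; exact: cst_continuous.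
Qed.

(** Integration by parts leaves [omega * (f1 L * g L - f1 0 * g 0)], and the boundary conditions
    make the two atoms cancel exactly this term. *)
Lemma sticky_dirichlet_form f1 f2 g g1 : derivative_on `[0, L] f1 f2 ->
  {within `[0, L], continuous f2} -> f2 0 = omega * f1 0 -> f2 L = - omega * f1 L ->
  derivative_on `[0, L] g g1 -> {within `[0, L], continuous g1} ->
  f2 0 * g 0 + f2 L * g L +
    omega * \int[lebesgue_measure]_(x in `[0, L]) (f2 x * g x) =
  - (omega * \int[lebesgue_measure]_(x in `[0, L]) (f1 x * g1 x)).
Proof.
move=> df1 cf2 f20 f2L dg cg1.
have cf1 := derivative_on_continuous df1; have cg := derivative_on_continuous dg.
have cfg := within_continuousM cf2 cg; have cfg' := within_continuousM cf1 cg1.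
have := derivative_on_Rintegral L0 (derivative_onM df1 dg) (within_continuousD cfg cfg').
rewrite RintegralD//; [|exact: within_continuous_integrable..].
set I := Rintegral _ _ _; set J := Rintegral _ _ _ => IJ.
have -> : I = f1 L * g L - f1 0 * g 0 - J by rewrite -IJ; ring.
by rewrite f20 f2L; ring.
Qed.

Lemma clamp_spline (a delta : R) : 0 < delta -> 0 <= a -> a + 3 * delta <= L ->
  exists s s2, [/\ sticky_operator omega L s s2, continuous s,
    forall x, x <= a -> s x = 0, forall x, a + 3 * delta <= x -> s x = 1 &
    forall x, `|s x| <= 9].
Proof.
move=> d0 a0 aL.
(* [sp n] is the third finite difference of a truncated power: [sp 3] vanishes
   left of [a], is constant right of [a + 3 delta] and has a continuous second
   derivative, so it satisfies the boundary conditions trivially. *)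
pose t (i : nat) (x : R) : R := Num.max 0 (x - (a + i%:R * delta)).
pose sp (n : nat) x : R := t 0%N x ^+ n - 3 * t 1%N x ^+ n + 3 * t 2%N x ^+ n - t 3%N x ^+ n.
have dsp n (x : R) : is_derive x 1 (sp n.+2) (n.+2%:R * sp n.+1 x).
  pose T i : R -> R := fun y => t i y ^+ n.+2.
  have dt i : is_derive x 1 (T i) (n.+2%:R * t i x ^+ n.+1) by exact: is_derive_clampX.
  have -> : sp n.+2 = T 0%N - (3 : R) *: T 1%N + (3 : R) *: T 2%N - T 3%N by apply/funext.
  have H := is_deriveB (is_deriveD (is_deriveB (dt 0%N) (is_deriveZ 3 (dt 1%N)))
    (is_deriveZ 3 (dt 2%N))) (dt 3%N).
  by apply: is_derive_eq; rewrite /sp /GRing.scale/=; ring.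
have tE0 i x : x <= a -> t i x = 0.
  by move=> xa; rewrite /t max_l// subr_le0 (le_trans xa)// lerDl mulr_ge0// ltW.
have sp0 n x : (0 < n)%N -> x <= a -> sp n x = 0.
  by move=> n0 xa; rewrite /sp !tE0// expr0n eqn0Ngt n0/=; ring.
have tE1 i x : (i <= 3)%N -> a + 3 * delta <= x -> t i x = x - (a + i%:R * delta).
  move=> i3 ax; rewrite /t max_r// subr_ge0 (le_trans _ ax)// lerD2l ler_wpM2r ?(ltW d0)//.
  by rewrite ler_nat.
(* The third finite difference of a cube with step [delta] is [3! * delta ^+ 3], the value of [sp 3]
   right of [a + 3 * delta]. *)
pose c := (6 * delta ^+ 3)^-1.
have c0 : 0 < c by rewrite invr_gt0 mulr_gt0 ?exprn_gt0.
pose s x := c * sp 3%N x; pose s1 x := c * (3 * sp 2%N x); pose s2 x := c * (6 * sp 1%N x).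
have ds (x : R) : is_derive x 1 s (s1 x) by exact: (is_deriveZ c (dsp 1%N x)).
have ds1 (x : R) : is_derive x 1 s1 (s2 x).
  have d2 := dsp 0%N x; have -> : s1 = c *: ((3 : R) *: sp 2%N) by apply/funext.
  have H := is_deriveZ c (is_deriveZ 3 d2).
  by apply: is_derive_eq; rewrite /s2 /GRing.scale/=; ring.
have ct i : continuous (t i).
  move=> x; apply: (@continuous_max R R (fun=> 0) (fun x => x - _)); first exact: cvg_cst.
  by apply: cvgB; [exact: cvg_id|exact: cvg_cst].
have cs2 : continuous s2.
  move=> x; apply: cvgM; [exact: cvg_cst|apply: cvgM; first exact: cvg_cst].
  have cM i : 3 * t i y ^+ 1 @[y --> x] --> 3 * t i x ^+ 1.
    by apply: cvgM; [exact: cvg_cst|exact: ct].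
  by apply: cvgB; [apply: cvgD; [apply: cvgB|]|]; rewrite ?expr1//; exact: ct.
have s00 : s1 0 = 0 by rewrite /s1 sp0//; ring.
have s20 : s2 0 = 0 by rewrite /s2 sp0//; ring.
have s1L : s1 L = 0 by rewrite /s1 /sp !tE1//; ring.
have s2L : s2 L = 0 by rewrite /s2 /sp !tE1//; ring.
exists s, s2; split.
- exists s1; split.
  + by apply: is_derive_derivative_on => x _.
  + by apply: is_derive_derivative_on => x _.
  + exact: continuous_subspaceT.
  + by rewrite s20 s00 mulr0.
  + by rewrite s2L s1L mulr0.
- by move=> x; apply/differentiable_continuous/derivable1_diffP; case: (ds x).
- by move=> x xa; rewrite /s sp0// mulr0.
- move=> x ax; rewrite /s /sp !tE1// /c; field; exact: lt0r_neq0.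
- move=> x; have [ax|xa] := leP (a + 3 * delta) x.
    by rewrite /s /sp !tE1// (_ : _ * _ = 1) ?normr1 ?ler1n// /c; field; exact: lt0r_neq0.
  (* Left of [a + 3 * delta] the four cubes are at most 27, 8, 1 and 0 times [delta ^+ 3]; the crude
     bound [(27 + 3 * 8 + 3 * 1) / 6] is the constant 9. *)
  have tB (i : nat) (m : R) : (3 - i%:R) <= m -> 0 <= m -> 0 <= t i x ^+ 3 <= (m * delta) ^+ 3.
    move=> im m0; have t0 : 0 <= t i x by rewrite /t le_max lexx.
    have md : 0 <= m * delta by rewrite mulr_ge0// ltW.
    rewrite exprn_ge0//=; apply: lerXn2r; rewrite ?nnegrE// /t ge_max md/=.
    have : (3 - i%:R) * delta <= m * delta by rewrite ler_wpM2r// ltW.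
    by lra.
  have := tB 0%N 3 ltac:(lra) ltac:(lra); have := tB 1%N 2 ltac:(lra) ltac:(lra).
  have := tB 2%N 1 ltac:(lra) ltac:(lra); have := tB 3%N 0 ltac:(lra) ltac:(lra).
  rewrite !exprMn [0 ^+ _]exprS !mul0r; move: c0; rewrite /s /sp /c.
  have : 0 < delta ^+ 3 by rewrite exprn_gt0.
  set D := delta ^+ 3 => D0 _; rewrite expr1n mul1r.
  have -> : (2 : R) ^+ 3 = 8 by ring.
  have -> : (3 : R) ^+ 3 = 27 by ring.
  rewrite normrM normfV [`|6 * D|]ger0_norm; last by rewrite mulr_ge0// ltW.
  rewrite ler_pdivrMl ?mulr_gt0// => /andP[? ?] /andP[? ?] /andP[? ?] /andP[? ?].
  by rewrite ler_norml; apply/andP; split; lra.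
Qed.
End sticky_form.

(** * Explicit integration against the sticky measure *)

Lemma bounded_measurable_restrict d (E : measurableType d) (R : realType)
    (D : set E) (f : E -> R) (M : R) : measurable D -> measurable_fun D f ->
  (forall x, D x -> `|f x| <= M) -> bounded_measurable (f \_ D).
Proof.
move=> mD mf fM; split.
  by apply/(measurable_restrictT _ _).1.
exists `|M| => x; rewrite /patch; case: ifPn => [/set_mem Dx|_].
  by rewrite (le_trans (fM x Dx))// ler_norm.
by rewrite normr0.
Qed.

(** The monotone class argument reduces an integration formula to its values on measurable sets.
    This is how integrals against measures assembled from atoms and Lebesgue measure become
    explicit. *)
Lemma bounded_measurable_Rintegral_unique d (E : measurableType d) (R : realType)
    (mu : {measure set E -> \bar R}) (Lam : (E -> R) -> R) : (mu setT < +oo)%E ->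
  (forall A, measurable A -> Lam \1_A = fine (mu A)) ->
  (forall (a : R) f g, bounded_measurable f -> bounded_measurable g ->
    Lam (fun x => a * f x + g x) = a * Lam f + Lam g) ->
  (forall (u : (E -> R)^nat) f (M : R), (forall n, bounded_measurable (u n)) ->
    bounded_measurable f -> (forall n x, `|u n x| <= M) ->
    (forall x, u n x @[n --> \oo] --> f x) -> Lam (u n) @[n --> \oo] --> Lam f) ->
  forall f, bounded_measurable f -> \int[mu]_x f x = Lam f.
Proof.
move=> muT Lind Llin Llim.
have ind A : measurable A -> \int[mu]_x (\1_A x : R) = Lam \1_A.
  by move=> mA; rewrite Lind// /Rintegral integral_indic// setIT.
apply: (@bounded_measurable_induction _ E R measurable).
- exact/esym/sigma_algebra_id/sigma_algebra_measurable.
- exact: measurableI.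
- by have := ind _ measurableT; rewrite (_ : \1__ = fun=> 1)//; apply/funext => x; rewrite indicE in_setT.
- exact: ind.
- move=> a f g bf bg Hf Hg; rewrite Llin// -Hf -Hg -RintegralZl//; last first.
    exact: bounded_measurable_integrable.
  rewrite RintegralD//; last exact: bounded_measurable_integrable.
  apply: (bounded_measurable_integrable muT) => //.
  have := bounded_measurable_lin a bf (bounded_measurable_cst _ 0).
  by under eq_fun do rewrite addr0.
- move=> u f M bu Hu uM uf; have bf := bounded_measurable_lim bu uM uf.
  have h1 : \int[mu]_x u n x @[n --> \oo] --> \int[mu]_x f x.
    apply: (@Rintegral_bounded_cvg _ _ _ mu muT setT u f M) => //.
    by move=> n; case: (bu n).
  have h2 := Llim u f M bu bf uM uf.
  have h3 : Lam (u n) @[n --> \oo] --> \int[mu]_x f x by under eq_fun do rewrite -Hu.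
  exact: (cvg_unique _ h3 h2).
Qed.

Section atoms_and_lebesgue.
Context (R : realType) (L : R) (a b c : {nonneg R}).
Hypothesis L0 : 0 < L.
Let E := measurableTypeR R.
Let S : set E := `[0, L]%classic.
Let m := atoms_and_lebesgue L a b c.
Implicit Types (f : E -> R).

Lemma lebesgue_itv_lty : (@lebesgue_measure R S < +oo)%E.
Proof. by rewrite /S lebesgue_measure_itv/= lte_fin L0 -EFinD ltry. Qed.

Lemma atoms_and_lebesgueE (A : set E) : measurable A -> m A =
  (a%:num * \1_A (0 : R) + b%:num * fine (lebesgue_measure (A `&` S)) + c%:num * \1_A L)%:E.
Proof.
move=> mA; have mS : @measurable _ E S by exact: measurable_itv.
rewrite [LHS]measure_addE [X in (X + _)%E]measure_addE.
transitivity (a%:num%:E * \d_(0%R : R) A + b%:num%:E * lebesgue_measure (A `&` S) +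
  c%:num%:E * \d_(L : R) A)%E; first by [].
rewrite !diracE !EFinD !EFinM fineK ?indicE//.
rewrite ge0_fin_numE//; apply: le_lt_trans lebesgue_itv_lty.
by apply: le_measure; rewrite ?inE//; apply: (@measurableI _ E A S mA mS).
Qed.

Lemma atoms_and_lebesgue_lty : (m setT < +oo)%E.
Proof. by rewrite atoms_and_lebesgueE// ltry. Qed.

Lemma atoms_and_lebesgue_Rintegral f : bounded_measurable f ->
  \int[m]_x f x = a%:num * f 0 +
    b%:num * \int[lebesgue_measure]_(x in `[0, L]) f x + c%:num * f L.
Proof.
have If g := @bounded_measurable_integrable_on _ E R lebesgue_measure S
  (measurable_itv _) lebesgue_itv_lty g.
apply: (@bounded_measurable_Rintegral_unique _ E R m (fun f => a%:num * f 0 +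
    b%:num * \int[lebesgue_measure]_(x in `[0, L]) f x + c%:num * f L)).
- exact: atoms_and_lebesgue_lty.
- move=> A mA; rewrite atoms_and_lebesgueE//= /Rintegral integral_indic//.
- move=> k g h bg bh; have bkg : bounded_measurable (fun x => k * g x).
    have := bounded_measurable_lin k bg (bounded_measurable_cst _ 0).
    by under eq_fun do rewrite addr0.
  rewrite RintegralD//; [|exact: If bkg|exact: If bh].
  by rewrite RintegralZl//; [ring|exact: If bg].
- move=> u g M bu bg uM ug; apply: cvgD; [apply: cvgD|]; apply: cvgM; try exact: cvg_cst.
  + exact: ug.
  + apply: (@Rintegral_bounded_cvg_on _ E R lebesgue_measure S
      (measurable_itv _) lebesgue_itv_lty u g M) => // n.
    by apply: measurable_funTS; case: (bu n).
  + exact: ug.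
Qed.
End atoms_and_lebesgue.

(** A substitute for a vanishing derivative: cut [[0, t]] into equal steps shorter than [d] and add
    up increments of at most [e / t] times the step, for a total of [e]. The bound has to be uniform
    in the starting time [s]. *)
Lemma eq_of_small_increments (R : realType) (G : R -> R) (t : R) : 0 <= t ->
  (forall e : R, 0 < e -> exists2 d : R, 0 < d & forall s h, 0 <= s -> 0 < h -> h < d ->
    s + h <= t -> `|G (s + h) - G s| <= e * h) ->
  G t = G 0.
Proof.
rewrite le_eqVlt => /predU1P[<-//|t0] HG.
apply/eqP; rewrite -subr_eq0 -normr_le0; apply/ler_addgt0Pr => e e0; rewrite add0r.
have [d d0 Hd] := HG (e / t) ltac:(by rewrite divr_gt0).
have [n nd] : exists n, t / n.+1%:R < d.
  exists (Num.truncn (t / d)); rewrite ltr_pdivrMr// mulrC -ltr_pdivrMr//.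
  exact: truncnS_gt.
pose h := t / n.+1%:R.
have h0 : 0 < h by rewrite divr_gt0.
have tE : t = n.+1%:R * h by rewrite /h mulrC divfK.
have step k : (k <= n.+1)%N -> `|G (k%:R * h) - G 0| <= e / t * (k%:R * h).
  elim: k => [|k IH] kn; first by rewrite mul0r subrr normr0 mulr0.
  have E : k.+1%:R * h = k%:R * h + h by rewrite -natr1 mulrDl mul1r.
  have := Hd (k%:R * h) h; rewrite -E mulr_ge0 ?(ltW h0)// => /(_ isT h0 nd).
  rewrite {1}tE ler_pM2r// ler_nat => /(_ kn) H1.
  have := IH (ltnW kn); rewrite E mulrDr => H2.
  have := ler_normD (G (k.+1%:R * h) - G (k%:R * h)) (G (k%:R * h) - G 0).
  rewrite addrA subrK -E => H3; apply: (le_trans H3).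
  by rewrite addrC; exact: lerD.
by have := step n.+1 (leqnn _); rewrite -tE divfK// gt_eqF.
Qed.

Section sticky_measure.
Context (R : realType) (omega L : {posnum R}).
Let E := measurableTypeR R.
Let S : set E := `[0, L%:num]%classic.
Let mu := sticky_measure omega L.
Let Z : R := 2 + omega%:num * L%:num.
Implicit Types (f g F : E -> R).

Let Z0 : 0 < Z. Proof. by rewrite /Z ltr_pwDl// mulr_ge0. Qed.
Let L0 : 0 < L%:num. Proof. by []. Qed.

Lemma sticky_space_measurable : measurable S. Proof. exact: measurable_itv. Qed.
Let mS := sticky_space_measurable.

Lemma sticky_measure_lty : (mu setT < +oo)%E.
Proof. exact: atoms_and_lebesgue_lty. Qed.

Lemma sticky_measureE (A : set E) : measurable A -> mu A =
  (Z^-1 * (\1_A (0 : R) + \1_A L%:num +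
   omega%:num * fine (lebesgue_measure (A `&` S))))%:E.
Proof.
move=> mA; rewrite [LHS]atoms_and_lebesgueE//=; congr EFin; rewrite -/Z -/S; field.
exact: lt0r_neq0.
Qed.

Lemma sticky_measureT : mu setT = 1%E.
Proof.
rewrite sticky_measureE// setTI !indicE !in_setT /S lebesgue_measure_itv/= lte_fin L0.
rewrite -EFinD oppr0 addr0 /=; congr EFin; rewrite /Z; field; exact: lt0r_neq0.
Qed.

Lemma sticky_measureC : mu (~` S) = 0%E.
Proof.
rewrite sticky_measureE; last exact: measurableC.
rewrite setICl measure0 !indicE !memNset/=.
- by congr EFin; ring.
- by rewrite /S/= in_itv/= lexx ltW//; exact.
- by rewrite /S/= in_itv/= lexx ltW//; exact.
Qed.

Lemma sticky_Rintegral_on F (M : R) : measurable_fun S F -> (forall x, S x -> `|F x| <= M) ->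
  \int[mu]_(x in S) F x = Z^-1 * (F 0 + F L%:num +
    omega%:num * \int[lebesgue_measure]_(x in `[0, L%:num]) F x).
Proof.
move=> mF FM; have bF := bounded_measurable_restrict mS mF FM.
rewrite Rintegral_mkcond [LHS]atoms_and_lebesgue_Rintegral//=.
have FE x : S x -> (F \_ S) x = F x by move=> Sx; rewrite patchE mem_set.
rewrite !FE /S/= ?in_itv/= ?lexx ?ltW//.
rewrite (@eq_Rintegral _ _ _ _ _ F); last by move=> x /set_mem Sx; exact: FE.
by rewrite -/Z; field; exact: lt0r_neq0.
Qed.

Lemma ler_norm_sticky_Rintegral F (M : R) : measurable_fun S F ->
  (forall x, S x -> `|F x| <= M) -> `|\int[mu]_(x in S) F x| <= M.
Proof.
move=> mF FM; have muS : (mu S < +oo)%E by exact: (finite_measure_lty sticky_measure_lty mS).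
have IF := integrable_le_cst mS muS mF FM.
rewrite (le_trans (le_normr_Rintegral mS IF))//.
have I2 : mu.-integrable S (EFin \o (fun=> M)).
  exact: (@integrable_le_cst _ _ _ mu S mS muS (fun=> M) `|M|).
rewrite (le_trans (le_Rintegral mS _ I2 FM))//; first exact: integrable_norm.
rewrite Rintegral_cst//; have M0 : 0 <= M.
  by rewrite (le_trans _ (FM 0 _))// /S/= in_itv/= lexx ltW.
rewrite ler_piMr// -lee_fin fineK ?ge0_fin_numE// -sticky_measureT.
by apply: le_measure; rewrite ?inE.
Qed.
End sticky_measure.

(** * The transition semigroup of a Feller process on bounded measurable functions *)

Section feller_semigroup.
Context (R : realType) (S : set (measurableTypeR R))
  (p : R -> R -> probability (measurableTypeR R) R).
Hypotheses (mS : measurable S) (hp : feller_process S p).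
Let E := measurableTypeR R.
Let P := transition S p.
Implicit Types (f g : E -> R).

Let pT t x : (p t x setT < +oo)%E. Proof. by rewrite probability_setT ltry. Qed.
Let pS t x : (p t x S < +oo)%E. Proof. exact: (finite_measure_lty (pT t x) mS). Qed.

Lemma transition_restrict t f : P t (f \_ S) = P t f.
Proof.
apply/funext => x; apply: eq_Rintegral => y Sy.
by rewrite patchE Sy.
Qed.

Lemma eq_transition t f g : {in S, f =1 g} -> P t f = P t g.
Proof. by move=> fg; apply/funext => x; exact: eq_Rintegral. Qed.

Lemma transition_lin t x (a : R) f g : bounded_measurable (f \_ S) ->
  bounded_measurable (g \_ S) ->
  P t (fun y => a * f y + g y) x = a * P t f x + P t g x.
Proof.
move=> bf bg; rewrite -(transition_restrict t f) -(transition_restrict t g).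
rewrite (@eq_transition _ _ (fun y => a * (f \_ S) y + (g \_ S) y)); last first.
  by move=> y Sy; rewrite !patchE Sy.
have I h : bounded_measurable h -> (p t x).-integrable S (EFin \o h).
  exact: (bounded_measurable_integrable_on mS (pS t x)).
have baf : bounded_measurable (fun y => a * (f \_ S) y).
  have := bounded_measurable_lin a bf (bounded_measurable_cst _ 0).
  by under eq_fun do rewrite addr0.
by rewrite /P /transition RintegralD//; [rewrite RintegralZl//; exact: I|exact: I|exact: I].
Qed.

Lemma transition_cst t x (c : R) : 0 <= t -> S x -> P t (fun=> c) x = c.
Proof.
move=> t0 Sx; rewrite /P /transition Rintegral_cst//.
have pS1 : p t x S = 1%E by exact: (feller_support hp).
by rewrite [fine _](congr1 fine pS1) mulr1.
Qed.

Lemma transition_bounded t x f (M : R) : 0 <= t -> S x -> bounded_measurable (f \_ S) ->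
  (forall y, S y -> `|f y| <= M) -> `|P t f x| <= M.
Proof.
move=> t0 Sx bf fM; rewrite -(transition_restrict t f).
have If : (p t x).-integrable S (EFin \o (f \_ S)).
  exact: (bounded_measurable_integrable_on mS (pS t x)).
rewrite (le_trans (le_normr_Rintegral mS If))//.
have I2 : (p t x).-integrable S (EFin \o (fun=> M)).
  exact: (bounded_measurable_integrable_on mS (pS t x) (bounded_measurable_cst _ M)).
have <- : \int[p t x]_(y in S) M = M by exact: transition_cst.
apply: le_Rintegral => //; first exact: integrable_norm.
by move=> y Sy; rewrite patchE mem_set// fM.
Qed.

Lemma transition_bounded_cvg t x (u : (E -> R)^nat) f (M : R) :
  (forall n, bounded_measurable (u n)) -> (forall n x, `|u n x| <= M) ->
  (forall x, u n x @[n --> \oo] --> f x) -> P t (u n) x @[n --> \oo] --> P t f x.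
Proof.
move=> bu uM uf.
apply: (@Rintegral_bounded_cvg _ _ _ _ (pT t x) S u f M) => // n.
by apply: measurable_funTS; case: (bu n).
Qed.

Lemma bounded_measurable_restrictS f : bounded_measurable f -> bounded_measurable (f \_ S).
Proof.
move=> [mf [M fM]]; apply: (@bounded_measurable_restrict _ E R S f M) => //.
exact: measurable_funTS.
Qed.

Lemma transition_indic t x (A : set E) : 0 <= t -> S x -> measurable A ->
  P t \1_A x = fine (p t x (A `&` S)).
Proof. by move=> t0 Sx mA; rewrite /P /transition /Rintegral integral_indic. Qed.

Lemma transition_measurable t f : 0 <= t -> bounded_measurable f ->
  measurable_fun S (P t f).
Proof.
move=> t0; move: f.
have HA A : measurable A -> measurable_fun S (P t \1_A).
  move=> mA; apply: (eq_measurable_fun (fun x => fine (p t x (A `&` S)))).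
    by move=> x /set_mem Sx; rewrite transition_indic.
  apply: measurableT_comp => //; apply: (feller_measurable hp) => //.
  exact: measurableI.
apply: (@bounded_measurable_induction _ E R measurable).
- exact/esym/sigma_algebra_id/sigma_algebra_measurable.
- exact: measurableI.
- by have := HA _ measurableT; rewrite (_ : \1__ = fun=> 1)//; apply/funext => x; rewrite indicE in_setT.
- exact: HA.
- move=> a f g bf bg Hf Hg.
  rewrite (_ : P t _ = fun x => a * P t f x + P t g x).
    by apply: measurable_funD => //; exact: measurable_funM.
  by apply/funext => x; rewrite transition_lin//; exact: bounded_measurable_restrictS.
- move=> u f M bu Hu uM uf.
  apply: (@measurable_fun_cvg _ _ _ _ (fun n => P t (u n))) => // x Sx.
  exact: (transition_bounded_cvg (t := t) (x := x) bu uM uf).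
Qed.

Lemma bounded_measurable_transition t f : 0 <= t -> bounded_measurable f ->
  bounded_measurable ((P t f) \_ S).
Proof.
move=> t0 bf; have [_ [M fM]] := bf.
apply: (@bounded_measurable_restrict _ E R S _ M) => //.
  exact: transition_measurable.
move=> x Sx; apply: transition_bounded => //; exact: bounded_measurable_restrictS.
Qed.

(** Chapman-Kolmogorov is this identity for indicators; both sides are linear and continuous under
    bounded pointwise limits. *)
Lemma transitionD s t f x : 0 <= s -> 0 <= t -> bounded_measurable f -> S x ->
  P (s + t) f x = P s (P t f) x.
Proof.
move=> s0 t0 bf Sx; move: f bf.
have HA A : measurable A -> P (s + t) \1_A x = P s (P t \1_A) x.
  move=> mA; rewrite transition_indic ?addr_ge0//.
  rewrite (feller_chapman_kolmogorov hp)//; last exact: measurableI.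
  congr fine; apply: eq_integral => y /set_mem Sy.
  rewrite /= transition_indic// fineK// ge0_fin_numE//.
  by apply: (finite_measure_lty (pT t y)); exact: measurableI.
apply: (@bounded_measurable_induction _ E R measurable).
- exact/esym/sigma_algebra_id/sigma_algebra_measurable.
- exact: measurableI.
- by have := HA _ measurableT; rewrite (_ : \1__ = fun=> 1)//; apply/funext => z; rewrite indicE in_setT.
- exact: HA.
- move=> a f g bf bg Hf Hg.
  have bSf := bounded_measurable_restrictS bf; have bSg := bounded_measurable_restrictS bg.
  have -> : P s (P t (fun y => a * f y + g y)) = P s (fun y => a * P t f y + P t g y).
    by apply: eq_transition => y _; rewrite transition_lin.
  by rewrite !transition_lin//; [rewrite Hf Hg|exact: bounded_measurable_transition..].
- move=> u f M bu Hu uM uf.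
  have h1 := transition_bounded_cvg (t := s + t) (x := x) bu uM uf.
  suff h2 : P s (P t (u n)) x @[n --> \oo] --> P s (P t f) x.
    have Eu : (fun n => P (s + t) (u n) x) = (fun n => P s (P t (u n)) x) by apply/funext.
    by move: h1; rewrite Eu => h1; exact: (cvg_unique _ h1 h2).
  (* The functions [P t (u n)] are bounded, measurable and convergent on [S] only, so they are cut
     off before bounded convergence is applied to [P s]. *)
  rewrite -(transition_restrict s (P t f)).
  rewrite (_ : (fun n => _) = (fun n => P s (P t (u n) \_ S) x)); last first.
    by apply/funext => n; rewrite transition_restrict.
  apply: (@transition_bounded_cvg _ _ _ _ `|M|).
  + by move=> n; exact: bounded_measurable_transition.
  + move=> n y; rewrite patchE; case: ifPn => [/set_mem Sy|_]; last by rewrite normr0.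
    apply: transition_bounded => //; first exact: bounded_measurable_restrictS.
    by move=> z _; rewrite (le_trans (uM n z))// ler_norm.
  + move=> y; rewrite patchE; case: ifPn => [/set_mem Sy|nSy].
      have := transition_bounded_cvg (t := t) (x := y) bu uM uf.
      by apply: cvg_trans; apply: near_eq_cvg; near=> n; rewrite patchE mem_set.
    by apply: cvg_near_cst; near=> n; rewrite patchE (negbTE nSy).
Unshelve. all: by end_near. Qed.
End feller_semigroup.

Lemma uniform_cvgP (R : realType) (T : Type) (S : set R) (F : set_system T)
    (FF : Filter F) (u : T -> R -> R) (g : R -> R) :
  {uniform S, u t @[t --> F] --> g} <->
  forall e : R, 0 < e -> \forall t \near F, forall x, S x -> `|u t x - g x| <= e.
Proof.
split.
- move=> H e e0.
  have := H [set h | forall y, S y -> `|g y - h y| < e].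
  move=> /(_ _)/wrap[|].
    apply/uniform_nbhs; exists [set xy | `|xy.1 - xy.2| < e]; split => //=.
    exact: (@entourage_ball _ R (PosNum e0)).
  rewrite /nbhs/=; apply: filterS => t Ht x Sx.
  by rewrite distrC ltW// Ht.
- move=> H A /uniform_nbhs[B [entB BA]].
  have [e /= e0 eB] := entB.
  have := H (e / 2) ltac:(by rewrite divr_gt0).
  rewrite /nbhs/=; apply: filterS => t Ht; apply: BA => /= y Sy.
  apply: eB; rewrite /= /ball/=; rewrite distrC (le_lt_trans (Ht y Sy))//.
  by rewrite ltr_pdivrMr// ltr_pMr// ltr1n.
Qed.

(** * Reducing identities to the domain of the sticky operator *)

Section sticky_induction.
Context (R : realType) (omega L : R).
Hypothesis L0 : 0 < L.
Let E := measurableTypeR R.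
Let S : set E := `[0, L]%classic.

Lemma within_continuous_bounded (a b : R) (f : R -> R) : a <= b ->
  {within `[a, b], continuous f} -> exists M, forall x, x \in `[a, b] -> `|f x| <= M.
Proof.
move=> ab cf; have [c _ cM] := EVT_max ab cf; have [d _ dm] := EVT_min ab cf.
exists (Num.max `|f c| `|f d|) => x xab; have := cM x xab; have := dm x xab.
rewrite le_max => h1 h2; have := ler_norm (f c); have := ler_norm (- f d); rewrite normrN => h3 h4.
have [fx0|fx0] := leP 0 (f x).
  by rewrite ger0_norm// (le_trans h2 h4).
by rewrite ltr0_norm// [X in _ || X](le_trans _ h3) ?orbT// lerN2.
Qed.

Lemma bounded_measurable_continuous (f : E -> R) : {within `[0, L], continuous f} ->
  bounded_measurable (f \_ S).
Proof.
move=> cf; have [M fM] := within_continuous_bounded (ltW L0) cf.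
apply: (@bounded_measurable_restrict _ E R S f M) => //.
  exact: measurable_itv.
by apply: subspace_continuous_measurable_fun => //; exact: measurable_itv.
Qed.

(** The domain contains uniformly bounded splines converging to the indicator of each ray with
    [0 <= a < L]. A ray starting elsewhere agrees on [S] with a constant, which is why [H] is
    required to ignore values outside [S]. *)
Lemma sticky_induction (H : set (E -> R)) :
  (forall f f2, sticky_operator omega L f f2 -> bounded_measurable (f : E -> R) -> H f) ->
  (forall f g, bounded_measurable f -> bounded_measurable g -> {in S, f =1 g} -> H f -> H g) ->
  (forall (a : R) f g, bounded_measurable f -> bounded_measurable g ->
    H f -> H g -> H (fun x => a * f x + g x)) ->
  (forall (u : (E -> R)^nat) f (M : R), (forall n, bounded_measurable (u n)) ->
    (forall n, H (u n)) -> (forall n x, `|u n x| <= M) ->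
    (forall x, u n x @[n --> \oo] --> f x) -> H f) ->
  forall f, bounded_measurable f -> H f.
Proof.
move=> Hst Heq Hlin Hlim.
have Hc c : H (fun=> c).
  exact: Hst (sticky_operator_cst omega L c) (bounded_measurable_cst _ c).
apply: bounded_measurable_ray_induction => // a.
have bray : bounded_measurable (\1_`]a, +oo[ : E -> R) by exact: bounded_measurable_indic.
have [a0|a0] := ltP a 0.
  apply: (Heq (fun=> 1)) => //; first exact: bounded_measurable_cst.
  move=> x /set_mem; rewrite /S/= in_itv/= => /andP[x0 _].
  by rewrite indicE mem_set//= in_itv/= andbT (lt_le_trans a0).
have [La|aL] := leP L a.
  apply: (Heq (fun=> 0)) => //; first exact: bounded_measurable_cst.
  move=> x /set_mem; rewrite /S/= in_itv/= => /andP[_ xL].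
  by rewrite indicE memNset//= in_itv/= andbT ltNge (le_trans xL La).
(* The spline rises over the width [3 * dl n], which tends to 0 and never reaches beyond [L]. *)
pose dl n : R := (L - a) / 3 / n.+1%:R.
have dl0 n : 0 < dl n by rewrite !divr_gt0// subr_gt0.
have dlE n : 3 * dl n = (L - a) / n.+1%:R.
  by rewrite /dl; field; rewrite addrC natr1 pnatr_eq0.
have dlL n : a + 3 * dl n <= L.
  have La0 : 0 <= L - a by rewrite subr_ge0 ltW.
  by rewrite dlE -lerBrDl ler_pdivrMr// ler_peMr// ler1n.
have /choice[u Hu] n := clamp_spline omega (dl0 n) a0 (dlL n).
apply: (Hlim u _ 9) => [n|n|n x|x].
- have [s2 [_ cs _ _ s9]] := Hu n; split; last by exists 9.
  exact: continuous_measurable_fun.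
- have [s2 [sts cs _ _ s9]] := Hu n; apply: Hst sts _; split; last by exists 9.
  exact: continuous_measurable_fun.
- by have [s2 [_ _ _ _]] := Hu n; apply.
- apply: cvg_near_cst; have [xa|ax] := leP x a.
    apply: nearW => n; have [s2 [_ _ s0 _ _]] := Hu n.
    by rewrite s0// indicE memNset//= in_itv/= andbT ltNge xa.
  near=> n; have [s2 [_ _ _ s1 _]] := Hu n.
  rewrite s1 ?indicE ?mem_set//= ?in_itv/= ?ax//.
  rewrite dlE -lerBrDl ler_pdivrMr// mulrC -ler_pdivrMr ?subr_gt0//.
  rewrite (@le_trans _ _ n%:R)// ?ler_nat//.
  by near: n; exact: nbhs_infty_ger.
Unshelve. all: by end_near. Qed.
End sticky_induction.

(** Error in a discrete product rule: [al] and [be] are the errors of the difference quotients of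
    two factors, [a] and [b] the factors, bounded by [m] and [n]. The 1 in the tolerance keeps the
    denominator positive. *)
Lemma ler_norm_quotient_diff (R : realFieldType) (al be a b e m n : R) :
  `|al| <= e / (m + n + 1) -> `|be| <= e / (m + n + 1) -> `|a| <= m -> `|b| <= n ->
  0 <= e -> `|al * b - a * be| <= e.
Proof.
move=> hal hbe am bn e0.
have m0 : 0 <= m by exact: le_trans am.
have n0 : 0 <= n by exact: le_trans bn.
have K0 : 0 < m + n + 1 by rewrite ltr_wpDl// addr_ge0.
rewrite (le_trans (ler_normB _ _))// !normrM.
have h1 : `|al| * `|b| <= e / (m + n + 1) * n by exact: ler_pM.
have h2 : `|a| * `|be| <= m * (e / (m + n + 1)) by exact: ler_pM.
apply: (le_trans (lerD h1 h2)).
rewrite [leLHS](_ : _ = e * ((m + n) / (m + n + 1))); last by ring.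
by rewrite ler_piMr// ler_pdivrMr// mul1r lerDl.
Qed.

(** * Symmetry of the sticky semigroup on the domain of its generator *)

Section sticky_semigroup.
Context (R : realType) (omega L : {posnum R})
  (p : R -> R -> probability (measurableTypeR R) R).
Hypothesis hp : sticky_brownian_motion omega%:num L%:num p.
Let E := measurableTypeR R.
Let S : set E := `[0, L%:num]%classic.
Let mu := sticky_measure omega L.
Let P := transition S p.
Let fp : feller_process S p := proj1 hp.
Let L0 : 0 < L%:num. Proof. by []. Qed.
Let mS : measurable S. Proof. exact: measurable_itv. Qed.
Let muS : (mu S < +oo)%E.
Proof. exact: (finite_measure_lty (sticky_measure_lty omega L) mS). Qed.
Let bmc (f : E -> R) : {within S, continuous f} -> bounded_measurable (f \_ S).
Proof. exact: bounded_measurable_continuous. Qed.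
Implicit Types (f g F : E -> R).

Let mc f : {within S, continuous f} -> measurable_fun S f.
Proof. by move=> cf; apply: subspace_continuous_measurable_fun. Qed.

Let bc f : {within S, continuous f} -> exists M, forall x, S x -> `|f x| <= M.
Proof. exact: (within_continuous_bounded (ltW L0)). Qed.

Lemma sticky_operator_form f1 f2 g g1 : derivative_on S f1 f2 ->
  {within S, continuous f2} -> f2 0 = omega%:num * f1 0 ->
  f2 L%:num = - omega%:num * f1 L%:num ->
  derivative_on S g g1 -> {within S, continuous g1} ->
  \int[mu]_(x in S) (f2 x * g x) = - (2 + omega%:num * L%:num)^-1 *
    (omega%:num * \int[lebesgue_measure]_(x in `[0, L%:num]) (f1 x * g1 x)).
Proof.
move=> df1 cf2 f20 f2L dg cg1.
have cfg := within_continuousM cf2 (derivative_on_continuous dg).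
have [M fM] := bc cfg.
rewrite (@sticky_Rintegral_on R omega L _ M (mc cfg) fM).
rewrite (sticky_dirichlet_form L0 df1 cf2 f20 f2L dg cg1).
by rewrite mulrN mulNr.
Qed.

Lemma sticky_operator_symmetric f f2 g g2 :
  sticky_operator omega%:num L%:num f f2 -> sticky_operator omega%:num L%:num g g2 ->
  \int[mu]_(x in S) (f2 x * g x) = \int[mu]_(x in S) (f x * g2 x).
Proof.
move=> [f1 [df df1 cf2 f20 f2L]] [g1 [dg dg1 cg2 g20 g2L]].
have cf1 := derivative_on_continuous df1; have cg1 := derivative_on_continuous dg1.
rewrite (sticky_operator_form df1 cf2 f20 f2L dg cg1).
have <- : \int[mu]_(x in S) (g2 x * f x) = \int[mu]_(x in S) (f x * g2 x).
  by apply: eq_Rintegral => x _; rewrite mulrC.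
rewrite (sticky_operator_form dg1 cg2 g20 g2L df cf1).
by do 2 congr (_ * _); apply: eq_Rintegral => x _; rewrite mulrC.
Qed.

Let transition_within t f x : P t (f \_ S) x = P t f x.
Proof. by rewrite /P transition_restrict. Qed.

Lemma transitionD_continuous s t f x : 0 <= s -> 0 <= t -> {within S, continuous f} ->
  S x -> P (s + t) f x = P s (P t f) x.
Proof.
move=> s0 t0 cf Sx; rewrite -[LHS]transition_within [LHS](transitionD mS fp s0 t0 (bmc cf) Sx).
by rewrite transition_restrict.
Qed.

Lemma transition_continuous_lin t (a : R) f g x : {within S, continuous f} ->
  {within S, continuous g} ->
  P t (fun y => a * f y + g y) x = a * P t f x + P t g x.
Proof. by move=> cf cg; rewrite /P (transition_lin p mS)//; exact: bmc. Qed.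

Let cst_within (c : R) : {within S, continuous (fun _ : R => c)}.
Proof. by apply: continuous_subspaceT => y; exact: cst_continuous. Qed.

(** [P s] contracts the sup norm on [S], so the error of the difference quotient at time 0 bounds
    the error at every later time [s]. This gives the uniformity in time needed by
    [eq_of_small_increments]. *)
Lemma transition_quotient_bound (s h e : R) f g x : 0 <= s -> 0 < h ->
  {within S, continuous f} -> {within S, continuous g} ->
  (forall y, S y -> `|(P h f y - f y) / h - g y| <= e) -> S x ->
  `|(P (s + h) f x - P s f x) / h - P s g x| <= e.
Proof.
move=> s0 h0 cf cg Hh Sx.
have ch := feller_continuous fp (ltW h0) cf.
rewrite (transitionD_continuous s0 (ltW h0) cf Sx).
have cN : {within S, continuous (fun y => -1 * f y + P h f y)} by exact: within_continuous_lin.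
have cNg : {within S, continuous (fun y => -1 * g y + 0)} by exact: within_continuous_lin.
have <- : P s (fun y => h^-1 * (-1 * f y + P h f y) + (-1 * g y + 0)) x =
   (P s (P h f) x - P s f x) / h - P s g x.
  rewrite !transition_continuous_lin//.
  by rewrite /P (transition_cst mS fp)//; ring.
apply: (transition_bounded mS fp) => //; first by apply: bmc; exact: within_continuous_lin.
move=> y Sy; have := Hh y Sy; congr (`|_| <= _); ring.
Qed.

(** The semigroup preserves the domain and commutes with the generator, since
    [P h (P t f) = P (t + h) f] turns the quotient of [P t f] into the quotient of [f] at time
    [t]. *)
Lemma C0_generator_transition t f g : 0 <= t -> C0_generator S p f g ->
  C0_generator S p (P t f) (P t g).
Proof.
move=> t0 [cf cg /uniform_cvgP H]; split; [exact: (feller_continuous fp)..|].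
apply/uniform_cvgP => e e0; have := H e e0.
apply: filter_app; near=> h => Hh x Sx.
have h0 : 0 < h by near: h; exact: nbhs_right_gt.
rewrite -/P -(transitionD_continuous (ltW h0) t0 cf Sx) (addrC h t).
exact: transition_quotient_bound.
Unshelve. all: by end_near. Qed.

Lemma transition0 f x : {within S, continuous f} -> S x -> P 0 f x = f x.
Proof.
move=> cf Sx; rewrite /P /transition /Rintegral.
rewrite (@eq_measure_integral _ _ _ _ \d_(x : E)); last first.
  by move=> A mA _; exact: (feller_start fp).
rewrite integral_dirac ?diracE ?mem_set ?mul1e//.
by apply/measurable_EFinP; exact: mc.
Qed.

Let continuous_integrable f : {within S, continuous f} -> mu.-integrable S (EFin \o f).
Proof. by move=> cf; have [M fM] := bc cf; exact: (integrable_le_cst mS muS (mc cf) fM). Qed.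

Let continuous_Rintegral_lin (a : R) f g : {within S, continuous f} ->
  {within S, continuous g} ->
  \int[mu]_(x in S) (a * f x + g x) = a * \int[mu]_(x in S) f x + \int[mu]_(x in S) g x.
Proof.
move=> cf cg; have caf : {within S, continuous (fun x => a * f x)}.
  exact: within_continuousM.
rewrite RintegralD//; [|exact: continuous_integrable..].
by rewrite RintegralZl//; exact: continuous_integrable.
Qed.

(* The interpolation [s |-> \int P_s f * P_(t-s) g] is constant because the
   operator is symmetric. *)
Lemma C0_reversible t f f2 g g2 : 0 <= t -> C0_generator S p f f2 ->
  C0_generator S p g g2 ->
  \int[mu]_(x in S) (f x * P t g x) = \int[mu]_(x in S) (g x * P t f x).
Proof.
move=> t0 Cf Cg; have [cf cf2 /uniform_cvgP Uf] := Cf; have [cg cg2 /uniform_cvgP Ug] := Cg.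
pose G s := \int[mu]_(x in S) (P s f x * P (t - s) g x).
have <- : G 0 = \int[mu]_(x in S) (f x * P t g x).
  by apply: eq_Rintegral => x /set_mem Sx; rewrite subr0 transition0.
have <- : G t = \int[mu]_(x in S) (g x * P t f x).
  by apply: eq_Rintegral => x /set_mem Sx; rewrite subrr transition0// mulrC.
apply/esym/eq_of_small_increments => // e e0.
have [Mf fM] := bc cf; have [Mg gM] := bc cg.
pose K := `|Mf| + `|Mg| + 1.
have K0 : 0 < K by rewrite ltr_wpDl// addr_ge0.
have eK : 0 < e / K by rewrite divr_gt0.
have [d d0 Hd] : exists2 d, 0 < d & forall h, 0 < h -> h < d ->
    (forall x, S x -> `|(P h f x - f x) / h - f2 x| <= e / K) /\
    (forall x, S x -> `|(P h g x - g x) / h - g2 x| <= e / K).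
  have : \forall h \near 0^'+,
      (forall x, S x -> `|(P h f x - f x) / h - f2 x| <= e / K) /\
      (forall x, S x -> `|(P h g x - g x) / h - g2 x| <= e / K).
    by apply: filterI; [exact: Uf|exact: Ug].
  rewrite near_withinE => /nbhs_ballP[d /= d0 Hd]; exists d => // h h0 hd.
  by apply: Hd; rewrite // /ball/= sub0r normrN gtr0_norm.
exists d => // s h s0 h0 hd sht; have [Hf Hg] := Hd h h0 hd.
(* With this remaining time both factors of the increment have forward quotients of the same length
   [h]: from [s] for [f], from [r] for [g]. *)
pose r := t - (s + h).
have r0 : 0 <= r by rewrite subr_ge0.
have trh : t - s = r + h by rewrite /r; ring.
have CA := C0_generator_transition s0 Cf; have [cA cA2 _] := CA.
have CB := C0_generator_transition r0 Cg; have [cB cB2 _] := CB.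
have cA' : {within S, continuous P (s + h) f}.
  by apply: (feller_continuous fp) => //; rewrite addr_ge0// ltW.
have cB' : {within S, continuous P (r + h) g}.
  by apply: (feller_continuous fp) => //; rewrite addr_ge0// ltW.
have sym : \int[mu]_(x in S) (P s f2 x * P r g x) = \int[mu]_(x in S) (P s f x * P r g2 x).
  by apply: sticky_operator_symmetric; apply: (hp.2 _ _).1.
(* [D] is the integrand of the increment and [D2] its formal derivative, whose integral is zero by
   [sym]. Subtracting [h * D2] is therefore free, and leaves [h] times a difference of two small
   products. *)
pose D x := -1 * (P s f x * P (r + h) g x) + P (s + h) f x * P r g x.
pose D2 x := -1 * (P s f x * P r g2 x) + P s f2 x * P r g x.
have cD : {within S, continuous D}.
  by apply: within_continuous_lin; exact: within_continuousM.
have cD2 : {within S, continuous D2}.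
  by apply: within_continuous_lin; exact: within_continuousM.
have cAB' := within_continuousM cA cB'; have cA'B := within_continuousM cA' cB.
have cAB2 := within_continuousM cA cB2; have cA2B := within_continuousM cA2 cB.
have cDD := within_continuous_lin (a := - h) cD2 cD.
have -> : G (s + h) - G s = \int[mu]_(x in S) (- h * D2 x + D x).
  rewrite (continuous_Rintegral_lin (- h) cD2 cD).
  rewrite (continuous_Rintegral_lin (-1) cAB2 cA2B) (continuous_Rintegral_lin (-1) cAB' cA'B).
  rewrite sym mulN1r addNr mulr0 add0r mulN1r addrC.
  by rewrite /G trh.
apply: (@ler_norm_sticky_Rintegral R omega L _ (e * h) (mc cDD)) => x Sx.
have hA := transition_quotient_bound s0 h0 cf cf2 Hf Sx.
have hB := transition_quotient_bound r0 h0 cg cg2 Hg Sx.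
have bA : `|P s f x| <= `|Mf|.
  apply: (transition_bounded mS fp s0 Sx (bmc cf)) => y Sy.
  exact: le_trans (fM y Sy) (ler_norm _).
have bB : `|P r g x| <= `|Mg|.
  apply: (transition_bounded mS fp r0 Sx (bmc cg)) => y Sy.
  exact: le_trans (gM y Sy) (ler_norm _).
set al := _ / _ - _ in hA; set be := _ / _ - _ in hB.
have -> : - h * D2 x + D x = h * (al * P r g x - P s f x * be).
  rewrite /D /D2 /al /be; field; exact: lt0r_neq0.
rewrite normrM (gtr0_norm h0) mulrC ler_pM2r//.
exact: (ler_norm_quotient_diff hA hB bA bB (ltW e0)).
Unshelve. all: by end_near. Qed.
End sticky_semigroup.

Lemma clamp_in (R : realType) (a b x : R) : a <= b -> Num.max a (Num.min b x) \in `[a, b].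
Proof. by move=> ab; rewrite in_itv/= le_max lexx/= ge_max ab ge_min lexx. Qed.

Lemma clamp_id (R : realType) (a b x : R) : x \in `[a, b] -> Num.max a (Num.min b x) = x.
Proof. by rewrite in_itv/= => /andP[ax xb]; rewrite min_r// max_r. Qed.

(** Extends a function continuous on the segment to the line by constants, the form in which
    [sticky_solve] takes its right-hand side. *)
Lemma continuous_comp_clamp (R : realType) (a b : R) (f : R -> R) : a <= b ->
  {within `[a, b], continuous f} -> continuous (fun x => f (Num.max a (Num.min b x))).
Proof.
move=> ab /subspace_continuousP cf x.
have := cf _ (clamp_in x ab); move=> H; apply: cvg_comp H.
move=> A; rewrite /within/= => HA.
have H2 := @continuous_clamp R a b x _ HA.
by apply: (@filterS _ (nbhs x) _ _ _ _ H2) => y Hy; exact/Hy/clamp_in.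
Qed.

Lemma ler_norm_Rintegral_cst d (E : measurableType d) (R : realType)
    (nu : {measure set E -> \bar R}) (D : set E) (F : E -> R) (M : R) :
  measurable D -> (nu D <= 1)%E -> measurable_fun D F -> 0 <= M ->
  (forall x, D x -> `|F x| <= M) -> `|\int[nu]_(x in D) F x| <= M.
Proof.
move=> mD nu1 mF M0 FM.
have nuD : (nu D < +oo)%E by rewrite (le_lt_trans nu1)// ltry.
have IF := integrable_le_cst mD nuD mF FM.
rewrite (le_trans (le_normr_Rintegral mD IF))//.
have I2 : nu.-integrable D (EFin \o (fun=> M)).
  exact: (@integrable_le_cst _ _ _ nu D mD nuD (fun=> M) `|M|).
rewrite (le_trans (le_Rintegral mD _ I2 FM))//; first exact: integrable_norm.
by rewrite Rintegral_cst// ler_piMr// -lee_fin fineK ?ge0_fin_numE.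
Qed.

(** * Reversibility, invariance and uniqueness of the sticky measure *)

Section sticky_invariance.
Context (R : realType) (omega L : {posnum R})
  (p : R -> R -> probability (measurableTypeR R) R).
Hypothesis hp : sticky_brownian_motion omega%:num L%:num p.
Let E := measurableTypeR R.
Let S : set E := `[0, L%:num]%classic.
Let mu := sticky_measure omega L.
Let P := transition S p.
Let fp : feller_process S p := proj1 hp.
Let o0 : 0 < omega%:num. Proof. by []. Qed.
Let L0 : 0 < L%:num. Proof. by []. Qed.
Let mS : measurable S. Proof. exact: measurable_itv. Qed.
Let muS : (mu S < +oo)%E.
Proof. exact: (finite_measure_lty (sticky_measure_lty omega L) mS). Qed.
Let bmc (f : E -> R) : {within S, continuous f} -> bounded_measurable (f \_ S).
Proof. exact: bounded_measurable_continuous. Qed.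
Implicit Types (f g F : E -> R).
Let mc f : {within S, continuous f} -> measurable_fun S f.
Proof. by move=> cf; apply: subspace_continuous_measurable_fun. Qed.

Let B f g t := \int[mu]_(x in S) (f x * P t g x).

Let bfP f g t : 0 <= t -> bounded_measurable f -> bounded_measurable g ->
  mu.-integrable S (EFin \o (fun x => f x * P t g x)) /\
  measurable_fun S (fun x => f x * P t g x).
Proof.
move=> t0 bf bg; have [mf [M fM]] := bf; have [mg [N gN]] := bg.
have m : measurable_fun S (fun x => f x * P t g x).
  apply: measurable_funM; first exact: measurable_funTS.
  exact: (transition_measurable mS fp).
split => //; apply: (@integrable_le_cst _ _ _ mu S mS muS _ (M * N) m) => x Sx.
rewrite normrM ler_pM//; apply: (transition_bounded mS fp) => //.
exact: bounded_measurable_restrictS.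
Qed.

Let B_linl t (a : R) f g h : 0 <= t -> bounded_measurable f -> bounded_measurable g ->
  bounded_measurable h -> B (fun x => a * f x + g x) h t = a * B f h t + B g h t.
Proof.
move=> t0 bf bg bh; have [If _] := bfP t0 bf bh; have [Ig _] := bfP t0 bg bh.
rewrite /B -RintegralZl// -RintegralD//.
  by apply: eq_Rintegral => x _; rewrite mulrDl mulrA.
by have := integrableZl mS a If; under eq_fun do rewrite -EFinM.
Qed.

Let B_linr t (a : R) f g h : 0 <= t -> bounded_measurable f -> bounded_measurable g ->
  bounded_measurable h -> B h (fun x => a * f x + g x) t = a * B h f t + B h g t.
Proof.
move=> t0 bf bg bh; have [If _] := bfP t0 bh bf; have [Ig _] := bfP t0 bh bg.
rewrite /B -RintegralZl// -RintegralD//.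
  apply: eq_Rintegral => x _; rewrite /P (transition_lin p mS).
  - by ring.
  - exact: bounded_measurable_restrictS.
  - exact: bounded_measurable_restrictS.
by have := integrableZl mS a If; under eq_fun do rewrite -EFinM.
Qed.

Let B_cvgl t (u : (E -> R)^nat) f h (M : R) : 0 <= t -> (forall n, bounded_measurable (u n)) ->
  bounded_measurable h -> (forall n x, `|u n x| <= M) ->
  (forall x, u n x @[n --> \oo] --> f x) -> B (u n) h t @[n --> \oo] --> B f h t.
Proof.
move=> t0 bu bh uM uf; have [_ [N hN]] := bh.
apply: (@Rintegral_bounded_cvg_on _ _ _ mu S mS muS (fun n x => u n x * P t h x) _ (M * N)).
- by move=> n; have [] := bfP t0 (bu n) bh.
- move=> n x Sx; rewrite normrM ler_pM//; apply: (transition_bounded mS fp) => //.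
  exact: bounded_measurable_restrictS.
- by move=> x Sx; apply: cvgM; [exact: uf|exact: cvg_cst].
Qed.

Let B_cvgr t (u : (E -> R)^nat) f h (M : R) : 0 <= t -> (forall n, bounded_measurable (u n)) ->
  bounded_measurable h -> (forall n x, `|u n x| <= M) ->
  (forall x, u n x @[n --> \oo] --> f x) -> B h (u n) t @[n --> \oo] --> B h f t.
Proof.
move=> t0 bu bh uM uf; have [_ [N hN]] := bh.
apply: (@Rintegral_bounded_cvg_on _ _ _ mu S mS muS (fun n x => h x * P t (u n) x) _ (N * M)).
- by move=> n; have [] := bfP t0 bh (bu n).
- move=> n x Sx; rewrite normrM ler_pM//; apply: (transition_bounded mS fp) => //.
  exact: bounded_measurable_restrictS.
- move=> x Sx; apply: cvgM; [exact: cvg_cst|].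
  exact: (transition_bounded_cvg mS bu uM uf).
Qed.

Let B_eq t f f' g g' : {in S, f =1 f'} -> {in S, g =1 g'} -> B f g t = B f' g' t.
Proof.
move=> ff gg; rewrite /B /P (eq_transition p t gg).
by apply: eq_Rintegral => x Sx; rewrite ff.
Qed.

(** [C0_reversible] needs both functions in the domain, so [sticky_induction] is applied twice: to
    [g] with [f'] in the domain, and then to [f] with [g] arbitrary. *)
Lemma sticky_reversible : reversible S mu P.
Proof.
move=> t f g t0 bf bg; rewrite -/(B f g t) -/(B g f t).
have step f' f2 : sticky_operator omega%:num L%:num f' f2 -> bounded_measurable f' ->
    forall g, bounded_measurable g -> B f' g t = B g f' t.
  move=> stf bf'; apply: (@sticky_induction R omega%:num L%:num (fun g => B f' g t = B g f' t)).
  - move=> h h2 sth bh; apply: C0_reversible => //; apply: (hp.2 _ _).2; [exact: stf|exact: sth].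
  - move=> h k bh bk hk Hh.
    by rewrite (B_eq t (fun _ _ => erefl) (fun x Sx => esym (hk x Sx))) Hh; exact: B_eq.
  - move=> a h k bh bk Hh Hk.
    by rewrite (B_linr a t0 bh bk bf') (B_linl a t0 bh bk bf') Hh Hk.
  - move=> u h M bu Hu uM uh.
    have h1 := B_cvgr t0 bu bf' uM uh; have h2 := B_cvgl t0 bu bf' uM uh.
    have Eu : (fun n => B f' (u n) t) = (fun n => B (u n) f' t) by apply/funext.
    by move: h1; rewrite Eu => h1; exact: (cvg_unique _ h1 h2).
move: f bf; apply: (@sticky_induction R omega%:num L%:num (fun f => B f g t = B g f t)).
- by move=> h h2 sth bh; apply: step sth bh _ bg.
- move=> h k bh bk hk Hh.
  by rewrite (B_eq t (fun x Sx => esym (hk x Sx)) (fun _ _ => erefl)) Hh; exact: B_eq.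
- move=> a h k bh bk Hh Hk.
  by rewrite (B_linr a t0 bh bk bg) (B_linl a t0 bh bk bg) Hh Hk.
- move=> u h M bu Hu uM uh.
  have h1 := B_cvgl t0 bu bg uM uh; have h2 := B_cvgr t0 bu bg uM uh.
  have Eu : (fun n => B (u n) g t) = (fun n => B g (u n) t) by apply/funext.
  by move: h1; rewrite Eu => h1; exact: (cvg_unique _ h1 h2).
Qed.

(** Reversibility tested against the constant 1, as [P t 1 = 1] on [S]. *)
Lemma sticky_invariant : invariant_probability S mu P.
Proof.
split; [exact: sticky_measureT|exact: sticky_measureC|move=> t f t0 bf].
have H := sticky_reversible t0 (bounded_measurable_cst _ 1) bf.
have <- : \int[mu]_(x in S) (1 * P t f x) = \int[mu]_(x in S) P t f x.
  by apply: eq_Rintegral => x _; rewrite mul1r.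
rewrite H; apply: eq_Rintegral => x /set_mem Sx.
by rewrite [X in _ * X](transition_cst mS fp 1 t0 Sx) mulr1.
Qed.

Let cst_within (c : R) : {within S, continuous (fun _ : R => c)}.
Proof. by apply: continuous_subspaceT => y; exact: cst_continuous. Qed.

(** By invariance the difference quotient of [k] has integral zero for every step, and it is
    uniformly close to [k2] for one small step. *)
Lemma invariant_generator_eq0 (nu : probability E R) k k2 :
  invariant_probability S nu P -> C0_generator S p k k2 ->
  \int[nu]_(x in S) k2 x = 0.
Proof.
move=> [_ _ inv] [ck ck2 /uniform_cvgP U].
have nu1 : (nu S <= 1)%E by exact: probability_le1.
have nuS : (nu S < +oo)%E by rewrite (le_lt_trans nu1)// ltry.
have In f : {within S, continuous f} -> nu.-integrable S (EFin \o f).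
  move=> cf; have [M fM] := within_continuous_bounded (ltW L0) cf.
  exact: (integrable_le_cst mS nuS (mc cf) fM).
have lin (a : R) f g : {within S, continuous f} -> {within S, continuous g} ->
    \int[nu]_(x in S) (a * f x + g x) = a * \int[nu]_(x in S) f x + \int[nu]_(x in S) g x.
  move=> cf cg; have caf : {within S, continuous (fun x => a * f x)}.
    exact: within_continuousM.
  by rewrite RintegralD//; [rewrite RintegralZl//; exact: In|exact: In..].
apply/eqP; rewrite -normr_le0; apply/ler_addgt0Pr => e e0; rewrite add0r.
have := U e e0; rewrite near_withinE => /nbhs_ballP[d /= d0 Hd].
pose h := d / 2; have h0 : 0 < h by rewrite divr_gt0.
have hd : ball (0 : R) d h.
  by rewrite /ball/= sub0r normrN gtr0_norm// /h ltr_pdivrMr// ltr_pMr// ltr1n.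
have Hh := Hd h hd h0.
have ch := feller_continuous fp (ltW h0) ck.
have inv0 : \int[nu]_(x in S) (-1 * k x + P h k x) = 0.
  have kE : \int[nu]_(x in S) (k \_ S) x = \int[nu]_(x in S) k x.
    by apply: eq_Rintegral => x Sx; rewrite patchE Sx.
  rewrite lin// /P -(transition_restrict S p h k) inv ?(ltW h0)//; last exact: bmc.
  by rewrite kE; ring.
have cN : {within S, continuous (fun y => -1 * k y + P h k y)} by exact: within_continuous_lin.
have cN2 : {within S, continuous (fun x => - h^-1 * (-1 * k x + P h k x) + k2 x)}.
  exact: within_continuous_lin.
have <- : \int[nu]_(x in S) (- h^-1 * (-1 * k x + P h k x) + k2 x) = \int[nu]_(x in S) k2 x.
  by rewrite lin// inv0 mulr0 add0r.
apply: ler_norm_Rintegral_cst => //; [exact: mc|exact: ltW|].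
move=> x Sx; rewrite -normrN; have := Hh x Sx; congr (`|_| <= _).
by rewrite -/P; ring.
Qed.

Lemma sticky_invariant_unique (nu : probability E R) :
  invariant_probability S nu P -> forall A, measurable A -> nu A = mu A.
Proof.
move=> inv; have [_ nuC _] := inv.
have nu1 : (nu S <= 1)%E by exact: probability_le1.
have nuS : (nu S < +oo)%E by rewrite (le_lt_trans nu1)// ltry.
have S1 (m : {measure set E -> \bar R}) : m setT = 1%E -> m (~` S) = 0%E -> m S = 1%E.
  move=> <- m0; rewrite -(setUv S) measureU//; [|exact: measurableC|exact: setICr].
  by rewrite [X in (_ + X)%E]m0 adde0.
have nuS1 : nu S = 1%E by apply: S1 => //; exact: probability_setT.
suff H f : bounded_measurable f -> \int[nu]_(x in S) f x = \int[mu]_(x in S) f x.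
  move=> A mA; have mAS : measurable (A `&` S) by exact: measurableI.
  have nuASoo : (nu (A `&` S) < +oo)%E.
    by rewrite (le_lt_trans _ nuS)// le_measure ?inE//; exact: subIsetr.
  have muASoo : (mu (A `&` S) < +oo)%E.
    by rewrite (le_lt_trans _ muS)// le_measure ?inE//; exact: subIsetr.
  have HAS : nu (A `&` S) = mu (A `&` S).
    have HA := H _ (bounded_measurable_indic R mA).
    rewrite /Rintegral !integral_indic// in HA.
    by rewrite -[LHS]fineK ?ge0_fin_numE// HA fineK ?ge0_fin_numE.
  have split0 (m : {measure set E -> \bar R}) : m (~` S) = 0%E -> m A = m (A `&` S).
    move=> mC; have H0 : m (A `\` S) = 0%E.
      apply: (@subset_measure0 _ E R m _ (~` S)) => //.
        exact: measurableD.
      exact: measurableC.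
    transitivity (m (A `\` S) + m (A `&` S))%E; first exact: (measureDI m mA mS).
    by rewrite H0 add0e.
  transitivity (nu (A `&` S)); first exact: (split0 nu nuC).
  by rewrite HAS; apply/esym/split0/sticky_measureC.
apply: (@sticky_induction R omega%:num L%:num
  (fun f => \int[nu]_(x in S) f x = \int[mu]_(x in S) f x)) f.
- move=> f f2 [f1 [df _ _ _ _]] bf.
  have cf := derivative_on_continuous df.
  pose c := \int[mu]_(x in S) f x.
  (* Subtracting the [mu]-mean makes [w] an admissible right-hand side: by [sticky_Rintegral_on] the
     condition of [sticky_solve] is, up to a nonzero factor, that [w] has [mu]-mean zero. The
     solution [k] then shows that [w] also has [nu]-mean zero. *)
  pose w x := f (Num.max 0 (Num.min L%:num x)) - c.
  have cw : continuous w.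
    move=> x; apply: cvgB; last exact: cvg_cst.
    exact: (continuous_comp_clamp (ltW L0) cf).
  have wE x : S x -> w x = 1 * f x + (- c) by move=> Sx; rewrite /w clamp_id// mul1r.
  have cwS : {within S, continuous w} by exact: continuous_subspaceT.
  have [M wM] := within_continuous_bounded (ltW L0) cwS.
  have intw (m : {measure set E -> \bar R}) : m S = 1%E ->
      \int[m]_(x in S) w x = \int[m]_(x in S) f x - c.
    move=> m1; have mSoo : (m S < +oo)%E by rewrite m1 ltry.
    have Im g : bounded_measurable g -> m.-integrable S (EFin \o g).
      exact: (bounded_measurable_integrable_on mS mSoo).
    have -> : \int[m]_(x in S) w x = \int[m]_(x in S) (f x - c).
      by apply: eq_Rintegral => x /set_mem Sx; rewrite wE// mul1r.
    rewrite RintegralB//; [|exact: Im|exact/Im/bounded_measurable_cst].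
    by rewrite Rintegral_cst// m1 mulr1.
  have muS1 : mu S = 1%E by apply: S1; [exact: sticky_measureT|exact: sticky_measureC].
  have w0 : w 0 + w L%:num + omega%:num * \int[lebesgue_measure]_(x in `[0, L%:num]) w x = 0.
    have := @sticky_Rintegral_on R omega L w M (mc cwS) wM.
    rewrite intw// subrr => /esym/eqP; rewrite mulf_eq0 invr_eq0.
    by rewrite gt_eqF ?ltr_pwDl ?mulr_ge0//= => /eqP.
  have [k [stk _ _]] := sticky_solve o0 L0 cw w0.
  have := invariant_generator_eq0 inv ((hp.2 _ _).2 stk).
  by rewrite intw// => /eqP; rewrite subr_eq0 => /eqP.
- move=> f g bf bg fg Hf.
  have fgE (m : {measure set E -> \bar R}) :
      \int[m]_(x in S) g x = \int[m]_(x in S) f x.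
    by apply: eq_Rintegral => x Sx; rewrite fg.
  by rewrite !fgE.
- move=> a f g bf bg Hf Hg.
  have I (m : {measure set E -> \bar R}) : (m S < +oo)%E ->
    \int[m]_(x in S) (a * f x + g x) = a * \int[m]_(x in S) f x + \int[m]_(x in S) g x.
    move=> moo; rewrite RintegralD//; [rewrite RintegralZl//|..];
      apply: (bounded_measurable_integrable_on mS moo) => //.
    have := bounded_measurable_lin a bf (bounded_measurable_cst _ 0).
    by under eq_fun do rewrite addr0.
  by rewrite !I// Hf Hg.
- move=> u f M bu Hu uM uf.
  have mu_ n : measurable_fun S (u n) by apply: measurable_funTS; case: (bu n).
  have h1 := Rintegral_bounded_cvg_on mS nuS mu_ (fun n x _ => uM n x) (fun x _ => uf x).
  have h2 := Rintegral_bounded_cvg_on mS muS mu_ (fun n x _ => uM n x) (fun x _ => uf x).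
  move: h1; rewrite (_ : (fun n => _) = fun n => \int[mu]_(x in S) u n x); last by apply/funext.
  by move=> h1; exact: (cvg_unique _ h1 h2).
Qed.
End sticky_invariance.

(** * Generators of strongly continuous semigroups on L^2 *)

Section L2_generator.
Context d (E : measurableType d) (R : realType).
Variable mu : {measure set E -> \bar R}.
Variable T : R -> (E -> R) -> (E -> R).
Hypothesis sT : strongly_continuous_semigroup mu T.
Implicit Types (f g h : E -> R).

Lemma L2_semigroup_Lfun t f : 0 <= t -> f \in Lfun mu 2%:E -> T t f \in Lfun mu 2%:E.
Proof. by case: sT => H _ _ _ _; exact: H. Qed.

Lemma L2_quotient_Lfun t f : 0 < t -> f \in Lfun mu 2%:E ->
  (fun x => (T t f x - f x) / t) \in Lfun mu 2%:E.
Proof.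
move=> t0 f2; have h2 := LfunB (L2_semigroup_Lfun (ltW t0) f2) f2.
have := Lfun_lin t^-1 h2 (LfunB f2 f2).
by under eq_fun do rewrite subrr addr0 mulrC.
Qed.

Lemma L2_generatorP f g : L2_generator mu T f g <->
  [/\ f \in Lfun mu 2%:E, g \in Lfun mu 2%:E &
   L2_rnorm mu (fun x => (T t f x - f x) / t - g x) @[t --> 0^'+] --> 0].
Proof.
by split=> -[f2 g2 H]; split => //; apply/(L2_dist_cvgP _ g2) => // t t0;
  exact: L2_quotient_Lfun.
Qed.

Lemma L2_generator_unique f g g' : L2_generator mu T f g -> L2_generator mu T f g' ->
  g = g' %[ae mu].
Proof.
move=> [f2 g2 H] [_ g'2 H']; apply: L2_cvg_unique H H' => // t t0.
exact: L2_quotient_Lfun.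
Qed.

Lemma L2_generator_lin (a : R) f f' g g' : L2_generator mu T f f' ->
  L2_generator mu T g g' ->
  L2_generator mu T (fun x => a * f x + g x) (fun x => a * f' x + g' x).
Proof.
move=> /L2_generatorP[f2 f'2 Hf] /L2_generatorP[g2 g'2 Hg]; apply/L2_generatorP.
split; [exact: Lfun_lin|exact: Lfun_lin|].
have H0 : `|a| * L2_rnorm mu (fun x => (T t f x - f x) / t - f' x) +
    L2_rnorm mu (fun x => (T t g x - g x) / t - g' x) @[t --> 0^'+] --> 0.
  rewrite -[X in _ --> X]addr0 -[X in _ --> X + _](mulr0 `|a|).
  by apply: cvgD => //; apply: cvgM => //; exact: cvg_cst.
apply: (squeeze_cvgr _ (cvg_cst 0) H0).
near=> t; rewrite L2_rnorm_ge0/=.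
have t0 : 0 < t by near: t; exact: nbhs_right_gt.
have qf := L2_quotient_Lfun t0 f2; have qg := L2_quotient_Lfun t0 g2.
have df := LfunB qf f'2; have dg := LfunB qg g'2.
rewrite -L2_rnormZ//.
have adf : (fun x => a * ((T t f x - f x) / t - f' x)) \in Lfun mu 2%:E.
  have := Lfun_lin a df (LfunB g2 g2).
  by under eq_fun do rewrite subrr addr0.
apply: le_trans (ler_L2_rnormD adf dg).
rewrite le_eqVlt; apply/orP; left; apply/eqP; apply: ae_eq_L2_rnorm.
- by apply: LfunB; [apply: L2_quotient_Lfun => //; exact: Lfun_lin|exact: Lfun_lin].
- by have := Lfun_lin 1 adf dg; under eq_fun do rewrite mul1r.
- case: sT => _ /(_ t a f g (ltW t0) f2 g2) + _ _ _.
  by apply: filterS => x /= /[apply] ->; ring.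
Unshelve. all: by end_near. Qed.

Lemma L2_semigroup_bounded t : 0 <= t -> exists2 C : R, 0 <= C &
  forall f, f \in Lfun mu 2%:E -> L2_rnorm mu (T t f) <= C * L2_rnorm mu f.
Proof.
move=> t0; case: sT => H1 _ /(_ t t0)[C HC] _ _; exists `|C| => // f f2.
have := HC f f2; rewrite !L2_normE ?H1// -EFinM lee_fin => /le_trans; apply.
by rewrite ler_wpM2r ?L2_rnorm_ge0// ler_norm.
Qed.

Lemma L2_semigroupB t f g : 0 <= t -> f \in Lfun mu 2%:E -> g \in Lfun mu 2%:E ->
  T t (fun x => f x - g x) = (fun x => T t f x - T t g x) %[ae mu].
Proof.
move=> t0 f2 g2; case: sT => _ /(_ t (-1) g f t0 g2 f2) + _ _ _.
rewrite (_ : (fun x => -1 * g x + f x) = (fun x => f x - g x)); last first.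
  by apply/funext => x; rewrite mulN1r addrC.
by apply: filterS => x /[apply] ->; rewrite mulN1r addrC.
Qed.

(** Boundedness sends a difference of norm zero to one of norm zero; this makes [T t] act on classes
    of functions. *)
Lemma ae_eq_L2_semigroup t f g : 0 <= t -> f \in Lfun mu 2%:E -> g \in Lfun mu 2%:E ->
  f = g %[ae mu] -> T t f = T t g %[ae mu].
Proof.
move=> t0 f2 g2 fg; have [C C0 HC] := L2_semigroup_bounded t0.
have fg2 := LfunB f2 g2.
have n0 : L2_rnorm mu (fun x => f x - g x) = 0.
  have z2 := LfunB f2 f2.
  rewrite (ae_eq_L2_rnorm fg2 z2).
    rewrite /L2_rnorm /L2_inner /Rintegral integral0_eq ?sqrtr0// => x _.
    by rewrite subrr mulr0.
  by apply: filterS fg => x /= /[apply] ->; rewrite !subrr.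
have T0 : L2_rnorm mu (T t (fun x => f x - g x)) = 0.
  by apply/eqP; rewrite eq_le L2_rnorm_ge0 andbT (le_trans (HC _ fg2))// n0 mulr0.
have := L2_rnorm_eq0 (L2_semigroup_Lfun t0 fg2) T0.
have := L2_semigroupB t0 f2 g2.
move=> H1 H2; near=> x => _.
have e1 : T t (fun x => f x - g x) x = T t f x - T t g x by apply: (near H1).
have e2 : T t (fun x => f x - g x) x = 0 by apply: (near H2).
by apply/eqP; rewrite -subr_eq0 -e1 e2.
Unshelve. all: by end_near. Qed.
End L2_generator.

Lemma L2_rnorm_le_cst d (E : measurableType d) (R : realType)
    (mu : {measure set E -> \bar R}) (f : E -> R) (e : R) : mu setT = 1%E -> 0 <= e ->
  measurable_fun setT f -> (forall x, `|f x| <= e) -> L2_rnorm mu f <= e.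
Proof.
move=> mu1 e0 mf fe.
rewrite -(ger0_norm e0) -sqrtr_sqr; apply: ler_wsqrtr.
rewrite (le_trans (ler_norm _))//; apply: ler_norm_Rintegral_cst => //.
- by rewrite mu1.
- exact: measurable_funM.
- by rewrite sqr_ge0.
- by move=> x _; rewrite normrM expr2 ler_pM.
Qed.

(** * The C^0-domain is a core of the L^2-generator *)

Section sticky_core.
Context (R : realType) (omega L : {posnum R})
  (p : R -> R -> probability (measurableTypeR R) R).
Hypothesis hp : sticky_brownian_motion omega%:num L%:num p.
Let E := measurableTypeR R.
Let S : set E := `[0, L%:num]%classic.
Let mu := sticky_measure omega L.
Let P := transition S p.
Variable T : R -> (E -> R) -> (E -> R).
Hypothesis hT : L2_semigroup mu P T.
Let sT := proj1 hT.
Let fp : feller_process S p := proj1 hp.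
Let o0 : 0 < omega%:num. Proof. by []. Qed.
Let L0 : 0 < L%:num. Proof. by []. Qed.
Let mS : measurable S. Proof. exact: measurable_itv. Qed.
Let muT : (mu setT < +oo)%E. Proof. exact: sticky_measure_lty. Qed.
Let muS : (mu S < +oo)%E. Proof. exact: (finite_measure_lty muT mS). Qed.
Let bmc (f : E -> R) : {within S, continuous f} -> bounded_measurable (f \_ S).
Proof. exact: bounded_measurable_continuous. Qed.
Let bL (f : E -> R) : bounded_measurable f -> f \in Lfun mu 2%:E.
Proof. exact: bounded_measurable_Lfun. Qed.
Implicit Types (f g F : E -> R).
Let mc f : {within S, continuous f} -> measurable_fun S f.
Proof. by move=> cf; apply: subspace_continuous_measurable_fun. Qed.
Let cL f : {within S, continuous f} -> f \_ S \in Lfun mu 2%:E.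
Proof. by move=> cf; exact/bL/bmc. Qed.

Lemma sticky_aeS : {ae mu, forall x, S x}.
Proof.
exists (~` S); split; [exact: measurableC|exact: sticky_measureC|by []].
Qed.

(** For a probability measure the sup norm dominates the L^2 norm, so uniform convergence of the
    quotients is more than enough. *)
Lemma L2_generator_C0 f g : C0_generator S p f g ->
  L2_generator mu T (f \_ S) (g \_ S).
Proof.
move=> [cf cg /uniform_cvgP U]; apply/(L2_generatorP sT); split; [exact: cL..|].
apply/cvgrPdist_le => e e0; have := U e e0; apply: filter_app; near=> t => Ht.
have t0 : 0 < t by near: t; exact: nbhs_right_gt.
rewrite sub0r normrN ger0_norm ?L2_rnorm_ge0//.
have ct := feller_continuous fp (ltW t0) cf.
(* An everywhere bounded version of the error: it vanishes off [S], and agrees almost everywhere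
   with the error written through [T]. *)
pose H x := (((P t f) \_ S) x - (f \_ S) x) / t - (g \_ S) x.
have mH : measurable_fun setT H.
  apply: measurable_funB; last by case: (bmc cg).
  apply: measurable_funM => //; apply: measurable_funB; last by case: (bmc cf).
  by case: (bmc ct).
have HE x : S x -> H x = (P t f x - f x) / t - g x by move=> Sx; rewrite /H !patchE mem_set.
have He x : `|H x| <= e.
  have [Sx|nSx] := pselect (S x); first by rewrite HE// Ht.
  by rewrite /H !patchE memNset// subrr mul0r subrr normr0 ltW.
have H2 : H \in Lfun mu 2%:E by apply: bL; split => //; exists e.
rewrite (@ae_eq_L2_rnorm _ _ _ _ _ H)//.
- by apply: L2_rnorm_le_cst => //; [exact: sticky_measureT|exact: ltW].
- by apply: LfunB; [exact/(L2_quotient_Lfun sT)/cL|exact: cL].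
- case: hT => _ /(_ t _ (ltW t0) (bmc cf)) HT.
  move: sticky_aeS HT; apply: filterS2 => x Sx /(_ Logic.I) HTx _.
  by rewrite HE// HTx /P transition_restrict !patchE mem_set.
Unshelve. all: by end_near. Qed.

Let inner_S f g : measurable_fun S f -> measurable_fun S g -> f \in Lfun mu 2%:E ->
  L2_inner mu f (g \_ S) = \int[mu]_(x in S) (f x * g x).
Proof.
move=> mf mg f2; rewrite [RHS]Rintegral_mkcond; apply: eq_Rintegral => x _.
by rewrite !patchE; case: ifP => // _; rewrite mulr0.
Qed.

(** For bounded [u] this is reversibility; truncation extends it to L^2. Keeping [k] bounded makes
    [P t k] meaningful as an integral. *)
Lemma L2_semigroup_symmetric t u k : 0 <= t -> u \in Lfun mu 2%:E ->
  bounded_measurable k -> L2_inner mu (T t u) k = L2_inner mu u ((P t k) \_ S).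
Proof.
move=> t0 u2 bk; have k2 := bL bk.
have bPk := bounded_measurable_transition mS fp t0 bk; have Pk2 := bL bPk.
have bmcase w : bounded_measurable w ->
    L2_inner mu (T t w) k = L2_inner mu w ((P t k) \_ S).
  move=> bw; have bPw := bounded_measurable_transition mS fp t0 bw.
  have Tw : T t w = (P t w) \_ S %[ae mu].
    case: hT => _ /(_ t _ t0 bw); move: sticky_aeS; apply: filterS2 => x Sx H _.
    by rewrite H// patchE mem_set.
  rewrite (ae_eq_L2_inner _ _ _ Tw)//; [|exact/(L2_semigroup_Lfun sT)/bL|exact: bL].
  have mw : measurable_fun S w by case: bw => mw _; exact: measurable_funTS.
  have mk : measurable_fun S k by case: bk => mk _; exact: measurable_funTS.
  have mPk := transition_measurable mS fp t0 bk.
  have mPw := transition_measurable mS fp t0 bw.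
  rewrite L2_innerC (inner_S mk mPw k2) (inner_S mw mPk (bL bw)).
  exact: (sticky_reversible hp).
have [C C0 HC] := L2_semigroup_bounded sT t0.
(* The sum of the Cauchy-Schwarz factors of the two error terms; approximating [u] within
   [e / (K + 1)] keeps their total below [e]. *)
pose K := C * L2_rnorm mu k + L2_rnorm mu ((P t k) \_ S).
have K0 : 0 <= K by rewrite addr_ge0 ?mulr_ge0 ?L2_rnorm_ge0.
apply/eqP; rewrite -subr_eq0 -normr_le0; apply/ler_addgt0Pr => e e0; rewrite add0r.
have [w bw uw] := L2_dense_bounded u2 (divr_gt0 e0 (ltr_wpDl K0 ltr01)).
have w2 := bL bw; have uw2 := LfunB u2 w2.
have Tu2 := L2_semigroup_Lfun sT t0 u2; have Tw2 := L2_semigroup_Lfun sT t0 w2.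
have Tuw2 := L2_semigroup_Lfun sT t0 uw2.
have -> : L2_inner mu (T t u) k - L2_inner mu u ((P t k) \_ S) =
   L2_inner mu (T t (fun x => u x - w x)) k -
   L2_inner mu (fun x => u x - w x) ((P t k) \_ S).
  rewrite (ae_eq_L2_inner Tuw2 (LfunB Tu2 Tw2) k2 (L2_semigroupB sT t0 u2 w2)).
  by rewrite !L2_innerBl// (bmcase w)//; ring.
rewrite (le_trans (ler_normB _ _))//.
rewrite (le_trans (lerD (cauchy_schwarz_L2 Tuw2 k2) (cauchy_schwarz_L2 uw2 Pk2)))//.
have h1 : L2_rnorm mu (T t (fun x => u x - w x)) <= C * (e / (K + 1)).
  by rewrite (le_trans (HC _ uw2))// ler_wpM2l.
rewrite (le_trans (lerD (ler_wpM2r (L2_rnorm_ge0 _ _) h1) (ler_wpM2r (L2_rnorm_ge0 _ _) uw)))//.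
rewrite [leLHS](_ : _ = K / (K + 1) * e); last by rewrite [in X in _ = X / _ * _]/K; ring.
by rewrite ler_piMl// ?(ltW e0)// ler_pdivrMr ?ltr_wpDl// mul1r lerDl.
Qed.

(** The limit of the symmetry of difference quotients: the L^2-generator is contained in the adjoint
    of the C^0-generator. It lets problems on the L^2 domain be tested with explicit solutions. *)
Lemma L2_generator_C0_adjoint f g k k2 : L2_generator mu T f g -> C0_generator S p k k2 ->
  L2_inner mu g (k \_ S) = L2_inner mu f (k2 \_ S).
Proof.
move=> /(L2_generatorP sT)[f2 g2 Hf] Ck; have [ck ck2 _] := Ck.
have /(L2_generatorP sT)[kL k2L Hk] := L2_generator_C0 Ck.
apply/eqP; rewrite -subr_eq0 -normr_le0.
(* The difference of the two sides does not depend on [t]; it is bounded by this quantity, which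
   tends to 0. *)
have H0 : L2_rnorm mu (fun x => (T t f x - f x) / t - g x) * L2_rnorm mu (k \_ S) +
   L2_rnorm mu f * L2_rnorm mu (fun x => (T t (k \_ S) x - (k \_ S) x) / t - (k2 \_ S) x)
   @[t --> 0^'+] --> (0 : R).
  rewrite -[X in _ --> X]addr0 -[X in _ --> X + _](mul0r (L2_rnorm mu (k \_ S))).
  rewrite -[X in _ --> _ + X](mulr0 (L2_rnorm mu f)).
  by apply: cvgD; apply: cvgM => //; exact: cvg_cst.
apply: (cvgr_to_ge H0); near=> t.
have t0 : 0 < t by near: t; exact: nbhs_right_gt.
have qf := L2_quotient_Lfun sT t0 f2; have qk := L2_quotient_Lfun sT t0 kL.
have Tf := L2_semigroup_Lfun sT (ltW t0) f2; have Tk := L2_semigroup_Lfun sT (ltW t0) kL.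
have sym : L2_inner mu (fun x => (T t f x - f x) / t) (k \_ S) =
    L2_inner mu f (fun x => (T t (k \_ S) x - (k \_ S) x) / t).
  have scale h u : h \in Lfun mu 2%:E -> u \in Lfun mu 2%:E ->
      L2_inner mu (fun x => h x / t) u = L2_inner mu h u / t.
    move=> h2 u2; have := L2_inner_linl t^-1 h2 (LfunB u2 u2) u2.
    rewrite (_ : (fun x => _) = (fun x => h x / t)); last first.
      by apply/funext => x; rewrite subrr addr0 mulrC.
    by rewrite L2_innerBl// subrr addr0 mulrC.
  rewrite scale//; last exact: LfunB.
  rewrite [RHS]L2_innerC scale//; last exact: LfunB.
  rewrite !L2_innerBl//; congr ((_ - _) / _); last exact: L2_innerC.
  rewrite (L2_semigroup_symmetric (ltW t0) f2 (bmc ck)) /P transition_restrict L2_innerC.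
  apply: ae_eq_L2_inner => //; first exact/cL/(feller_continuous fp (ltW t0)).
  case: hT => _ /(_ t _ (ltW t0) (bmc ck)); move: sticky_aeS; apply: filterS2 => x Sx H _.
  by rewrite H// /P transition_restrict patchE mem_set.
have -> : L2_inner mu g (k \_ S) - L2_inner mu f (k2 \_ S) =
   L2_inner mu f (fun x => (T t (k \_ S) x - (k \_ S) x) / t - (k2 \_ S) x) -
   L2_inner mu (fun x => (T t f x - f x) / t - g x) (k \_ S).
  rewrite [X in _ = X - _]L2_innerC !L2_innerBl// sym.
  by rewrite [X in _ = X - _ - _]L2_innerC [X in _ = _ - X - _]L2_innerC; ring.
rewrite (le_trans (ler_normB _ _))// addrC.
by apply: lerD; apply: cauchy_schwarz_L2 => //; exact: LfunB.
Unshelve. all: by end_near. Qed.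

Let one : E -> R := fun=> 1.

Let cone : {within S, continuous one}.
Proof. by apply: continuous_subspaceT => y; exact: cst_continuous. Qed.

Let muS1 : fine (mu S) = 1.
Proof.
have mu1 := sticky_measureT omega L; have muC := sticky_measureC omega L.
have -> : mu S = mu setT; last by rewrite mu1.
rewrite -(setUv S); apply/esym; transitivity (mu S + mu (~` S))%E.
  by apply: measureU; [by []|exact: measurableC|exact: setICr].
by rewrite muC adde0.
Qed.

Let one2 : one \_ S \in Lfun mu 2%:E.
Proof. exact: cL. Qed.

(** The bound of [sticky_solve] in terms of [mu]: since [mu] has density [omega / Z] and atoms
    [1 / Z] with [Z = 2 + omega * L], [|w 0| / omega + \int |w|] is at most [Z / omega] times the
    [mu]-mean of [|w|]. *)
Let C : R := L%:num * ((2 + omega%:num * L%:num) / omega%:num).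
Let C0 : 0 <= C. Proof. by rewrite mulr_ge0// divr_ge0// addr_ge0// mulr_ge0. Qed.

Let rnorm1 : L2_rnorm mu (one \_ S) <= 1.
Proof.
apply: L2_rnorm_le_cst => //; first exact: sticky_measureT.
  by case: (bmc cone).
by move=> x; rewrite patchE; case: ifP; rewrite ?normr1 ?normr0.
Qed.

Let meanle u : u \in Lfun mu 2%:E ->
  `|L2_inner mu u (one \_ S)| <= L2_rnorm mu u.
Proof.
move=> u2; rewrite (le_trans (cauchy_schwarz_L2 u2 one2))//.
by rewrite ler_piMr// L2_rnorm_ge0.
Qed.

(** Approximate [u] by a continuous function and subtract the mean of the latter, which is at most
    [delta / 2] because [u] has mean zero. The result is a solvable right-hand side, with the bound
    of [sticky_solve] turned into an L^2 bound. *)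
Lemma sticky_solve_dense u (delta : R) : u \in Lfun mu 2%:E ->
  L2_inner mu u (one \_ S) = 0 -> 0 < delta ->
  exists w k, [/\ C0_generator S p k w,
    L2_rnorm mu (fun x => u x - (w \_ S) x) <= delta &
    L2_rnorm mu (k \_ S) <= C * L2_rnorm mu (w \_ S)].
Proof.
move=> u2 u0 d0; have d20 : 0 < delta / 2 by rewrite divr_gt0.
have [w0 [cw0 bw0 uw0]] := L2_dense_continuous muT u2 d20.
have w02 := bL bw0; have uw02 := LfunB u2 w02.
pose m := L2_inner mu w0 (one \_ S).
have mle : `|m| <= delta / 2.
  apply: le_trans uw0; apply: le_trans (meanle uw02).
  by rewrite L2_innerBl// u0 sub0r normrN.
pose w x := w0 x - m.
have cw : continuous w by move=> x; apply: cvgB; [exact: cw0|exact: cst_continuous].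
have cwS : {within S, continuous w} by exact: continuous_subspaceT.
have [M wM] := within_continuous_bounded (ltW L0) cwS.
have Z0 : 2 + omega%:num * L%:num != 0 by rewrite gt_eqF// ltr_pwDl// mulr_ge0.
have intw : \int[mu]_(x in S) w x = 0.
  have I f : bounded_measurable f -> mu.-integrable S (EFin \o f).
    exact: bounded_measurable_integrable_on.
  rewrite RintegralB//; [|exact: I|exact/I/bounded_measurable_cst].
  rewrite Rintegral_cst// /m inner_S//; [|by case: bw0 => m0 _; exact: measurable_funTS|exact: mc].
  rewrite muS1 mulr1; apply/eqP; rewrite subr_eq0; apply/eqP; apply: eq_Rintegral => x _.
  by rewrite mulr1.
have wS := @sticky_Rintegral_on R omega L w M (mc cwS) wM.
have w00 : w 0 + w L%:num + omega%:num * \int[lebesgue_measure]_(x in `[0, L%:num]) w x = 0.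
  by move: wS; rewrite intw => /esym/eqP; rewrite mulf_eq0 invr_eq0 (negbTE Z0)/= => /eqP.
have [k [stk _ kb]] := sticky_solve o0 L0 cw w00.
have Ck := (hp.2 _ _).2 stk; have [ck _ _] := Ck.
exists w, k; split => //.
  have mS2 : (fun x => m * (one \_ S) x) \in Lfun mu 2%:E.
    by have := Lfun_lin m one2 (LfunB one2 one2); under eq_fun do rewrite subrr addr0.
  rewrite [leRHS]splitr.
  apply: (@le_trans _ _ (L2_rnorm mu (fun x => u x - w0 x) +
      L2_rnorm mu (fun x => m * (one \_ S) x))).
    apply: le_trans (ler_L2_rnormD uw02 mS2).
    rewrite le_eqVlt; apply/orP; left; apply/eqP; apply: ae_eq_L2_rnorm.
    - by apply: LfunB => //; exact: cL.
    - by have := Lfun_lin 1 uw02 mS2; under eq_fun do rewrite mul1r.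
    - by move: sticky_aeS; apply: filterS => x Sx _; rewrite !patchE mem_set// /w /one; ring.
  rewrite lerD// L2_rnormZ// (le_trans _ mle)// ler_piMr//.
pose A := \int[mu]_(x in S) `|w x|.
have caw : {within S, continuous (fun x => `|w x|)}.
  by apply: continuous_subspaceT => x; apply: cvg_norm; exact: cw.
have A0 : 0 <= A by exact: Rintegral_ge0.
have kA x : S x -> `|k x| <= C * A.
  move=> Sx; rewrite (le_trans (kb x Sx))// /C -mulrA ler_pM2l//.
  have awM y : S y -> `| `|w y| | <= M by move=> Sy; rewrite normr_id wM.
  rewrite /A (@sticky_Rintegral_on R omega L _ M (mc caw) awM).
  rewrite [leRHS](_ : _ = (`|w 0| + `|w L%:num|) / omega%:num +
     \int[lebesgue_measure]_(x in `[0, L%:num]) `|w x|); last by field; rewrite Z0 gt_eqF.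
  by rewrite lerD2r ler_pM2r ?invr_gt0// lerDl.
have AM : A <= L2_rnorm mu (w \_ S).
  have aw2 : (fun x => `|w x|) \_ S \in Lfun mu 2%:E by exact: cL.
  have -> : A = L2_inner mu ((fun x => `|w x|) \_ S) (one \_ S).
    rewrite /A Rintegral_mkcond; apply: eq_Rintegral => x _.
    by rewrite !patchE; case: ifP; rewrite ?mulr1 ?mulr0.
  rewrite (le_trans (ler_norm _))// (le_trans (meanle aw2))//.
  rewrite le_eqVlt; apply/orP; left; apply/eqP; congr Num.sqrt.
  apply: eq_Rintegral => x _; rewrite !patchE; case: ifP => // _.
  by rewrite -normrM -expr2 ger0_norm ?sqr_ge0.
apply: (@le_trans _ _ (C * A)); last by rewrite ler_wpM2l.
apply: L2_rnorm_le_cst; [exact: sticky_measureT|by rewrite mulr_ge0|by case: (bmc ck)|].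
move=> x; rewrite patchE; case: ifP => [/set_mem Sx|_]; first exact: kA.
by rewrite normr0 mulr_ge0.
Qed.

(** Duality: if [k] solves [k'' = w] with [w] close to [u], then the square of the norm of [u] is
    close to [<u, w> = <v, k>], where [|k| <= C * |w|] in norm. No derivative of [u] is needed,
    although [u] is only in the L^2 domain. *)
Lemma sticky_poincare u v : L2_generator mu T u v ->
  L2_inner mu u (one \_ S) = 0 -> L2_rnorm mu u <= C * L2_rnorm mu v.
Proof.
move=> Auv u0; have [u2 v2 _] := Auv.
set nu := L2_rnorm mu u; set nv := L2_rnorm mu v.
have nu0 : 0 <= nu by exact: L2_rnorm_ge0.
have nv0 : 0 <= nv by exact: L2_rnorm_ge0.
have key : nu ^+ 2 <= C * nv * nu.
  apply/ler_addgt0Pr => e e0.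
  have K0 : 0 < nu + C * nv + 1 by rewrite ltr_wpDl// addr_ge0// mulr_ge0.
  have d0 : 0 < e / (nu + C * nv + 1) by rewrite divr_gt0.
  have [w [k [Ck uw kw]]] := sticky_solve_dense u2 u0 d0.
  have [ck cw _] := Ck; have w2 := cL cw; have k2 := cL ck; have uw2 := LfunB u2 w2.
  set del := e / _ in d0 uw.
  (* Splits [<u, u>] along [w] and moves the generator from [k] to [u] by
     [L2_generator_C0_adjoint]. *)
  have h1 : nu ^+ 2 = L2_inner mu u (fun x => u x - (w \_ S) x) + L2_inner mu v (k \_ S).
    rewrite (L2_generator_C0_adjoint Auv Ck) L2_innerC L2_innerBl// sqr_L2_rnorm.
    by rewrite [X in _ = _ - X + _]L2_innerC; ring.
  have h2 : L2_inner mu u (fun x => u x - (w \_ S) x) <= nu * del.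
    rewrite (le_trans (ler_norm _))// (le_trans (cauchy_schwarz_L2 u2 uw2))//.
    by rewrite ler_wpM2l.
  have h3 : L2_rnorm mu (w \_ S) <= nu + del.
    have nwu2 : (fun x => - 1 * (u x - (w \_ S) x)) \in Lfun mu 2%:E.
      by have := Lfun_lin (-1) uw2 (LfunB u2 u2); under eq_fun do rewrite subrr addr0.
    have := ler_L2_rnormD u2 nwu2; rewrite L2_rnormZ// normrN normr1 mul1r.
    have -> : (fun x => u x + -1 * (u x - (w \_ S) x)) = w \_ S.
      by apply/funext => x; ring.
    by move=> /le_trans; apply; rewrite lerD2l.
  have h4 : L2_inner mu v (k \_ S) <= nv * (C * (nu + del)).
    rewrite (le_trans (ler_norm _))// (le_trans (cauchy_schwarz_L2 v2 k2))//.
    by rewrite ler_wpM2l// (le_trans kw)// ler_wpM2l.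
  rewrite h1 (le_trans (lerD h2 h4))//.
  rewrite [leLHS](_ : _ = C * nv * nu + (nu + C * nv) * del); last by ring.
  rewrite lerD2l /del mulrCA ler_piMr ?(ltW e0)// ler_pdivrMr// mul1r.
  by rewrite lerDl.
have [nu00|nuN0] := eqVneq nu 0; first by rewrite nu00 mulr_ge0.
by move: key; rewrite expr2 ler_pM2r// lt_neqAle eq_sym nuN0.
Qed.

(* By Poincare's inequality, approximating the image [g] of [f] in L^2 and
   solving the equation for the approximation also approximates [f], up to an
   additive constant. *)
Lemma sticky_core : is_core mu (L2_generator mu T)
  [set f \_ S | f in [set f | exists g, C0_generator S p f g]].
Proof.
split.
- exists (fun=> 0); last by apply/funext => x; rewrite patchE; case: ifP.
  by exists (fun=> 0); apply: (hp.2 _ _).2; exact: sticky_operator_cst.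
- move=> a _ _ [f [f2 Cf] <-] [g [g2 Cg] <-].
  exists (fun x => a * f x + g x).
    exists (fun x => a * f2 x + g2 x); apply: (hp.2 _ _).2.
    by apply: sticky_operator_lin; apply: (hp.2 _ _).1.
  by apply/funext => x; rewrite !patchE; case: ifP => // _; rewrite mulr0 addr0.
- by move=> _ [f [f2 Cf] <-]; exists (f2 \_ S); exact: L2_generator_C0.
move=> f g Afg e e0; have [f2 g2 _] := Afg.
have C1 (c : R) : C0_generator S p (fun=> c) (fun=> 0).
  by apply: (hp.2 _ _).2; exact: sticky_operator_cst.
(* The generator annihilates the constant 1, so by symmetry every image has mean zero, the
   solvability condition. *)
have g0 : L2_inner mu g (one \_ S) = 0.
  rewrite (L2_generator_C0_adjoint Afg (C1 1)).
  rewrite /L2_inner /Rintegral integral0_eq// => x _.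
  by rewrite patchE; case: ifP; rewrite mulr0.
(* This tolerance is at most [e], and remains so after multiplication by the Poincare constant
   [C]. *)
have d0 : 0 < e / (C + 1) by rewrite divr_gt0// ltr_wpDl.
have [w [k [Ck gw _]]] := sticky_solve_dense g2 g0 d0.
have [ck cw _] := Ck; have w2 := cL cw; have k2 := cL ck.
(* Shifting [k] by the mean of its distance to [f] makes the difference a mean zero element of the
   L^2 domain and does not change its image. *)
pose c := L2_inner mu (fun x => (k \_ S) x - f x) (one \_ S).
pose k' x := k x - c.
have Ck' : C0_generator S p k' w.
  apply: (hp.2 _ _).2.
  have := sticky_operator_lin 1 ((hp.2 _ _).1 Ck) ((hp.2 _ _).1 (C1 (- c))).
  congr sticky_operator; apply/funext => x; first by rewrite mul1r.
  by rewrite mul1r addr0.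
have Ak' := L2_generator_C0 Ck'; have [k'2 _ _] := Ak'.
exists (k' \_ S), (w \_ S).
have wg : L2_rnorm mu (fun x => -1 * g x + (w \_ S) x) <= e / (C + 1).
  rewrite (le_trans _ gw)// -L2_rnormN le_eqVlt; apply/orP; left; apply/eqP.
  by congr L2_rnorm; apply/funext => x; ring.
have A1 := L2_generator_lin sT (-1) Afg Ak'.
have z : L2_inner mu (fun x => -1 * f x + (k' \_ S) x) (one \_ S) = 0.
  have -> : (fun x => -1 * f x + (k' \_ S) x) =
      (fun x => - c * (one \_ S) x + ((k \_ S) x - f x)).
    by apply/funext => x; rewrite !patchE /one /k'; case: ifP => _; rewrite -?[point]/(0 : R); ring.
  rewrite L2_inner_linl//; last exact: LfunB.
  rewrite -/c; suff -> : L2_inner mu (one \_ S) (one \_ S) = 1 by ring.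
  rewrite inner_S//; [|by case: (bmc cone) => m1 _; exact: measurable_funTS|exact: mc].
  rewrite -[RHS](mul1r 1) -[X in _ = _ * X]muS1 -Rintegral_cst//.
  by apply: eq_Rintegral => x Sx; rewrite patchE Sx /one mulr1.
have ce : C * (e / (C + 1)) <= e.
  by rewrite mulrCA ler_piMr ?(ltW e0)// ler_pdivrMr ?ltr_wpDl// mul1r lerDl.
have fk : (fun x => (k' \_ S) x - f x) = (fun x => -1 * f x + (k' \_ S) x).
  by apply/funext => x; ring.
have gwE : (fun x => (w \_ S) x - g x) = (fun x => -1 * g x + (w \_ S) x).
  by apply/funext => x; ring.
split => //.
- by exists k' => //; exists w.
- rewrite /L2_dist fk L2_normE ?lee_fin; last exact: Lfun_lin.
  by rewrite (le_trans (sticky_poincare A1 z))// (le_trans _ ce)// ler_wpM2l.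
- rewrite /L2_dist gwE L2_normE ?lee_fin; last exact: Lfun_lin.
  rewrite (le_trans wg)// ler_pdivrMr ?ltr_wpDl// ler_peMr ?(ltW e0)//.
  by rewrite lerDr.
Qed.
End sticky_core.

(** * Paths of the jamming process *)

Lemma ler_norm_clamp (R : realType) (a b x y : R) :
  `|Num.max a (Num.min b x) - Num.max a (Num.min b y)| <= `|x - y|.
Proof.
wlog xy : x y / x <= y => [H|].
  have [/H//|/ltW/H] := leP x y; by rewrite distrC (distrC y).
have h1 : Num.min b x <= Num.min b y.
  by rewrite le_min ge_min lexx/= ge_min xy orbT.
have h2 : Num.max a (Num.min b x) <= Num.max a (Num.min b y).
  by rewrite ge_max le_max lexx/= le_max h1 orbT.
rewrite distrC (distrC x) !ger0_norm ?subr_ge0//.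
have h3 : Num.min b y - Num.min b x <= y - x.
  by have [bx|xb] := leP b x; have [byy|yb] := leP b y; lra.
suff : Num.max a (Num.min b y) - Num.max a (Num.min b x) <= Num.min b y - Num.min b x by lra.
by have [ax|xa] := leP a (Num.min b x); have [ay|ya] := leP a (Num.min b y); lra.
Qed.

Section rtp_paths.
Context (R : realType) (omega L : R) d (Omega : measurableType d)
  (Q : R -> probability Omega R) (v : R -> Omega -> R)
  (tau : nat -> Omega -> R) (x : R -> R -> Omega -> R).
Hypothesis L0 : 0 < L.
Hypothesis hx : jamming_rtp omega L Q v tau x.
Let hv := rtp_velocity hx.
Let clamp (y : R) : R := Num.max 0 (Num.min L y).

Lemma jump_time_le n m w : (n <= m)%N -> tau n w <= tau m w.
Proof.
elim: m => [|m IH]; first by rewrite leqn0 => /eqP ->.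
rewrite leq_eqVlt => /predU1P[->//|]; rewrite ltnS => /IH h.
by rewrite (le_trans h)// ltW// (mjp_time_lt hv).
Qed.

Lemma jump_time_ge0 n w : 0 <= tau n w.
Proof. by rewrite -(mjp_time0 hv w); exact: jump_time_le. Qed.

Lemma jump_interval t w : 0 <= t -> exists n, tau n w <= t < tau n.+1 w.
Proof.
move=> t0.
have ex : exists n, t < tau n w.
  have /cvgryPgt /(_ t) [n _ H] := mjp_time_cvg hv w.
  by exists n; apply: H => /=.
case: (ex_minnP ex) => -[|n]; first by rewrite (mjp_time0 hv) ltNge t0.
move=> tn min_n; exists n; rewrite tn andbT leNgt; apply/negP => /min_n.
by rewrite ltnn.
Qed.

(** At the next jump time the recursion restarts from the position it should determine. Continuity
    of the path extends the formula to this right end, which makes induction over the jumps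
    possible. *)
Lemma rtp_motion_le (x0 : R) n t w : x0 \in `[0, L] -> tau n w <= t <= tau n.+1 w ->
  x x0 t w = clamp (x x0 (tau n w) w + v (tau n w) w * (t - tau n w)).
Proof.
move=> x0L /andP[nt]; rewrite le_eqVlt => /predU1P[->|tn]; last first.
  by apply: (rtp_motion hx) => //; rewrite nt.
set T := tau n.+1 w; set g := fun t => clamp (x x0 (tau n w) w + v (tau n w) w * (t - tau n w)).
have T0 : 0 < T.
  by rewrite (le_lt_trans (jump_time_ge0 n w))// (mjp_time_lt hv).
have cg : g t @[t --> T^'-] --> g T.
  apply: cvg_at_left_filter.
  have cl : {for T, continuous (fun t => x x0 (tau n w) w + v (tau n w) w * (t - tau n w))}.
    apply: cvgD; first exact: cvg_cst.
    apply: cvgM; first exact: cvg_cst.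
    by apply: cvgB; [exact: cvg_id|exact: cvg_cst].
  exact: (@continuous_comp R R R _ clamp T cl (@continuous_clamp R 0 L _)).
have cx : x x0 t w @[t --> T^'-] --> x x0 T w.
  have : {within `[0, +oo[, continuous (fun t => x x0 t w)} by exact: (rtp_continuous hx x0L).
  move=> /subspace_continuousP.
  move=> /(_ T); rewrite /= in_itv/= andbT => /(_ (ltW T0)).
  move=> H; apply/cvgrPdist_le => e e0; move/cvgrPdist_le : H => /(_ e e0).
  rewrite !near_withinE => HA; near=> s => _.
  have s0 : `[0, +oo[%classic s.
    by rewrite /= in_itv/= andbT ltW//; near: s; exact: lt_nbhsr.
  suff : `[0, +oo[%classic s -> `|x x0 T w - x x0 s w| <= e by apply.
  by near: s.
have cx2 : x x0 t w @[t --> T^'-] --> g T.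
  apply: cvg_trans cg; apply: near_eq_cvg; near=> s.
  apply/esym; apply: (rtp_motion hx) => //; apply/andP; split.
    by apply/ltW; near: s; apply: nbhs_left_gt; exact: (mjp_time_lt hv).
  by near: s; exact: nbhs_left_lt.
exact: (cvg_unique _ cx cx2).
Unshelve. all: by end_near. Qed.

Let clampL (y : R) : clamp y \in `[0, L].
Proof. exact/clamp_in/ltW. Qed.

Lemma rtp_position_in (x0 : R) t w : x0 \in `[0, L] -> 0 <= t -> x x0 t w \in `[0, L].
Proof.
move=> x0L t0; have [n nt] := jump_interval w t0.
by rewrite (rtp_motion hx x0L nt); exact: clampL.
Qed.

Lemma rtp_velocity_in t w : 0 <= t -> v t w \in rtp_velocities R.
Proof.
move=> t0; have [n nt] := jump_interval w t0.
by rewrite (mjp_constant hv nt); exact: (mjp_state hv).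
Qed.

Let velocity_bound n w : `|v (tau n w) w| <= 2.
Proof.
have := mjp_state hv n w; rewrite !inE => /or3P[] /eqP ->.
- by rewrite ger0_norm.
- by rewrite normr0.
- by rewrite normrN ger0_norm.
Qed.

(** Between jumps the speed is at most 2 and the projection, being 1-Lipschitz and fixing the
    current position, does not increase displacements. *)
Lemma rtp_displacement (x0 : R) t w : x0 \in `[0, L] -> 0 <= t ->
  `|x x0 t w - x0| <= 2 * t.
Proof.
move=> x0L t0.
have step n s : tau n w <= s <= tau n.+1 w ->
    `|x x0 s w - x x0 (tau n w) w| <= 2 * (s - tau n w).
  move=> /andP[ns sn]; rewrite (@rtp_motion_le x0 n s w x0L) ?ns ?sn//.
  have xn := rtp_position_in w x0L (jump_time_ge0 n w).
  rewrite -[X in _ - X](clamp_id xn) (le_trans (ler_norm_clamp _ _ _ _))//.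
  rewrite addrAC subrr add0r normrM [X in _ * X]ger0_norm ?subr_ge0//.
  by rewrite ler_wpM2r ?subr_ge0.
have at_jump n : `|x x0 (tau n w) w - x0| <= 2 * tau n w.
  elim: n => [|n IH].
    by rewrite (mjp_time0 hv) (rtp_start hx)// subrr normr0 mulr0.
  have := step n (tau n.+1 w); rewrite lexx andbT jump_time_le// => /(_ isT) H.
  rewrite -(subrK (x x0 (tau n w) w) (x x0 (tau n.+1 w) w)) -addrA.
  by rewrite (le_trans (ler_normD _ _))// (le_trans (lerD H IH))//; lra.
have [n /andP[nt tn]] := jump_interval w t0.
have := step n t; rewrite nt ltW// => /(_ isT) H.
rewrite -(subrK (x x0 (tau n w) w) (x x0 t w)) -addrA.
by rewrite (le_trans (ler_normD _ _))// (le_trans (lerD H (at_jump n)))//; lra.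
Qed.

(* Both paths are moved by the same displacement followed by the 1-Lipschitz
   projection on [0, L]. *)
Lemma rtp_coupling (x0 x1 : R) t w : x0 \in `[0, L] -> x1 \in `[0, L] -> 0 <= t ->
  `|x x0 t w - x x1 t w| <= `|x0 - x1|.
Proof.
move=> x0L x1L t0.
have step n s : tau n w <= s <= tau n.+1 w ->
    `|x x0 s w - x x1 s w| <= `|x x0 (tau n w) w - x x1 (tau n w) w|.
  move=> ns; rewrite (rtp_motion_le x0L ns) (rtp_motion_le x1L ns).
  rewrite (le_trans (ler_norm_clamp _ _ _ _))// le_eqVlt; apply/orP; left; apply/eqP.
  by congr (`|_|); ring.
have at_jump n : `|x x0 (tau n w) w - x x1 (tau n w) w| <= `|x0 - x1|.
  elim: n => [|n IH]; first by rewrite (mjp_time0 hv) !(rtp_start hx).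
  by apply: le_trans IH; apply: step; rewrite lexx andbT jump_time_le.
have [n /andP[nt tn]] := jump_interval w t0.
by apply: le_trans (at_jump n); apply: step; rewrite nt ltW.
Qed.

(** [U m] is [Y n] for the largest [n < m] with [tau n <= t]. It is measurable for each [m], and at
    each point it is eventually constant in [m], as [t] lies in a single jump interval. *)
Let measurable_jump_process (t : R) (Y : nat -> Omega -> R) (z : Omega -> R) : 0 <= t ->
  (forall n, measurable_fun setT (Y n)) ->
  (forall n w, tau n w <= t < tau n.+1 w -> z w = Y n w) -> measurable_fun setT z.
Proof.
move=> t0 mY zY.
pose U := fix U n : Omega -> R := if n is n'.+1 then
  (fun w => if tau n' w <= t then Y n' w else U n' w) else (fun=> 0).
have mU n : measurable_fun setT (U n).
  elim: n => [|n IH] /=; first exact: measurable_cst.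
  apply: measurable_fun_ifT => //.
  by apply: measurable_fun_ler => //; exact: (mjp_measurable_time hv).
apply: (@measurable_fun_cvg _ _ _ _ U) => // w _.
have [n nt] := jump_interval w t0; have /andP[n1 n2] := nt.
apply: cvg_near_cst; exists n.+1 => // m /= nm.
elim: m nm => // m IH; rewrite leq_eqVlt => /predU1P[<-|].
  by rewrite /= n1 (zY _ _ nt).
rewrite ltnS => nm; rewrite /= leNgt (lt_le_trans n2 (jump_time_le w nm))/=.
exact: IH.
Qed.

Lemma rtp_velocity_measurable t : 0 <= t -> measurable_fun setT (v t).
Proof.
move=> t0; apply: (measurable_jump_process t0 (mjp_measurable_chain hv)) => n w.
exact: (mjp_constant hv).
Qed.

Lemma rtp_position_measurable (x0 : R) t : x0 \in `[0, L] -> 0 <= t ->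
  measurable_fun setT (x x0 t).
Proof.
move=> x0L t0.
have mmove (X : Omega -> R) n (s : Omega -> R) : measurable_fun setT X -> measurable_fun setT s ->
    measurable_fun setT (fun w => clamp (X w + v (tau n w) w * (s w - tau n w))).
  move=> mX ms; apply: (@measurableT_comp _ _ _ _ _ _ clamp).
    by apply: continuous_measurable_fun; exact: continuous_clamp.
  apply: measurable_funD => //; apply: measurable_funM.
    exact: (mjp_measurable_chain hv).
  by apply: measurable_funB => //; exact: (mjp_measurable_time hv).
have mX n : measurable_fun setT (fun w => x x0 (tau n w) w).
  elim: n => [|n IH].
    rewrite (_ : (fun w => _) = fun=> x0); first exact: measurable_cst.
    by apply/funext => w; rewrite (mjp_time0 hv) (rtp_start hx).
  rewrite (_ : (fun w => _) = fun w => clamp (x x0 (tau n w) w +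
    v (tau n w) w * (tau n.+1 w - tau n w))).
    by apply: mmove => //; exact: (mjp_measurable_time hv).
  apply/funext => w; apply: rtp_motion_le => //.
  by rewrite lexx andbT jump_time_le.
apply: (measurable_jump_process (Y := fun n w => clamp (x x0 (tau n w) w +
    v (tau n w) w * (t - tau n w))) t0) => [n|n w nt].
  by apply: (mmove _ n (fun=> t)).
exact: (rtp_motion hx).
Qed.

Lemma rtp_nojump (x0 : R) t w : x0 \in `[0, L] -> 0 <= t -> t < tau 1%N w ->
  x x0 t w = clamp (x0 + v (tau 0%N w) w * t) /\ v t w = v (tau 0%N w) w.
Proof.
move=> x0L t0 t1; have nt : tau 0%N w <= t < tau 1%N w by rewrite (mjp_time0 hv) t0.
rewrite (rtp_motion hx x0L nt) (mjp_constant hv nt); split => //.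
by rewrite (mjp_time0 hv) (rtp_start hx)// subr0.
Qed.
End rtp_paths.

(** * Expectations over a short time step *)

Section bounded_expectation.
Context d (E : measurableType d) (R : realType) (mu : {measure set E -> \bar R}).
Hypothesis muT : (mu setT < +oo)%E.
Implicit Types (f g : E -> R).

Lemma bounded_measurableD f g : bounded_measurable f -> bounded_measurable g ->
  bounded_measurable (fun x => f x + g x).
Proof.
by move=> bf bg; have := bounded_measurable_lin 1 bf bg; under eq_fun do rewrite mul1r.
Qed.

Lemma bounded_measurableZ (a : R) f : bounded_measurable f ->
  bounded_measurable (fun x => a * f x).
Proof. by move=> bf; apply: bounded_measurableM => //; exact: bounded_measurable_cst. Qed.

Lemma bounded_measurableB f g : bounded_measurable f -> bounded_measurable g ->
  bounded_measurable (fun x => f x - g x).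
Proof.
move=> bf bg; have := bounded_measurable_lin (-1) bg bf.
by under eq_fun do rewrite mulN1r addrC.
Qed.

Lemma bounded_measurable_RintegralD f g : bounded_measurable f -> bounded_measurable g ->
  \int[mu]_x (f x + g x) = \int[mu]_x f x + \int[mu]_x g x.
Proof.
by move=> bf bg; rewrite RintegralD//; exact: bounded_measurable_integrable.
Qed.

Lemma bounded_measurable_RintegralB f g : bounded_measurable f -> bounded_measurable g ->
  \int[mu]_x (f x - g x) = \int[mu]_x f x - \int[mu]_x g x.
Proof.
by move=> bf bg; rewrite RintegralB//; exact: bounded_measurable_integrable.
Qed.

Lemma bounded_measurable_RintegralZ (a : R) f : bounded_measurable f ->
  \int[mu]_x (a * f x) = a * \int[mu]_x f x.
Proof. by move=> bf; rewrite RintegralZl//; exact: bounded_measurable_integrable. Qed.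

Lemma bounded_measurable_sum (I : Type) (s : seq I) (F : I -> E -> R) :
  (forall i, bounded_measurable (F i)) ->
  bounded_measurable (fun x => \sum_(i <- s) F i x).
Proof.
move=> bF; elim: s => [|i s IH].
  rewrite (_ : (fun x => _) = fun=> 0); first exact: bounded_measurable_cst.
  by apply/funext => x; rewrite big_nil.
rewrite (_ : (fun x => _) = fun x => F i x + \sum_(i <- s) F i x).
  exact: bounded_measurableD.
by apply/funext => x; rewrite big_cons.
Qed.

Lemma bounded_measurable_Rintegral_sum (I : Type) (s : seq I) (F : I -> E -> R) :
  (forall i, bounded_measurable (F i)) ->
  \int[mu]_x (\sum_(i <- s) F i x) = \sum_(i <- s) \int[mu]_x F i x.
Proof.
move=> bF; elim: s => [|i s IH].
  rewrite big_nil (_ : (fun x => _) = fun=> 0); first by rewrite /Rintegral integral0.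
  by apply/funext => x; rewrite big_nil.
rewrite big_cons -IH -bounded_measurable_RintegralD//; last exact: bounded_measurable_sum.
by apply: eq_Rintegral => x _; rewrite big_cons.
Qed.

Lemma Rintegral_indic (A : set E) : measurable A -> \int[mu]_x (\1_A x : R) = fine (mu A).
Proof. by move=> mA; rewrite /Rintegral integral_indic// setIT. Qed.

Lemma le_norm_RintegralB f g e : bounded_measurable f -> bounded_measurable g ->
  bounded_measurable e -> (forall x, `|f x - g x| <= e x) ->
  `|\int[mu]_x f x - \int[mu]_x g x| <= \int[mu]_x e x.
Proof.
move=> bf bg be fge; rewrite -bounded_measurable_RintegralB//.
have Ifg := bounded_measurable_integrable muT measurableT (bounded_measurableB bf bg).
rewrite (le_trans (le_normr_Rintegral measurableT Ifg))//.
apply: le_Rintegral => //; first exact: integrable_norm.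
exact: bounded_measurable_integrable.
Qed.
End bounded_expectation.

Section rtp_rates.
Context (R : realType) (omega : R).
Hypothesis omega0 : 0 < omega.
Let V := rtp_velocities R.

Let v2v0 : (2 == 0 :> R) = false. Proof. by apply/negbTE. Qed.
Let v2vn2 : (2 == - 2 :> R) = false. Proof. by apply/negbTE/eqP; lra. Qed.
Let v0v2 : (0 == 2 :> R) = false. Proof. by rewrite eq_sym. Qed.
Let v0vn2 : (0 == - 2 :> R) = false. Proof. by apply/negbTE/eqP; lra. Qed.
Let vn2v2 : (- 2 == 2 :> R) = false. Proof. by rewrite eq_sym. Qed.
Let vn2v0 : (- 2 == 0 :> R) = false. Proof. by rewrite eq_sym. Qed.
Let vE := (v2v0, v2vn2, v0v2, v0vn2, vn2v2, vn2v0, eqxx).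

Lemma rtp_velocities_sum (c : R) (F : R -> R) : c \in V ->
  \sum_(y <- V) (c == y)%:R * F y = F c.
Proof.
rewrite /V /rtp_velocities !big_cons big_nil !inE => /or3P[] /eqP ->; rewrite ?vE /=; ring.
Qed.

Lemma rtp_rate_sum (c : R) (F : R -> R) : c \in V ->
  \sum_(y <- V) rtp_rate omega c y * F y =
  if c == 0 then omega * (F 2 + F (- 2)) else 2 * omega * F 0.
Proof.
rewrite /V /rtp_velocities !big_cons big_nil !inE => /or3P[] /eqP ->;
  rewrite /rtp_rate ?vE/=; ring.
Qed.

Lemma rtp_exit_rate (c : R) : c \in V -> exit_rate V (rtp_rate omega) c = 2 * omega.
Proof.
move=> cV; have := rtp_rate_sum (fun=> 1) cV; rewrite /exit_rate.
under eq_bigr do rewrite mulr1; move=> ->; case: ifP => _; ring.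
Qed.

(** Transition matrix of the embedded jump chain; the denominator is the exit rate, common to all
    velocities. *)
Definition rtp_jump (c y : R) : R := rtp_rate omega c y / (2 * omega).

Lemma rtp_jump_sum (c : R) (F : R -> R) : c \in V ->
  \sum_(y <- V) rtp_jump c y * F y = if c == 0 then (F 2 + F (- 2)) / 2 else F 0.
Proof.
move=> cV; have := rtp_rate_sum (fun y => (2 * omega)^-1 * F y) cV.
under eq_bigr do rewrite mulrA -/(rtp_jump c _); move=> ->.
by case: ifP => _; field; exact: lt0r_neq0.
Qed.

Lemma rtp_jump_sum1 (c : R) : c \in V -> \sum_(y <- V) rtp_jump c y = 1.
Proof.
move=> cV; have := rtp_jump_sum (fun=> 1) cV; under eq_bigr do rewrite mulr1.
by move=> ->; case: ifP => _//; field.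
Qed.
End rtp_rates.

Section rtp_one_step.
Context (R : realType) (omega L : R) d (Omega : measurableType d)
  (Q : R -> probability Omega R) (v : R -> Omega -> R)
  (tau : nat -> Omega -> R) (x : R -> R -> Omega -> R).
Hypotheses (omega0 : 0 < omega) (L0 : 0 < L).
Hypothesis hx : jamming_rtp omega L Q v tau x.
Let hv := rtp_velocity hx.
Let clamp (y : R) : R := Num.max 0 (Num.min L y).
Let V := rtp_velocities R.
Let q := rtp_jump omega.
Let gap n w := tau n.+1 w - tau n w.

(** The probability that a holding time exceeds [t], the same whatever the velocity. *)
Definition rtp_stay (t : R) : R := expR (- (2 * omega * t)).

Let chain (n : nat) (a : R) : set Omega := [set w | v (tau n w) w = a].
Let longer (n : nat) (s : R) : set Omega := [set w | s < gap n w].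

Let chain_measurable n a : measurable (chain n a).
Proof.
rewrite (_ : chain n a = setT `&` (fun w => v (tau n w) w) @^-1` [set a]); last by rewrite setTI.
by apply: (mjp_measurable_chain hv) => //; exact: measurable_set1.
Qed.

Let gap_measurable n : measurable_fun setT (gap n).
Proof. by apply: measurable_funB; exact: (mjp_measurable_time hv). Qed.

Let longer_measurable n s : measurable (longer n s).
Proof.
rewrite (_ : longer n s = setT `&` gap n @^-1` `]s, +oo[).
  by apply: gap_measurable => //; exact: measurable_itv.
by rewrite setTI; apply/seteqP; split => w; rewrite /longer /= in_itv/= andbT.
Qed.

Let law0 (c : R) : c \in V -> Q c (chain 0 c) = 1%E.
Proof.
move=> cV.
have := @mjp_law _ _ _ _ _ _ _ _ hv c 0 (fun=> c) (fun=> 0) cV (fun=> cV) (fun=> lexx 0).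
rewrite eqxx big_ord0 mulr1 => <-; congr (Q c _).
apply/seteqP; split => w /=; first by move=> h; split => // -[|].
by move=> [/(_ 0%N (leqnn _))].
Qed.

Let law1 (c y s : R) : c \in V -> y \in V -> 0 <= s ->
  Q c (chain 0 c `&` chain 1 y `&` longer 0 s) = (q c y * rtp_stay s)%:E.
Proof.
move=> cV yV s0.
have yyV i : (if i is 0 then c else y) \in V by case: i.
have := @mjp_law _ _ _ _ _ _ _ _ hv c 1 (fun i => if i is 0 then c else y) (fun=> s) cV yyV
  (fun=> s0).
rewrite eqxx big_ord_recl big_ord0 mulr1 mul1r (rtp_exit_rate omega cV) => <-.
congr (Q c _); apply/seteqP; split => w /=.
  by move=> [[h0 h1] h2]; split; [case=> [|[|]]|case].
by move=> [h1 h2]; split; [split; [exact: (h1 0%N)|exact: (h1 1%N)]|exact: (h2 0%N)].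
Qed.

(** The product form of the first two holding times makes two jumps before time [h] an event of
    order [h ^+ 2]. *)
Let law2 (c y z s t : R) : c \in V -> y \in V -> z \in V -> 0 <= s -> 0 <= t ->
  Q c (chain 0 c `&` chain 1 y `&` chain 2 z `&` longer 0 s `&` longer 1 t) =
  (q c y * rtp_stay s * (q y z * rtp_stay t))%:E.
Proof.
move=> cV yV zV s0 t0.
pose ys i : R := if i is 0 then c else if i is 1 then y else z.
pose ss i : R := if i is 0 then s else t.
have yyV i : ys i \in V by case: i => [|[|]].
have ss0 i : 0 <= ss i by case: i.
have := @mjp_law _ _ _ _ _ _ _ _ hv c 2 ys ss cV yyV ss0.
rewrite eqxx !big_ord_recl big_ord0 mulr1 mul1r /ys/=.
rewrite (rtp_exit_rate omega cV) (rtp_exit_rate omega yV) => <-.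
congr (Q c _); apply/seteqP; split => w /=.
  by move=> [[[[h0 h1] h2] h3] h4]; split; [case=> [|[|[|]]]|case=> [|[|]]].
move=> [h1 h2]; split; [|exact: (h2 1%N)]; split; [|exact: (h2 0%N)].
by split; [split; [exact: (h1 0%N)|exact: (h1 1%N)]|exact: (h1 2%N)].
Qed.

Let chain_in n a w : (w \in chain n a) = (v (tau n w) w == a).
Proof. by apply/idP/eqP => [/set_mem|h]; [|apply/mem_set]. Qed.

Let longer_in n s w : (w \in longer n s) = (s < gap n w).
Proof. by apply/idP/idP => [/set_mem|h]; [|apply/mem_set]. Qed.

Let A (c y s : R) : set Omega := chain 0 c `&` chain 1 y `&` longer 0 s.
Let F (c y z s t : R) : set Omega :=
  chain 0 c `&` chain 1 y `&` chain 2 z `&` longer 0 s `&` longer 1 t.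

Let A_measurable c y s : measurable (A c y s).
Proof. by do ?apply: measurableI. Qed.

Let F_measurable c y z s t : measurable (F c y z s t).
Proof. by do ?apply: measurableI. Qed.

Let A_indic c y s w : \1_(A c y s) w =
  (v (tau 0 w) w == c)%:R * ((v (tau 1 w) w == y)%:R * (s < gap 0 w)%R%:R) :> R.
Proof. by rewrite indicE !in_setI !chain_in longer_in -!natrM !mulnb andbA. Qed.

Let F_indic c y z s t w : \1_(F c y z s t) w =
  (v (tau 0 w) w == c)%:R * ((v (tau 1 w) w == y)%:R * ((v (tau 2 w) w == z)%:R *
    ((s < gap 0 w)%R%:R * (t < gap 1 w)%R%:R))) :> R.
Proof. by rewrite indicE !in_setI !chain_in !longer_in -!natrM !mulnb !andbA. Qed.

(* Before time [h] there is no jump, or a single one up to probability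
   O(h^2); after a single jump the displacement is O(h). *)
Lemma rtp_one_step (x0 c h M K : R) (u : measurableTypeR R * measurableTypeR R -> R) :
  x0 \in `[0, L] -> c \in V -> 0 <= h -> bounded_measurable u ->
  (forall z, `|u z| <= M) -> 0 <= K ->
  (forall y a b, y \in V -> a \in `[0, L] -> b \in `[0, L] ->
    `|u (a, y) - u (b, y)| <= K * `|a - b|) ->
  `|rtp_transition Q v x h u (x0, c) - (rtp_stay h * u (clamp (x0 + c * h), c) +
     (1 - rtp_stay h) * \sum_(y <- V) q c y * u (x0, y))| <=
  2 * K * h * (1 - rtp_stay h) + 2 * M * (1 - rtp_stay h) ^+ 2.
Proof.
move=> x0L cV h0 bu uM K0 uK.
set st := rtp_stay h; set U := u (clamp (x0 + c * h), c).
have st0 : rtp_stay 0 = 1 by rewrite /rtp_stay mulr0 oppr0 expR0.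
have QT : (Q c setT < +oo)%E by rewrite probability_setT ltry.
have bI (B : set Omega) : measurable B -> bounded_measurable (\1_B : Omega -> R).
  exact: bounded_measurable_indic.
pose X w := u (x x0 h w, v h w).
have bX : bounded_measurable X.
  split; last by exists M => w; exact: uM.
  have mx := rtp_position_measurable hx x0L h0.
  have mv := rtp_velocity_measurable hx h0.
  apply: (@measurableT_comp _ _ _ _ _ _ u); first by case: bu.
  exact: (measurable_fun_pair mx mv).
pose m y w : R := \1_(A c y h) w * U + (\1_(A c y 0) w - \1_(A c y h) w) * u (x0, y).
have bm y : bounded_measurable (m y).
  apply: bounded_measurableD; apply: bounded_measurableM;
    do ?exact: bounded_measurable_cst; last apply: bounded_measurableB; exact: bI.
pose e1 y w : R := \1_(A c y 0) w - \1_(A c y h) w.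
have be1 y : bounded_measurable (e1 y) by apply: bounded_measurableB; exact: bI.
(* Inclusion-exclusion for the event that both holding times are at most [h]: the law is given by
   tails, and holding times are positive, so that the tail at 0 is the full event. *)
pose e2 y z w : R := \1_(F c y z 0 0) w - \1_(F c y z h 0) w -
  (\1_(F c y z 0 h) w - \1_(F c y z h h) w).
have be2 y z : bounded_measurable (e2 y z).
  by apply: bounded_measurableB; apply: bounded_measurableB; exact: bI.
(* A pointwise error bound. With a first jump by time [h] the displacement costs [2 * K * h], two
   short holding times cost a further [2 * M], and a wrong initial velocity, which has probability
   zero, costs [M]. *)
pose err w := 2 * K * h * (\sum_(y <- V) e1 y w) +
  (2 * M * (\sum_(y <- V) \sum_(z <- V) e2 y z w) + M * (1 - \1_(chain 0 c) w)).
have bs1 : bounded_measurable (fun w => \sum_(y <- V) e1 y w).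
  exact: bounded_measurable_sum.
have bs2 y : bounded_measurable (fun w => \sum_(z <- V) e2 y z w).
  exact: bounded_measurable_sum.
have bs3 : bounded_measurable (fun w => \sum_(y <- V) \sum_(z <- V) e2 y z w).
  exact: bounded_measurable_sum.
have bD : bounded_measurable (fun w => 1 - \1_(chain 0 c) w : R).
  by apply: bounded_measurableB; [exact: bounded_measurable_cst|exact: bI].
have berr : bounded_measurable err.
  by apply: bounded_measurableD; [|apply: bounded_measurableD]; exact: bounded_measurableZ.
have bmain : bounded_measurable (fun w => \sum_(y <- V) m y w).
  exact: bounded_measurable_sum.
have IA y s : y \in V -> 0 <= s -> \int[Q c]_w (\1_(A c y s) w : R) = q c y * rtp_stay s.
  by move=> yV s0; rewrite Rintegral_indic// [X in fine X](law1 cV yV s0).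
have IF y z s t : y \in V -> z \in V -> 0 <= s -> 0 <= t ->
    \int[Q c]_w (\1_(F c y z s t) w : R) = q c y * rtp_stay s * (q y z * rtp_stay t).
  by move=> yV zV s0 t0; rewrite Rintegral_indic// [X in fine X](law2 cV yV zV s0 t0).
have Imain : \int[Q c]_w (\sum_(y <- V) m y w) =
    st * U + (1 - st) * \sum_(y <- V) q c y * u (x0, y).
  rewrite bounded_measurable_Rintegral_sum//.
  rewrite big_seq (eq_bigr (fun y => q c y * (st * U) + (1 - st) * (q c y * u (x0, y)))).
    by rewrite -big_seq big_split/= -mulr_suml -mulr_sumr rtp_jump_sum1// mul1r.
  move=> y yV; rewrite bounded_measurable_RintegralD//; last 2 first.
  - by apply: bounded_measurableM; [exact: bI|exact: bounded_measurable_cst].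
  - by apply: bounded_measurableM; [exact: be1|exact: bounded_measurable_cst].
  under eq_Rintegral do rewrite mulrC.
  rewrite (bounded_measurable_RintegralZ QT)//; last exact: bI.
  under [X in _ + X]eq_Rintegral do rewrite mulrC.
  rewrite (bounded_measurable_RintegralZ QT)//; last exact: be1.
  rewrite bounded_measurable_RintegralB//; [|exact: bI..].
  by rewrite !IA// st0 -/st; ring.
have Ierr : \int[Q c]_w err w = 2 * K * h * (1 - st) + 2 * M * (1 - st) ^+ 2.
  rewrite bounded_measurable_RintegralD//; last 2 first.
  - exact: bounded_measurableZ.
  - by apply: bounded_measurableD; exact: bounded_measurableZ.
  rewrite bounded_measurable_RintegralD//; [|exact: bounded_measurableZ..].
  rewrite !(bounded_measurable_RintegralZ QT)//.
  have -> : \int[Q c]_w (1 - \1_(chain 0 c) w) = 0 :> R.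
    rewrite bounded_measurable_RintegralB//; [|exact: bounded_measurable_cst|exact: bI].
    by rewrite Rintegral_indic// [X in _ - fine X](law0 cV) Rintegral_cst// [X in _ * fine X](probability_setT (Q c)) mulr1 subrr.
  rewrite mulr0 addr0; congr (_ * _ + _ * _).
    rewrite bounded_measurable_Rintegral_sum//.
    rewrite big_seq (eq_bigr (fun y => q c y * (1 - st))).
      by rewrite -big_seq -mulr_suml rtp_jump_sum1// mul1r.
    move=> y yV; rewrite bounded_measurable_RintegralB//; [|exact: bI..].
    by rewrite !IA// st0 -/st; ring.
  rewrite bounded_measurable_Rintegral_sum//.
  rewrite big_seq (eq_bigr (fun y => q c y * (1 - st) ^+ 2)).
    by rewrite -big_seq -mulr_suml rtp_jump_sum1// mul1r.
  move=> y yV; rewrite bounded_measurable_Rintegral_sum//.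
  rewrite big_seq (eq_bigr (fun z => q y z * (q c y * (1 - st) ^+ 2))).
    by rewrite -big_seq -mulr_suml rtp_jump_sum1// mul1r.
  move=> z zV; rewrite bounded_measurable_RintegralB//; last 2 first.
  - by apply: bounded_measurableB; exact: bI.
  - by apply: bounded_measurableB; exact: bI.
  rewrite !bounded_measurable_RintegralB//; do ?exact: bI.
  by rewrite !IF// st0 -/st; ring.
rewrite /rtp_transition/= -/(X _) -Imain -Ierr.
apply: le_norm_RintegralB => // w.
set v0 := v (tau 0 w) w; set v1 := v (tau 1 w) w; set v2 := v (tau 2 w) w.
have v1V : v1 \in V by exact: (mjp_state hv).
have v2V : v2 \in V by exact: (mjp_state hv).
pose a : R := (h < gap 0 w)%R%:R; pose b : R := (h < gap 1 w)%R%:R.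
have gap0 n : 0 < gap n w by rewrite subr_gt0 (mjp_time_lt hv).
have mE : \sum_(y <- V) m y w = (v0 == c)%:R * (a * U + (1 - a) * u (x0, v1)).
  rewrite (eq_bigr (fun y => (v1 == y)%:R * ((v0 == c)%:R * (a * U + (1 - a) * u (x0, y))))).
    by rewrite rtp_velocities_sum.
  by move=> y _; rewrite /m !A_indic -/v0 -/v1 gap0 -/a /=; ring.
have e1E : \sum_(y <- V) e1 y w = (v0 == c)%:R * (1 - a).
  rewrite (eq_bigr (fun y => (v1 == y)%:R * ((v0 == c)%:R * (1 - a)))).
    by rewrite rtp_velocities_sum.
  by move=> y _; rewrite /e1 !A_indic -/v0 -/v1 gap0 -/a /=; ring.
have e2E : \sum_(y <- V) \sum_(z <- V) e2 y z w = (v0 == c)%:R * ((1 - a) * (1 - b)).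
  rewrite (eq_bigr (fun y => (v1 == y)%:R * ((v0 == c)%:R * ((1 - a) * (1 - b))))).
    by rewrite rtp_velocities_sum.
  move=> y _.
  rewrite (eq_bigr (fun z => (v2 == z)%:R * ((v1 == y)%:R *
      ((v0 == c)%:R * ((1 - a) * (1 - b)))))).
    by rewrite rtp_velocities_sum.
  by move=> z _; rewrite /e2 !F_indic -/v0 -/v1 -/v2 !gap0 -/a -/b /=; ring.
rewrite mE /err e1E e2E indicE chain_in -/v0 /a /b.
have [v0c|v0c] := eqVneq v0 c; last first.
  by rewrite !mul0r !mulr0 !add0r subr0 subr0 mulr1; exact: uM.
rewrite !mul1r subrr mulr0 addr0.
have gap0E : gap 0 w = tau 1 w by rewrite /gap (mjp_time0 hv) subr0.
have [hg|gh] := ltP h (gap 0 w).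
  have ht1 : h < tau 1%N w by rewrite -gap0E.
  have [xE vE] := rtp_nojump hx x0L h0 ht1.
  rewrite /X xE vE -/v0 v0c mul1r subrr mul0r !mulr0 !addr0 subrr normr0.
  by rewrite mul0r !mulr0.
rewrite !subr0 mul0r add0r !mul1r mulr1.
(* A second holding time longer than [h] excludes a second jump before [h]. The complementary event
   is larger than having two jumps, but it factorizes and its probability still is of order
   [h ^+ 2]. *)
have [hg1|gh1] := ltP h (gap 1 w).
  have ht : tau 1 w <= h < tau 2 w.
    rewrite -gap0E gh/= -(subrK (tau 1 w) (tau 2 w)) (lt_le_trans hg1)// lerDl.
    exact: jump_time_ge0 hx 1%N w.
  rewrite subrr mulr0 addr0 /X (mjp_constant hv ht) -/v1.
  have xL := rtp_position_in L0 hx w x0L h0.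
  rewrite (le_trans (uK _ _ _ v1V xL x0L))// -mulrA mulrCA.
  rewrite ler_wpM2l//; exact: (rtp_displacement L0 hx w x0L h0).
rewrite subr0 mulr1 (le_trans (ler_normB _ _))// (le_trans (lerD (uM _) (uM _)))//.
have : 0 <= 2 * K * h by rewrite !mulr_ge0.
by lra.
Qed.
End rtp_one_step.

(** Only [1 + y <= expR y] is used, for both signs of [y]; the upper bound on [expR (- y)] rests on
    [(1 - y + y ^+ 2) * (1 + y) = 1 + y ^+ 3]. *)
Lemma rtp_stay_bounds (R : realType) (omega h : R) : 0 < omega -> 0 <= h ->
  [/\ 0 <= 1 - rtp_stay omega h, 1 - rtp_stay omega h <= 2 * omega * h &
    `|1 - rtp_stay omega h - 2 * omega * h| <= (2 * omega * h) ^+ 2].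
Proof.
move=> o0 h0; rewrite /rtp_stay; set y := 2 * omega * h.
have y0 : 0 <= y by rewrite !mulr_ge0// ltW.
have h1 : 1 - y <= expR (- y) by have := expR_ge1Dx (- y); lra.
have h2 : expR (- y) <= 1 - y + y ^+ 2.
  rewrite expRN -div1r ler_pdivrMr ?expR_gt0//.
  apply: (@le_trans _ _ ((1 - y + y ^+ 2) * (1 + y))).
    rewrite (_ : _ * _ = 1 + y ^+ 3); last by ring.
    by rewrite lerDl exprn_ge0.
  rewrite ler_wpM2l ?expR_ge1Dx//.
  have := sqr_ge0 (y - 2^-1); rewrite (_ : (y - 2^-1) ^+ 2 = y ^+ 2 - y + 4^-1); last by field.
  by lra.
have h3 : expR (- y) <= 1 by rewrite -expR0 ler_expR oppr_le0.
split; [lra|lra|].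
by rewrite ler_norml; apply/andP; split; lra.
Qed.

Lemma is_derive_comp_shift (R : realType) (f : R -> R) (x d l : R) :
  is_derive (x + d) 1 f l -> is_derive x 1 (fun y => f (y + d)) l.
Proof.
move=> /is_derive1_cvgP H; apply/is_derive1_cvgP.
apply/cvgrPdist_le => e e0; have /cvgrPdist_le /(_ e e0) := H.
rewrite !near_withinE => /nbhs_ballP[r /= r0 Hr]; apply/nbhs_ballP; exists r => //= y.
rewrite /ball/= => xy yx; have := Hr (y + d).
rewrite /ball/= (_ : x + d - (y + d) = x - y); last by ring.
rewrite (_ : y + d - (x + d) = y - x); last by ring.
by move=> /(_ xy); apply; apply: contra yx => /eqP /addIr ->.
Qed.

(** With a primitive [I] of [w], the shift changes the integral by the increments of [I] over length
    [d] at the two ends, and each is [d * w] up to [K * d ^+ 2]. The condition on [d] keeps the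
    shifted points where [I] is differentiable. *)
Lemma shift_Rintegral (R : realType) (L K d : R) (w : R -> R) : 0 < L -> 0 <= K ->
  (forall a b, `|w a - w b| <= K * `|a - b|) -> `|d| <= 2^-1 ->
  `|\int[lebesgue_measure]_(x in `[0, L]) w (x + d) -
    \int[lebesgue_measure]_(x in `[0, L]) w x - d * (w L - w 0)| <= 2 * K * d ^+ 2.
Proof.
move=> L0 K0 wK d2.
have cw : continuous w.
  have Ke : 0 < K + 1 by rewrite ltr_wpDl.
  move=> a; apply/cvgrPdist_le => e e0; have eK : 0 < e / (K + 1) by rewrite divr_gt0.
  near=> b; rewrite (le_trans (wK _ _))//.
  have : `|a - b| <= e / (K + 1).
    by near: b; apply: cvgr_dist_le eK; exact: cvg_id.
  rewrite ler_pdivlMr// mulrC => /(le_trans _); apply.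
  by rewrite ler_wpM2r// lerDl.
have [I dI] : exists I : R -> R, forall x : R, -1 < x -> is_derive x 1 I (w x).
  by apply: (@continuous_antiderivative R w (-2)) => [|a _]; [lra|exact: cw].
have /ler_normlP[d2' d2''] := d2.
have dIs : derivative_on `[- 2^-1, L + 2^-1] I w.
  by apply: is_derive_derivative_on => x /=; rewrite in_itv/= => /andP[x1 _]; apply: dI; lra.
have ds : derivative_on `[0, L] (fun x => I (x + d)) (fun x => w (x + d)).
  apply: is_derive_derivative_on => x /=; rewrite in_itv/= => /andP[x0 _].
  by apply: is_derive_comp_shift; apply: dI; lra.
have dI0 : derivative_on `[0, L] I w.
  by apply: derivative_onW dIs => x /=; rewrite !in_itv/= => /andP[x0 xL]; lra.
have cws : {within `[0, L], continuous w} by exact: continuous_subspaceT.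
have cwd : {within `[0, L], continuous (fun x => w (x + d))}.
  apply: continuous_subspaceT => x.
  have cxd : {for x, continuous (fun x : R => x + d)}.
    by apply: cvgD; [exact: cvg_id|exact: cvg_cst].
  exact: (@continuous_comp R R R _ w x cxd (cw _)).
rewrite (derivative_on_Rintegral L0 ds cwd) (derivative_on_Rintegral L0 dI0 cws).
have mvt a : 0 <= a -> a <= L -> `|I (a + d) - I a - d * w a| <= K * d ^+ 2.
  move=> a0 aL.
  have bound c : `|c - a| <= `|d| -> `|w c * d - d * w a| <= K * d ^+ 2.
    move=> ca; rewrite mulrC -mulrBr normrM -[d ^+ 2]ger0_norm ?sqr_ge0// normrX expr2.
    by rewrite mulrCA ler_wpM2l// (le_trans (wK _ _))// ler_wpM2l.
  have [dge|dlt] := leP 0 d.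
    have [||| c /andP[ac cd] ->] := derivative_on_mvt dIs (x := a) (y := a + d); [lra..|].
    rewrite addrAC subrr add0r; apply: bound.
    by rewrite !ger0_norm; lra.
  have [||| c /andP[ac cd] E] := derivative_on_mvt dIs (x := a + d) (y := a); [lra..|].
  have -> : I (a + d) - I a = w c * d by rewrite -[LHS]opprB E; ring.
  by apply: bound; rewrite ler0_norm ?ltr0_norm//; lra.
have h1 := mvt L (ltW L0) (lexx _); have h2 := mvt 0 (lexx _) (ltW L0).
rewrite (_ : _ - _ - _ = (I (L + d) - I L - d * w L) - (I (0 + d) - I 0 - d * w 0)); last by ring.
by rewrite (le_trans (ler_normB _ _))// (le_trans (lerD h1 h2))//; lra.
Unshelve. all: by end_near. Qed.

(** * Explicit integration against the invariant measure of the jamming process *)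

Section rtp_measure.
Context (R : realType) (omega L : {posnum R}).
Let E1 := measurableTypeR R.
Let E := (measurableTypeR R * measurableTypeR R)%type.
Let S : set E1 := `[0, L%:num]%classic.
Let V := rtp_velocities R.
Let Sh : set E := rtp_space L%:num.
Let muh := rtp_measure omega L.
Let Z : R := 2 + omega%:num * L%:num.
Implicit Types (F : E -> R).
Let L0 : 0 < L%:num. Proof. by []. Qed.
Let Z0 : 0 < Z. Proof. by rewrite /Z ltr_pwDl// mulr_ge0. Qed.
Let mS : measurable S. Proof. exact: measurable_itv. Qed.

Lemma at_velocityE (c : R) (m : {measure set E1 -> \bar R}) (A : set E) : measurable A ->
  at_velocity c m A = m [set x | A (x, c)].
Proof.
move=> mA; rewrite /at_velocity/= /product_measure1.
have mA' : measurable [set x | A (x, c)].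
  have := measurable_ysection c mA; congr measurable.
  by apply/seteqP; split => x; rewrite /ysection/= inE.
transitivity (\int[m]_x (\1_[set x | A (x, c)] x)%:E)%E.
  apply: eq_integral => x _ /=; rewrite diracE indicE.
  by congr (nat_of_bool _)%:R%:E; apply/idP/idP; rewrite !inE /xsection/= inE.
by rewrite integral_indic// setIT.
Qed.

(** The integral against [rtp_measure] written out. The states [(0, 2)] and [(L, - 2)] are missing
    because a particle leaving a wall does not stay there, and their mass is zero. *)
Definition rtp_mean F : R := Z^-1 * (2^-1 * F (0, 0) + 2^-1 * F (0, - 2) +
  2^-1 * F (L%:num, 2) + 2^-1 * F (L%:num, 0) +
  omega%:num / 4 * \int[lebesgue_measure]_(x in `[0, L%:num]) F (x, 2) +
  omega%:num / 2 * \int[lebesgue_measure]_(x in `[0, L%:num]) F (x, 0) +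
  omega%:num / 4 * \int[lebesgue_measure]_(x in `[0, L%:num]) F (x, - 2)).

Let slice_measurable (c : R) (A : set E) : measurable A -> measurable [set x | A (x, c)].
Proof.
move=> mA; have := measurable_ysection c mA; congr measurable.
by apply/seteqP; split => x; rewrite /ysection/= inE.
Qed.

Lemma rtp_measureE (A : set E) : measurable A -> muh A = (rtp_mean \1_A)%:E.
Proof.
move=> mA; rewrite [LHS]measure_addE [X in (X + _)%E]measure_addE.
rewrite [X in (X + _ + _)%E](at_velocityE _ _ mA) [X in (_ + X + _)%E](at_velocityE _ _ mA).
rewrite [X in (_ + _ + X)%E](at_velocityE _ _ mA).
rewrite !(atoms_and_lebesgueE _ _ _ L0 (slice_measurable _ mA))/= -!EFinD.
congr EFin; rewrite /rtp_mean.
have sliceE (c x : R) : \1_[set x | A (x, c)] x = \1_A (x, c) :> R.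
  by rewrite !indicE; congr (nat_of_bool _)%:R; apply/idP/idP; rewrite !inE.
have IE c : \int[lebesgue_measure]_(x in `[0, L%:num]) (\1_A (x, c) : R) =
    fine (lebesgue_measure ([set x | A (x, c)] `&` S)).
  rewrite -[LHS](_ : \int[lebesgue_measure]_(x in `[0, L%:num]) (\1_[set x | A (x, c)] x : R) = _).
    by rewrite /Rintegral integral_indic//; exact: slice_measurable.
  by apply: eq_Rintegral => x _; rewrite sliceE.
rewrite !IE !sliceE -/S -/Z; field; exact: lt0r_neq0.
Qed.

Lemma rtp_measureT : muh setT = 1%E.
Proof.
rewrite rtp_measureE//; congr EFin; rewrite /rtp_mean.
have IE (c : R) : \int[lebesgue_measure]_(x in `[0, L%:num]) (\1_(@setT E) (x, c) : R) = L%:num.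
  have -> : \int[lebesgue_measure]_(x in `[0, L%:num]) (\1_(@setT E) (x, c) : R) =
      \int[lebesgue_measure]_(x in `[0, L%:num]) (1 : R).
    by apply: eq_Rintegral => x _; rewrite indicE in_setT.
  have lebS : lebesgue_measure S = (L%:num)%:E.
    by rewrite /S lebesgue_measure_itv/= lte_fin L0 -EFinD oppr0 addr0.
  by rewrite Rintegral_cst// [X in fine X]lebS mul1r.
rewrite !IE !indicE !in_setT /Z /=; field; exact: lt0r_neq0 Z0.
Qed.

Lemma rtp_measure_lty : (muh setT < +oo)%E. Proof. by rewrite rtp_measureT ltry. Qed.

Lemma bounded_measurable_slice F (c : R) : bounded_measurable F ->
  bounded_measurable (fun x : E1 => F (x, c)).
Proof.
move=> [mF [M FM]]; split; last by exists M.
by apply: (measurableT_comp mF); exact: measurable_pair2.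
Qed.

Lemma rtp_Rintegral F : bounded_measurable F -> \int[muh]_x F x = rtp_mean F.
Proof.
have lebS := lebesgue_itv_lty L0.
have If g : bounded_measurable g -> lebesgue_measure.-integrable S (EFin \o g).
  exact: (bounded_measurable_integrable_on mS lebS).
apply: (@bounded_measurable_Rintegral_unique _ E R muh).
- exact: rtp_measure_lty.
- by move=> A mA; rewrite rtp_measureE.
- move=> k f g bf bg; rewrite /rtp_mean.
  have IE c : \int[lebesgue_measure]_(x in `[0, L%:num]) (k * f (x, c) + g (x, c)) =
      k * \int[lebesgue_measure]_(x in `[0, L%:num]) f (x, c) +
      \int[lebesgue_measure]_(x in `[0, L%:num]) g (x, c).
    have bfc := bounded_measurable_slice c bf; have bgc := bounded_measurable_slice c bg.
    rewrite RintegralD//; [|exact: (If _ (bounded_measurableZ k bfc))|exact: If].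
    by rewrite RintegralZl//; exact: If.
  by rewrite !IE; ring.
- move=> u f M bu bf uM uf; rewrite /rtp_mean.
  have IE c : \int[lebesgue_measure]_(x in `[0, L%:num]) u n (x, c) @[n --> \oo] -->
      \int[lebesgue_measure]_(x in `[0, L%:num]) f (x, c).
    apply: (@Rintegral_bounded_cvg_on _ _ _ _ S mS lebS (fun n x => u n (x, c)) _ M) => // n.
    by have [mu_ _] := bounded_measurable_slice c (bu n); exact: measurable_funTS.
  apply: cvgM; first exact: cvg_cst.
  by repeat apply: cvgD; (apply: cvgM; [exact: cvg_cst|]); do ?[exact: uf|exact: IE].
Qed.

Lemma rtp_space_measurable : measurable Sh.
Proof.
apply: measurableX => //.
rewrite (_ : [set` rtp_velocities R] = [set 2] `|` [set 0] `|` [set (- 2)]).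
  by apply: measurableU => //; apply: measurableU.
apply/seteqP; split => x /=; rewrite !inE; first by move=> /or3P[] /eqP ->; tauto.
by move=> [[->|->]|->]; rewrite eqxx ?orbT.
Qed.

(** There are finitely many velocities, so joint measurability on the state space follows from that
    of the slices: [F] cut off is a finite sum of slices times indicators of a velocity. *)
Lemma bounded_measurable_rtp F (M : R) :
  (forall c, c \in V -> measurable_fun S (fun x => F (x, c))) ->
  (forall z, Sh z -> `|F z| <= M) -> bounded_measurable (F \_ Sh).
Proof.
move=> mF FM.
have sliceE c : (fun x => (F \_ Sh) (x, c)) = if c \in V then (fun x => F (x, c)) \_ S else fun=> 0.
  apply/funext => x; case: (boolP (c \in V)) => cV; rewrite !patchE.
    congr (if _ then _ else _).
    by apply/idP/idP => /set_mem; [move=> [/= xS _]|move=> xS]; apply/mem_set.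
  by rewrite memNset// => -[_ /=]; apply/negP.
have bs c : bounded_measurable (fun x : E1 => (F \_ Sh) (x, c)).
  rewrite sliceE; case: ifPn => cV; last exact: bounded_measurable_cst.
  apply: (@bounded_measurable_restrict _ E1 R S _ M) => //; first exact: mF.
  by move=> x Sx; apply: FM; split.
have E' : F \_ Sh = fun z => \sum_(c <- V) (z.2 == c)%:R * (F \_ Sh) (z.1, c).
  apply/funext => -[x c] /=; have [cV|cV] := boolP (c \in V); first by rewrite rtp_velocities_sum.
  rewrite big1_seq ?patchE ?memNset//; first by move=> -[_ /=]; apply/negP.
  move=> y /andP[_ yV]; case: eqP => [cy|_]; last by rewrite mul0r.
  by move: cV; rewrite cy yV.
rewrite E'; apply: bounded_measurable_sum => c; apply: bounded_measurableM.
  split; last by exists 1 => z; case: (_ == _); rewrite ?normr1 ?normr0.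
  rewrite (_ : (fun z : E => _) = fun z => \1_[set c] z.2).
    by apply: (measurableT_comp (f := \1_[set c] : E1 -> R)).
  by apply/funext => z; rewrite indicE; congr (nat_of_bool _)%:R; apply/eqP/idP => [->|/set_mem//]; exact/mem_set.
have [mb [N Nb]] := bs c; split; last by exists N => z; exact: Nb.
exact: (measurableT_comp (f := fun x : E1 => (F \_ Sh) (x, c)) mb).
Qed.

Lemma rtp_Rintegral_on F (M : R) :
  (forall c, c \in V -> measurable_fun S (fun x => F (x, c))) ->
  (forall z, Sh z -> `|F z| <= M) -> \int[muh]_(z in Sh) F z = rtp_mean F.
Proof.
move=> mF FM; rewrite Rintegral_mkcond rtp_Rintegral; last exact: bounded_measurable_rtp mF FM.
have E' c x : c \in V -> x \in `[0, L%:num] -> (F \_ Sh) (x, c) = F (x, c).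
  by move=> cV xL; rewrite patchE mem_set.
have V2 : 2 \in V by rewrite !inE eqxx.
have V0 : 0 \in V by rewrite !inE eqxx orbT.
have Vn2 : - 2 \in V by rewrite !inE eqxx !orbT.
have IE c : c \in V -> \int[lebesgue_measure]_(x in `[0, L%:num]) (F \_ Sh) (x, c) =
    \int[lebesgue_measure]_(x in `[0, L%:num]) F (x, c).
  by move=> cV; apply: eq_Rintegral => x /set_mem /= xL; exact: E'.
have L0m : 0 \in `[0, L%:num] by rewrite in_itv/= lexx ltW.
have LLm : L%:num \in `[0, L%:num] by rewrite in_itv/= lexx ltW.
by rewrite /rtp_mean !IE// !E'.
Qed.
End rtp_measure.

(** The second-order remainder of [rtp_one_step_mean]. Here [a2], [am] and [b2], [bm] are the values
    at the walls 0 and [L] for velocities 2 and -2, [th] is the probability of a jump, and [e2],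
    [em] are the transport errors of [shift_Rintegral]. *)
Lemma rtp_mean_step_bound (R : realFieldType) (omega h K M th st a2 am b2 bm e2 em : R) :
  0 < omega -> 0 <= h -> 0 <= K -> st = 1 - th -> 0 <= st -> 0 <= th ->
  th <= 2 * omega * h -> `|th - 2 * omega * h| <= (2 * omega * h) ^+ 2 ->
  `|a2| <= M -> `|am| <= M -> `|b2| <= M -> `|bm| <= M ->
  `|e2| <= 2 * K * (2 * h) ^+ 2 -> `|em| <= 2 * K * (- 2 * h) ^+ 2 ->
  `|(a2 - am + bm - b2) * ((th - 2 * omega * h + th * (2 * omega * h)) / 4) +
    omega / 4 * (st * e2 + st * em)| <=
  (2 * M * (2 * omega) ^+ 2 + 8 * omega * K) * h ^+ 2.
Proof.
move=> o0 h0 K0 stE st0 th0 th1 th2 a2M amM b2M bmM d2 dm.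
have w4 : 0 <= omega / 4 by rewrite divr_ge0// ltW.
apply: (le_trans (ler_normD _ _)).
rewrite (normrM (a2 - am + bm - b2)) (normrM (omega / 4)) (ger0_norm w4).
have n1 : `|a2 - am + bm - b2| <= 4 * M.
  rewrite (le_trans (ler_normB _ _))//.
  have := le_trans (ler_normD _ _) (lerD (ler_normB a2 am) (lexx `|bm|)).
  by lra.
have n2 : `|(th - 2 * omega * h + th * (2 * omega * h)) / 4| <=
    (2 * omega * h) ^+ 2 / 2.
  rewrite normrM normfV [X in _ / X]ger0_norm// ler_pdivrMr//.
  rewrite (le_trans (ler_normD _ _))// (le_trans (lerD th2 (lexx _)))//.
  have oh : 0 <= 2 * omega * h by rewrite !mulr_ge0// ltW.
  rewrite (ger0_norm (mulr_ge0 th0 oh)).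
  have : th * (2 * omega * h) <= (2 * omega * h) ^+ 2.
    by rewrite expr2 ler_wpM2r.
  by lra.
have n3 : `|st * e2 + st * em| <= 16 * K * h ^+ 2.
  have st1 : `|st| <= 1 by rewrite ger0_norm// stE; lra.
  rewrite (le_trans (ler_normD _ _))// !normrM.
  have := ler_pM (normr_ge0 _) (normr_ge0 _) st1 d2.
  have := ler_pM (normr_ge0 _) (normr_ge0 _) st1 dm.
  rewrite !mul1r !exprMn sqrrN => p1 p2.
  by rewrite (le_trans (lerD p2 p1))//; lra.
have q1 := ler_pM (normr_ge0 _) (normr_ge0 _) n1 n2.
have q2 := ler_wpM2l w4 n3.
apply: (le_trans (lerD q1 q2)).
have : 0 <= omega * K * h ^+ 2 by rewrite !mulr_ge0// ?sqr_ge0// ltW.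
by rewrite [(2 * omega * h) ^+ 2]exprMn; lra.
Qed.

(** * One time step of the jamming process in the mean *)

Section rtp_semigroup.
Context (R : realType) (omega L : {posnum R}) d (Omega : measurableType d)
  (Q : R -> probability Omega R) (v : R -> Omega -> R)
  (tau : nat -> Omega -> R) (x : R -> R -> Omega -> R).
Hypothesis hx : jamming_rtp omega%:num L%:num Q v tau x.
Let E1 := measurableTypeR R.
Let E := (measurableTypeR R * measurableTypeR R)%type.
Let S : set E1 := `[0, L%:num]%classic.
Let V := rtp_velocities R.
Let Sh : set E := rtp_space L%:num.
Let muh := rtp_measure omega L.
Let Z : R := 2 + omega%:num * L%:num.
Let P := rtp_transition Q v x.
Let clamp (y : R) : R := Num.max 0 (Num.min L%:num y).
Implicit Types (u f g F : E -> R).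
Let o0 : 0 < omega%:num. Proof. by []. Qed.
Let L0 : 0 < L%:num. Proof. by []. Qed.
Let Z0 : 0 < Z. Proof. by rewrite /Z ltr_pwDl// mulr_ge0. Qed.
Let mS : measurable S. Proof. exact: measurable_itv. Qed.
Let mSh : measurable Sh. Proof. exact: rtp_space_measurable. Qed.
Let QT c : (Q c setT < +oo)%E. Proof. by rewrite probability_setT ltry. Qed.
Let muT : (muh setT < +oo)%E. Proof. exact: rtp_measure_lty. Qed.

Let path t (x0 : R) w : E := (x x0 t w, v t w).

Let path_in t x0 w : 0 <= t -> x0 \in `[0, L%:num] -> Sh (path t x0 w).
Proof.
move=> t0 x0L; split => /=; first exact: (rtp_position_in L0 hx w x0L t0).
exact: (rtp_velocity_in hx w t0).
Qed.

Let path_bm t x0 u : 0 <= t -> x0 \in `[0, L%:num] -> bounded_measurable u ->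
  bounded_measurable (fun w => u (path t x0 w)).
Proof.
move=> t0 x0L [mu_ [M uM]]; split; last by exists M.
have mx := rtp_position_measurable hx x0L t0.
have mv := rtp_velocity_measurable hx t0.
exact: (measurableT_comp mu_ (measurable_fun_pair mx mv)).
Qed.

Lemma rtp_transition_lin t z (a : R) f g : 0 <= t -> Sh z -> bounded_measurable f ->
  bounded_measurable g -> P t (fun y => a * f y + g y) z = a * P t f z + P t g z.
Proof.
move=> t0 [zS _] bf bg; have bf' := path_bm t0 zS bf; have bg' := path_bm t0 zS bg.
rewrite [LHS](bounded_measurable_RintegralD (QT z.2) (bounded_measurableZ a bf') bg').
by rewrite (bounded_measurable_RintegralZ (QT z.2) a bf').
Qed.

Lemma rtp_transition_bounded t z f (M : R) : 0 <= t -> Sh z -> bounded_measurable f ->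
  (forall y, `|f y| <= M) -> `|P t f z| <= M.
Proof.
move=> t0 [zS _] bf fM; have [mf _] := path_bm t0 zS bf.
apply: (@ler_norm_Rintegral_cst _ _ _ (Q z.2) setT) => //.
- by rewrite [leLHS](probability_setT (Q z.2)).
- by rewrite (le_trans _ (fM z)).
Qed.

Lemma rtp_transition_cvg t z (u : (E -> R)^nat) f (M : R) : 0 <= t -> Sh z ->
  (forall n, bounded_measurable (u n)) -> (forall n x, `|u n x| <= M) ->
  (forall x, u n x @[n --> \oo] --> f x) -> P t (u n) z @[n --> \oo] --> P t f z.
Proof.
move=> t0 [zS _] bu uM uf.
apply: (@Rintegral_bounded_cvg _ _ _ _ (QT z.2) setT (fun n w => u n (path t z.1 w)) _ M) => //.
by move=> n; case: (path_bm t0 zS (bu n)).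
Qed.

Lemma eq_rtp_transition t z f g : 0 <= t -> Sh z -> {in Sh, f =1 g} -> P t f z = P t g z.
Proof.
move=> t0 [zS _] fg; apply: eq_Rintegral => w _; apply: fg; apply/mem_set.
exact: path_in.
Qed.

(** A class that the transition operators preserve with the same [M] and [K], once images are cut
    off outside [Sh]. The error of one time step is therefore uniform in the time already
    elapsed. *)
Definition lipschitz_slices (M K : R) u := [/\ bounded_measurable u, forall z, `|u z| <= M &
  forall y a b, y \in V -> a \in `[0, L%:num] -> b \in `[0, L%:num] ->
    `|u (a, y) - u (b, y)| <= K * `|a - b|].

Lemma lipschitz_measurable (K : R) (f : E1 -> R) : 0 <= K ->
  (forall a b, a \in `[0, L%:num] -> b \in `[0, L%:num] -> `|f a - f b| <= K * `|a - b|) ->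
  measurable_fun S f.
Proof.
move=> K0 fK; apply: subspace_continuous_measurable_fun => //.
apply/subspace_continuousP => a aS; apply/cvgrPdist_le => e e0.
have K1 : 0 < K + 1 by rewrite ltr_wpDl.
have eK : 0 < e / (K + 1) by rewrite divr_gt0.
rewrite near_withinE; near=> b => bS; rewrite (le_trans (fK _ _ aS bS))//.
have : `|a - b| <= e / (K + 1).
  by near: b; apply: cvgr_dist_le eK; exact: cvg_id.
rewrite ler_pdivlMr// mulrC => /(le_trans _); apply.
by rewrite ler_wpM2r// lerDl.
Unshelve. all: by end_near. Qed.

Lemma rtp_transition_lipschitz (M K t : R) u : 0 <= K -> 0 <= t -> lipschitz_slices M K u ->
  forall y a b, y \in V -> a \in `[0, L%:num] -> b \in `[0, L%:num] ->
    `|P t u (a, y) - P t u (b, y)| <= K * `|a - b|.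
Proof.
move=> K0 t0 [bu uM uK] y a b yV aL bL.
have ba := path_bm t0 aL bu; have bb := path_bm t0 bL bu.
rewrite -[X in `|X|](bounded_measurable_RintegralB (QT y) ba bb).
have [mab _] := bounded_measurableB ba bb.
apply: (@ler_norm_Rintegral_cst _ _ _ (Q y) setT) => //.
- by rewrite [leLHS](probability_setT (Q y)).
- by rewrite mulr_ge0.
move=> w _; have vV := rtp_velocity_in hx w t0.
have aI := rtp_position_in L0 hx w aL t0; have bI := rtp_position_in L0 hx w bL t0.
rewrite (le_trans (uK _ _ _ vV aI bI))// ler_wpM2l//.
exact: (rtp_coupling hx w aL bL t0).
Qed.

Lemma lipschitz_slices_transition (M K t : R) u : 0 <= K -> 0 <= t ->
  lipschitz_slices M K u -> lipschitz_slices M K ((P t u) \_ Sh).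
Proof.
move=> K0 t0 uMK; have [bu uM uK] := uMK.
have PK := rtp_transition_lipschitz K0 t0 uMK.
have PM z : Sh z -> `|P t u z| <= M by move=> Sz; exact: rtp_transition_bounded.
split.
- apply: (bounded_measurable_rtp _ PM) => y yV.
  by apply: (lipschitz_measurable K0) => a b aL bL; exact: PK.
- move=> z; rewrite patchE; case: ifPn => [/set_mem Sz|_]; first exact: PM.
  by rewrite normr0 (le_trans _ (uM z)).
- move=> y a b yV aL bL; rewrite !patchE !mem_set//; exact: PK.
Qed.

Let slice_measurable (M K : R) u y : lipschitz_slices M K u ->
  measurable_fun S (fun a => u (a, y)).
Proof. by move=> [bu _ _]; have [m _] := bounded_measurable_slice y bu; exact: measurable_funTS. Qed.


(** The first two terms come from the error of [rtp_one_step] with [th <= 2 * omega * h], the last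
    from [rtp_mean_step_bound]. *)
Let C (M K : R) : R := 2 * K * (2 * omega%:num) + 2 * M * (2 * omega%:num) ^+ 2 +
  Z^-1 * (2 * M * (2 * omega%:num) ^+ 2 + 8 * omega%:num * K).

(* The terms of order [h] of [rtp_one_step] cancel after integration against
   [rtp_measure]: transport along the velocities produces boundary terms, which
   the jumps at the atoms compensate. *)
Lemma rtp_one_step_mean (M K h : R) u : 0 <= K -> 0 <= h -> 2 * h <= 2^-1 ->
  lipschitz_slices M K u ->
  `|\int[muh]_(z in Sh) P h u z - \int[muh]_(z in Sh) u z| <= C M K * h ^+ 2.
Proof.
move=> K0 h0 h2 uMK; have [bu uM uK] := uMK.
have M0 : 0 <= M by rewrite (le_trans _ (uM (0, 0))).
set st := rtp_stay omega%:num h; set th := 1 - st.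
have [th0 th1 th2] := rtp_stay_bounds o0 h0; rewrite -/st -/th in th0 th1 th2.
have st0 : 0 <= st by exact: expR_ge0.
(* The mean of [u] over the velocity after a jump, the position being frozen; [main] is the
   approximation of [rtp_one_step]. *)
pose J (z : E) : R := if z.2 == 0 then (u (z.1, 2) + u (z.1, - 2)) / 2 else u (z.1, 0).
pose main (z : E) : R := st * u (clamp (z.1 + z.2 * h), z.2) + th * J z.
have V2 : 2 \in V by rewrite !inE eqxx.
have V0 : 0 \in V by rewrite !inE eqxx orbT.
have Vm : - 2 \in V by rewrite !inE eqxx !orbT.
have two0 : (2 == 0 :> R) = false by apply/negbTE.
have mtwo0 : (- 2 == 0 :> R) = false by rewrite oppr_eq0.
have rho z : Sh z -> `|P h u z - main z| <= 2 * K * h * th + 2 * M * th ^+ 2.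
  case: z => a y [/= aL yV].
  have := rtp_one_step o0 L0 hx aL yV h0 bu uM K0 uK.
  by rewrite (rtp_jump_sum o0 (fun y => u (a, y)) yV).
have clampL a : clamp a \in `[0, L%:num] by exact/clamp_in/ltW.
have JM z : `|J z| <= M.
  rewrite /J; case: ifP => _ //; rewrite normrM normfV [X in _ / X]ger0_norm//.
  rewrite ler_pdivrMr// (le_trans (ler_normD _ _))//.
  by rewrite (le_trans (lerD (uM _) (uM _)))//; lra.
have JK y a b : a \in `[0, L%:num] -> b \in `[0, L%:num] ->
    `|J (a, y) - J (b, y)| <= K * `|a - b|.
  move=> aL bL; rewrite /J/=; case: ifP => _; last exact: uK.
  rewrite -mulrBl normrM normfV [X in _ / X]ger0_norm// ler_pdivrMr//.
  have -> (p q r s : R) : p + q - (r + s) = p - r + (q - s) by ring.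
  apply: (le_trans (ler_normD _ _)).
  by rewrite (le_trans (lerD (uK _ _ _ V2 aL bL) (uK _ _ _ Vm aL bL)))//; lra.
have mainM z : `|main z| <= M.
  rewrite (le_trans (ler_normD _ _))// !normrM (ger0_norm st0) (ger0_norm th0).
  rewrite (le_trans (lerD (ler_wpM2l st0 (uM _)) (ler_wpM2l th0 (JM z))))//.
  by rewrite -mulrDl /th addrCA subrr addr0 mul1r.
have main_m y : y \in V -> measurable_fun S (fun a => main (a, y)).
  move=> yV; apply: (lipschitz_measurable K0) => a b aL bL; rewrite /main/=.
  have -> (p q r s : R) : st * p + th * q - (st * r + th * s) = st * (p - r) + th * (q - s).
    by ring.
  apply: (le_trans (ler_normD _ _)); rewrite !normrM (ger0_norm st0) (ger0_norm th0).
  have h1 : `|u (clamp (a + y * h), y) - u (clamp (b + y * h), y)| <= K * `|a - b|.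
    rewrite (le_trans (uK _ _ _ yV (clampL _) (clampL _)))// ler_wpM2l//.
    rewrite (le_trans (ler_norm_clamp _ _ _ _))// le_eqVlt; apply/orP; left; apply/eqP.
    by congr (`|_|); ring.
  rewrite (le_trans (lerD (ler_wpM2l st0 h1) (ler_wpM2l th0 (JK y a b aL bL))))//.
  by rewrite -mulrDl /th addrCA subrr addr0 mul1r.
have [bPu PuM _] := lipschitz_slices_transition K0 h0 uMK.
have bmain := bounded_measurable_rtp main_m (fun z _ => mainM z).
have step1 : `|\int[muh]_(z in Sh) P h u z - \int[muh]_(z in Sh) main z| <=
    2 * K * h * th + 2 * M * th ^+ 2.
  rewrite !(Rintegral_mkcond _ Sh).
  have r0 : 0 <= 2 * K * h * th + 2 * M * th ^+ 2.
    by rewrite addr_ge0 ?mulr_ge0// sqr_ge0.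
  have -> : 2 * K * h * th + 2 * M * th ^+ 2 =
      \int[muh]_z (2 * K * h * th + 2 * M * th ^+ 2).
    by rewrite Rintegral_cst// [X in fine X](rtp_measureT omega L) mulr1.
  apply: (le_norm_RintegralB muT bPu bmain (bounded_measurable_cst _ _)) => z.
  rewrite !patchE; case: ifPn => [/set_mem Sz|_]; first exact: rho.
  by rewrite subrr normr0.
(* The projection extends each slice to the whole line with the same Lipschitz constant, so that the
   clamped motion becomes a plain shift of [w]. *)
pose w y a := u (clamp a, y).
have wK y : y \in V -> forall a b, `|w y a - w y b| <= K * `|a - b|.
  move=> yV a b; rewrite (le_trans (uK _ _ _ yV (clampL _) (clampL _)))// ler_wpM2l//.
  exact: ler_norm_clamp.
have wE y a : a \in `[0, L%:num] -> w y a = u (a, y) by move=> aL; rewrite /w /clamp clamp_id.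
pose i y := \int[lebesgue_measure]_(a in `[0, L%:num]) u (a, y).
pose j y := \int[lebesgue_measure]_(a in `[0, L%:num]) w y (a + y * h).
have L0m : 0 \in `[0, L%:num] by rewrite in_itv/= lexx ltW.
have LLm : L%:num \in `[0, L%:num] by rewrite in_itv/= lexx ltW.
have shift y : y \in V -> `|y * h| <= 2^-1 ->
    `|j y - i y - y * h * (u (L%:num, y) - u (0, y))| <= 2 * K * (y * h) ^+ 2.
  move=> yV yh; have := shift_Rintegral L0 K0 (wK y yV) yh; rewrite -/(j y) !wE//.
  have -> : \int[lebesgue_measure]_(a in `[0, L%:num]) w y a = i y.
    by apply: eq_Rintegral => a /set_mem /= aL; rewrite wE.
  by [].
have h2n : `|2 * h| <= 2^-1 by rewrite ger0_norm// mulr_ge0.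
have h2m : `|- 2 * h| <= 2^-1 by rewrite mulNr normrN.
have d2 := shift _ V2 h2n; have dm := shift _ Vm h2m.
have lebS := lebesgue_itv_lty L0.
have bu_ y := bounded_measurable_slice y bu.
have bw y : y \in V -> bounded_measurable (fun a : E1 => w y (a + y * h)).
  move=> yV; split; last by exists M => a; exact: uM.
  have mc : measurable_fun setT (fun a : R => clamp (a + y * h)).
    apply: continuous_measurable_fun => a.
    have ca : {for a, continuous (fun a : R => a + y * h)}.
      by apply: cvgD; [exact: cvg_id|exact: cvg_cst].
    exact: (@continuous_comp R R R _ clamp a ca (@continuous_clamp R 0 L%:num _)).
  have [muy _] := bu_ y.
  exact: (measurableT_comp muy mc).
have mainI (f1 f2 : E1 -> R) : bounded_measurable f1 -> bounded_measurable f2 ->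
    \int[lebesgue_measure]_(a in `[0, L%:num]) (st * f1 a + th * f2 a) =
    st * \int[lebesgue_measure]_(a in `[0, L%:num]) f1 a +
    th * \int[lebesgue_measure]_(a in `[0, L%:num]) f2 a.
  move=> bf bg.
  have If b : bounded_measurable b -> lebesgue_measure.-integrable S (EFin \o b).
    exact: (bounded_measurable_integrable_on mS lebS).
  rewrite RintegralD//; [|exact: (If _ (bounded_measurableZ st bf))|exact: (If _ (bounded_measurableZ th bg))].
  by rewrite !RintegralZl//; exact: If.
have bJ0 : bounded_measurable (fun a : E1 => (u (a, 2) + u (a, - 2)) / 2).
  apply: bounded_measurableM; last exact: bounded_measurable_cst.
  exact: bounded_measurableD.
have I2 : \int[lebesgue_measure]_(a in `[0, L%:num]) main (a, 2) = st * j 2 + th * i 0.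
  rewrite -(mainI _ _ (bw _ V2) (bu_ 0)); apply: eq_Rintegral => a _.
  by rewrite /main /J/= two0.
have Im : \int[lebesgue_measure]_(a in `[0, L%:num]) main (a, - 2) = st * j (- 2) + th * i 0.
  rewrite -(mainI _ _ (bw _ Vm) (bu_ 0)); apply: eq_Rintegral => a _.
  by rewrite /main /J/= mtwo0.
have I0 : \int[lebesgue_measure]_(a in `[0, L%:num]) main (a, 0) =
    st * i 0 + th * ((i 2 + i (- 2)) / 2).
  have -> : (i 2 + i (- 2)) / 2 =
      \int[lebesgue_measure]_(a in `[0, L%:num]) ((u (a, 2) + u (a, - 2)) / 2).
    have If (f1 : E1 -> R) := @bounded_measurable_integrable_on _ E1 R lebesgue_measure S mS lebS f1.
    rewrite RintegralZr//; last exact: (If _ (bounded_measurableD (bu_ 2) (bu_ (- 2)))).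
    by rewrite RintegralD//; [exact: (If _ (bu_ 2))|exact: (If _ (bu_ (- 2)))].
  rewrite -(mainI _ _ (bu_ 0) bJ0); apply: eq_Rintegral => a /set_mem /= aL.
  by rewrite /main /J/= eqxx mul0r addr0 /clamp clamp_id.
(* The pairs of wall and velocity that carry an atom are exactly those at rest, so at the atoms only
   the jumps act. *)
have c0 (y : R) : y = 0 \/ y = - 2 -> clamp (0 + y * h) = 0.
  move=> [->|->]; first by rewrite mul0r addr0 /clamp clamp_id.
  by rewrite /clamp max_l// ge_min add0r mulNr oppr_le0 mulr_ge0 ?orbT.
have cL (y : R) : y = 0 \/ y = 2 -> clamp (L%:num + y * h) = L%:num.
  move=> [->|->]; first by rewrite mul0r addr0 /clamp clamp_id.
  by rewrite /clamp min_l ?max_r ?(ltW L0)// lerDl mulr_ge0.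
have step2 : `|\int[muh]_(z in Sh) main z - \int[muh]_(z in Sh) u z| <=
   Z^-1 * (2 * M * (2 * omega%:num) ^+ 2 + 8 * omega%:num * K) * h ^+ 2.
  rewrite (rtp_Rintegral_on omega main_m (fun z _ => mainM z)).
  rewrite (rtp_Rintegral_on omega (fun y _ => slice_measurable y uMK) (fun z _ => uM z)).
  rewrite /rtp_mean I2 Im I0 -!/(i _) -mulrBr normrM ger0_norm ?invr_ge0 ?(ltW Z0)//.
  rewrite -[leRHS]mulrA ler_pM2l ?invr_gt0//.
  rewrite /main/= (c0 0 (or_introl erefl)) (c0 (- 2) (or_intror erefl)).
  rewrite (cL 2 (or_intror erefl)) (cL 0 (or_introl erefl)).
  rewrite /J/= eqxx two0 mtwo0.
  set a0 := u (0, 0); set am := u (0, -2); set a2 := u (0, 2).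
  set b0 := u (L%:num, 0); set bm := u (L%:num, -2); set b2 := u (L%:num, 2).
  set e2 := j 2 - i 2 - 2 * h * (b2 - a2) in d2.
  set em := j (- 2) - i (- 2) - - 2 * h * (bm - am) in dm.
  have stE : st = 1 - th by rewrite /th; ring.
  (* The integrals of [u] cancel because the jumps preserve the velocity weights 1/4, 1/2, 1/4. At
     the walls the jumps contribute [th / 4] and the transport [- 2 * omega * h * (1 - th) / 4]
     times the same combination, and [th] is [2 * omega * h] to first order. *)
  rewrite [X in `|X|](_ : _ = (a2 - am + bm - b2) *
     ((th - 2 * omega%:num * h + th * (2 * omega%:num * h)) / 4) +
     omega%:num / 4 * (st * e2 + st * em)); last first.
    by rewrite /e2 /em stE; field.
  by apply: rtp_mean_step_bound => //; exact: uM.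
have -> : \int[muh]_(z in Sh) P h u z - \int[muh]_(z in Sh) u z =
  (\int[muh]_(z in Sh) P h u z - \int[muh]_(z in Sh) main z) +
  (\int[muh]_(z in Sh) main z - \int[muh]_(z in Sh) u z) by ring.
rewrite (le_trans (ler_normD _ _))// (le_trans (lerD step1 step2))//.
rewrite /C [leRHS]mulrDl lerD2r [leRHS]mulrDl; apply: lerD.
  rewrite -!mulrA ler_wpM2l// ler_wpM2l//.
  rewrite [leRHS](_ : _ = h * (2 * omega%:num * h)); last by ring.
  by rewrite ler_wpM2l.
rewrite -!mulrA ler_wpM2l// ler_wpM2l//.
rewrite [leRHS](_ : _ = (2 * omega%:num * h) ^+ 2); last by ring.
by rewrite lerXn2r// nnegrE// !mulr_ge0// ltW.
Qed.
End rtp_semigroup.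

(** * Invariance of the measure of the jamming process *)

Section rtp_invariant.
Context (R : realType) (omega L : {posnum R}) d (Omega : measurableType d)
  (Q : R -> probability Omega R) (v : R -> Omega -> R)
  (tau : nat -> Omega -> R) (x : R -> R -> Omega -> R).
Hypothesis hx : jamming_rtp omega%:num L%:num Q v tau x.
Let E1 := measurableTypeR R.
Let E := (measurableTypeR R * measurableTypeR R)%type.
Let V := rtp_velocities R.
Let Sh : set E := rtp_space L%:num.
Let muh := rtp_measure omega L.
Let P := rtp_transition Q v x.
Variable T : R -> (E -> R) -> (E -> R).
Hypothesis hT : L2_semigroup muh P T.
Let sT := proj1 hT.
Implicit Types (u f g F : E -> R).
Let mSh : measurable Sh. Proof. exact: rtp_space_measurable. Qed.
Let muT : (muh setT < +oo)%E. Proof. exact: rtp_measure_lty. Qed.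
Let bL u : bounded_measurable u -> u \in Lfun muh 2%:E.
Proof. exact: bounded_measurable_Lfun. Qed.

Lemma rtp_measureC : muh (~` Sh) = 0%E.
Proof.
have mC : measurable (~` Sh) by exact: measurableC.
have V2 : 2 \in V by rewrite !inE eqxx.
have V0 : 0 \in V by rewrite !inE eqxx orbT.
have Vm : - 2 \in V by rewrite !inE eqxx !orbT.
have L0m : 0 \in `[0, L%:num] by rewrite in_itv/= lexx ltW.
have LLm : L%:num \in `[0, L%:num] by rewrite in_itv/= lexx ltW.
have E0 a c : a \in `[0, L%:num] -> c \in V -> \1_(~` Sh) (a, c) = 0 :> R.
  by move=> aL cV; rewrite indicE memNset// => /(_ (conj aL cV)).
have I0 c : c \in V -> \int[lebesgue_measure]_(a in `[0, L%:num]) (\1_(~` Sh) (a, c) : R) = 0.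
  move=> cV; rewrite -[RHS](_ : \int[lebesgue_measure]_(a in `[0, L%:num]) (0 : R) = 0).
    by apply: eq_Rintegral => a /set_mem /= aL; rewrite E0.
  by rewrite /Rintegral integral0.
rewrite [LHS](rtp_measureE omega L mC) /rtp_mean !I0// !E0//.
by congr EFin; ring.
Qed.

Lemma rtp_aeS : {ae muh, forall z, Sh z}.
Proof. by exists (~` Sh); split; [exact: measurableC|exact: rtp_measureC|]. Qed.

Let ae_mean f g : bounded_measurable (f \_ Sh) -> bounded_measurable (g \_ Sh) ->
  f = g %[ae muh] -> \int[muh]_(z in Sh) f z = \int[muh]_(z in Sh) g z.
Proof.
move=> [mf _] [mg _] fg; rewrite !(Rintegral_mkcond _ Sh).
apply: (ae_eq_Rintegral measurableT mf mg).
by apply: filterS fg => z /(_ Logic.I) fgz _; rewrite !patchE fgz.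
Qed.

Let mean_patch f : \int[muh]_(z in Sh) (f \_ Sh) z = \int[muh]_(z in Sh) f z.
Proof. by apply: eq_Rintegral => z zS; rewrite patchE zS. Qed.

(** The semigroup law is that of [T], transferred to [P] almost everywhere with [P s u], cut off
    outside [Sh], as a representative of [T s u]. Null sets do not matter under the integral. *)
Let semigroup_mean (M K s h : R) u : 0 <= K -> 0 <= s -> 0 <= h -> lipschitz_slices L M K u ->
  \int[muh]_(z in Sh) P (s + h) u z = \int[muh]_(z in Sh) P h ((P s u) \_ Sh) z.
Proof.
move=> K0 s0 h0 uMK; have sh0 : 0 <= h + s by rewrite addr_ge0.
have [bu _ _] := uMK.
have wMK := lipschitz_slices_transition hx K0 s0 uMK; have [bw _ _] := wMK.
have [bw' _ _] := lipschitz_slices_transition hx K0 sh0 uMK.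
have [bw'' _ _] := lipschitz_slices_transition hx K0 h0 wMK.
rewrite addrC; apply: ae_mean => //.
have [_ _ _ [_ Tsum] _] := sT; have [_ TP] := hT.
have e1 := Tsum h s u h0 s0 (bL bu); have e2 := TP (h + s) u sh0 bu.
have e3 : T s u = (P s u) \_ Sh %[ae muh].
  move: rtp_aeS (TP s u s0 bu); apply: filterS2 => z Sz H _.
  by rewrite H// patchE mem_set.
have e4 := ae_eq_L2_semigroup sT h0 (L2_semigroup_Lfun sT s0 (bL bu)) (bL bw) e3.
have e5 := TP h _ h0 bw.
near=> z => _.
have <- : T (h + s) u z = P (h + s) u z by apply: (near e2).
have -> : T (h + s) u z = T h (T s u) z by apply: (near e1).
have -> : T h (T s u) z = T h ((P s u) \_ Sh) z by apply: (near e4).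
by apply: (near e5).
Unshelve. all: by end_near. Qed.

Let start_mean (M K : R) u : 0 <= K -> lipschitz_slices L M K u ->
  \int[muh]_(z in Sh) P 0 u z = \int[muh]_(z in Sh) u z.
Proof.
move=> K0 uMK; have [bu _ _] := uMK.
have [bw _ _] := lipschitz_slices_transition hx K0 (lexx 0) uMK.
have [_ _ _ [T0 _] _] := sT; have [_ TP] := hT.
apply: ae_mean => //.
  by have [mu_ [N uN]] := bu; apply: (bounded_measurable_restrict mSh (measurable_funTS mu_) (fun z _ => uN z)).
move: (T0 _ (bL bu)) (TP 0 u (lexx 0) bu); apply: filterS2 => z H1 H2 _.
by rewrite -H2// H1.
Qed.

Lemma rtp_lipschitz_mean (M K t : R) u : 0 <= K -> 0 <= t -> lipschitz_slices L M K u ->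
  \int[muh]_(z in Sh) P t u z = \int[muh]_(z in Sh) u z.
Proof.
move=> K0 t0 uMK; rewrite -(start_mean K0 uMK).
have [C HC] : exists C : R, forall h w, 0 <= h -> 2 * h <= 2^-1 -> lipschitz_slices L M K w ->
    `|\int[muh]_(z in Sh) P h w z - \int[muh]_(z in Sh) w z| <= C * h ^+ 2.
  by eexists => h w h0 h2 wMK; exact: (rtp_one_step_mean hx K0 h0 h2 wMK).
apply: (eq_of_small_increments (G := fun t => \int[muh]_(z in Sh) P t u z) t0) => e e0.
(* The first bound gives [2 * h <= 2^-1], required by the one-step estimate; the second turns
   [C * h ^+ 2] into at most [e * h]. *)
exists (Num.min 4^-1 (e / (`|C| + 1))); first by rewrite lt_min divr_gt0// andbT.
move=> s h s0 h0; rewrite lt_min => /andP[h4 he] _.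
have wMK := lipschitz_slices_transition hx K0 s0 uMK.
rewrite (semigroup_mean K0 s0 (ltW h0) uMK) -(mean_patch (P s u)).
have h2 : 2 * h <= 2^-1 by lra.
rewrite (le_trans (HC h _ (ltW h0) h2 wMK))// expr2 mulrA ler_wpM2r ?(ltW h0)//.
move: he; rewrite ltr_pdivlMr// => he; rewrite (le_trans _ (ltW he))// mulrC ler_wpM2l ?(ltW h0)//.
by rewrite (le_trans (ler_norm _))// lerDl.
Qed.

(** Measurability of [P t u] in the initial state is first obtained for Lipschitz [u]; it is part of
    the property so as to pass through the induction together with the identity. *)
Let stationary t u := [/\ bounded_measurable u, bounded_measurable ((P t u) \_ Sh) &
  \int[muh]_(z in Sh) P t u z = \int[muh]_(z in Sh) u z].

Let patch_lin (a : R) f g : (fun z => a * f z + g z) \_ Sh = fun z => a * (f \_ Sh) z + (g \_ Sh) z.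
Proof. by apply/funext => z; rewrite !patchE; case: ifP => // _; rewrite mulr0 addr0. Qed.

Let mean_lin (a : R) f g : bounded_measurable (f \_ Sh) -> bounded_measurable (g \_ Sh) ->
  \int[muh]_(z in Sh) (a * f z + g z) =
  a * \int[muh]_(z in Sh) f z + \int[muh]_(z in Sh) g z.
Proof.
move=> bf bg; rewrite !(Rintegral_mkcond _ Sh) patch_lin.
rewrite (bounded_measurable_RintegralD muT (bounded_measurableZ a bf) bg).
by rewrite (bounded_measurable_RintegralZ muT a bf).
Qed.

Let patch_bm u : bounded_measurable u -> bounded_measurable (u \_ Sh).
Proof.
by move=> [mu_ [N uN]]; exact: (bounded_measurable_restrict mSh (measurable_funTS mu_) (fun z _ => uN z)).
Qed.

Let stationary_lin t (a : R) f g : 0 <= t -> stationary t f -> stationary t g ->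
  stationary t (fun z => a * f z + g z).
Proof.
move=> t0 [bf bPf ef] [bg bPg eg].
have E' : (P t (fun z => a * f z + g z)) \_ Sh = fun z => a * ((P t f) \_ Sh) z + ((P t g) \_ Sh) z.
  rewrite -patch_lin; apply/funext => z; rewrite !patchE; case: ifPn => // /set_mem Sz.
  exact: (rtp_transition_lin hx a t0 Sz bf bg).
split; [exact: bounded_measurable_lin|by rewrite E'; exact: bounded_measurable_lin|].
rewrite -(mean_patch (P t _)) E' (mean_lin a (patch_bm bPf) (patch_bm bPg)) !mean_patch ef eg.
by rewrite (mean_lin a (patch_bm bf) (patch_bm bg)).
Qed.

Let stationary_lim t (w : (E -> R)^nat) f (M : R) : 0 <= t -> (forall n, stationary t (w n)) ->
  (forall n z, `|w n z| <= M) -> (forall z, w n z @[n --> \oo] --> f z) -> stationary t f.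
Proof.
move=> t0 sw wM wf.
have bw n : bounded_measurable (w n) by case: (sw n).
have bPw n : bounded_measurable ((P t (w n)) \_ Sh) by case: (sw n).
have bf := bounded_measurable_lim bw wM wf.
have M0 : 0 <= M by rewrite (le_trans _ (wM 0%N (0, 0))).
have PM n z : `|((P t (w n)) \_ Sh) z| <= M.
  rewrite patchE; case: ifPn => [/set_mem Sz|_]; last by rewrite normr0.
  exact: (rtp_transition_bounded hx t0 Sz (bw n) (wM n)).
have Pf z : ((P t (w n)) \_ Sh) z @[n --> \oo] --> ((P t f) \_ Sh) z.
  under eq_fun do rewrite patchE; rewrite patchE.
  case: ifPn => [/set_mem Sz|_]; last exact: cvg_cst.
  exact: (rtp_transition_cvg hx t0 Sz bw wM wf).
split => //; first exact: (bounded_measurable_lim bPw PM Pf).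
have mPw n : measurable_fun Sh ((P t (w n)) \_ Sh) by have [m _] := bPw n; exact: measurable_funTS.
have mw n : measurable_fun Sh (w n) by have [m _] := bw n; exact: measurable_funTS.
have c1 := @Rintegral_bounded_cvg _ E R muh muT Sh _ _ M mSh mPw
  (fun n z _ => PM n z) (fun z _ => Pf z).
have c2 := @Rintegral_bounded_cvg _ E R muh muT Sh _ _ M mSh mw
  (fun n z _ => wM n z) (fun z _ => wf z).
have cE : (fun n => \int[muh]_(z in Sh) ((P t (w n)) \_ Sh) z) =
    (fun n => \int[muh]_(z in Sh) w n z).
  by apply/funext => n; rewrite mean_patch; case: (sw n).
rewrite cE mean_patch in c1.
exact: (cvg_unique _ c1 c2).
Qed.

Let stationary_lipschitz t (M K : R) u : 0 <= K -> 0 <= t -> lipschitz_slices L M K u ->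
  stationary t u.
Proof.
move=> K0 t0 uMK; have [bu _ _] := uMK; split => //.
  by have [] := lipschitz_slices_transition hx K0 t0 uMK.
exact: rtp_lipschitz_mean K0 t0 uMK.
Qed.

Let tensor (g : E1 -> R) (c : R) z := g z.1 * \1_[set c] z.2 : R.

Let indic_le1 (c y : R) : `|\1_[set c] y : R| <= 1.
Proof. by rewrite indicE; case: (_ \in _); rewrite ?normr1 ?normr0. Qed.

Let tensor_bm (g : E1 -> R) c : bounded_measurable g -> bounded_measurable (tensor g c).
Proof.
move=> [mg [M gM]]; apply: bounded_measurableM.
  by split; [exact: (measurableT_comp mg)|exists M => z; exact: gM].
split; last by exists 1 => z; exact: indic_le1.
by apply: (measurableT_comp (f := \1_[set c] : E1 -> R)).
Qed.

Let tensor_lipschitz (g : E1 -> R) (c M K : R) : bounded_measurable g ->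
  (forall a, `|g a| <= M) -> (forall a b, `|g a - g b| <= K * `|a - b|) ->
  lipschitz_slices L M K (tensor g c).
Proof.
move=> bg gM gK; split; first exact: tensor_bm.
  move=> z; rewrite normrM -[leRHS]mulr1; apply: ler_pM => //; exact: indic_le1.
move=> y a b _ _ _; rewrite /tensor/= -mulrBl normrM -[leRHS]mulr1.
by apply: ler_pM => //; exact: indic_le1.
Qed.

(** Monotone class argument in the position alone, with the velocity fixed: the ramps approximating
    a ray are Lipschitz, which puts their tensors within reach of [rtp_lipschitz_mean]. *)
Let tensor_stationary t (c : R) (g : E1 -> R) : 0 <= t -> bounded_measurable g ->
  stationary t (tensor g c).
Proof.
move=> t0; move: g.
have tlim (w : (E1 -> R)^nat) (f : E1 -> R) (M : R) : (forall n y, `|w n y| <= M) ->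
    (forall y, w n y @[n --> \oo] --> f y) -> (forall n, stationary t (tensor (w n) c)) ->
    stationary t (tensor f c).
  move=> wM wf sw; apply: (stationary_lim t0 sw (M := M)) => [n z|z].
    rewrite normrM -[leRHS]mulr1; apply: ler_pM => //; exact: indic_le1.
  by apply: cvgM; [exact: wf|exact: cvg_cst].
apply: (@bounded_measurable_ray_induction R (fun g : E1 -> R => stationary t (tensor g c))).
- apply: (stationary_lipschitz (lexx 0) t0 (M := 1)).
  apply: tensor_lipschitz => [|a|a b]; first exact: bounded_measurable_cst.
    by rewrite normr1.
  by rewrite subrr normr0 mul0r.
- move=> a; apply: (tlim (ramp a) \1_`]a, +oo[ 1 (ler_norm_ramp a) (@cvg_ramp R a)) => n.
  apply: (stationary_lipschitz (ler0n R n) t0 (M := 1)).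
  apply: tensor_lipschitz; [exact: bounded_measurable_ramp|exact: ler_norm_ramp|].
  move=> y b; rewrite (le_trans (ler_norm_clamp _ _ _ _))// -mulrBr normrM opprB addrA subrK.
  by rewrite ger0_norm.
- move=> k f g bf bg sf sg.
  rewrite (_ : tensor _ c = fun z => k * tensor f c z + tensor g c z).
    exact: stationary_lin.
  by apply/funext => z; rewrite /tensor; ring.
- move=> w f M bw wM wf sw; exact: (tlim w f M).
Qed.

(** On [Sh] a bounded measurable function is a sum of three tensors, one for each velocity, and
    neither side of the identity sees values outside [Sh]. *)
Lemma rtp_invariant : invariant_probability Sh muh P.
Proof.
split; [exact: rtp_measureT|exact: rtp_measureC|move=> t u t0 bu].
pose u' z := \sum_(c <- V) tensor (fun a => u (a, c)) c z.
have [bu' _ e'] : stationary t u'.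
  rewrite /u'; elim: (V : seq R) => [|c s IHs].
    under eq_fun do rewrite big_nil.
    apply: (stationary_lipschitz (lexx 0) t0 (M := 0)); split.
    - exact: bounded_measurable_cst.
    - by move=> z; rewrite normr0.
    - by move=> y a b _ _ _; rewrite subrr normr0 mul0r.
  have bc := bounded_measurable_slice c bu.
  have := stationary_lin 1 t0 (tensor_stationary c t0 bc) IHs.
  by under eq_fun do rewrite mul1r; under [X in _ -> stationary t X]eq_fun do rewrite big_cons.
have uE : {in Sh, u =1 u'}.
  move=> [a c] /set_mem[/= _ cV]; rewrite /u' /tensor/=.
  rewrite (eq_bigr (fun y => (c == y)%:R * u (a, y))); last first.
    move=> y _; rewrite mulrC indicE; congr (_%:R * _); congr nat_of_bool.
    by apply/idP/eqP => [/set_mem|->]; [|exact/mem_set].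
  by rewrite rtp_velocities_sum.
rewrite [RHS](eq_Rintegral muh uE) -e'; apply: eq_Rintegral => z /set_mem Sz.
exact: (eq_rtp_transition hx t0 Sz uE).
Qed.
End rtp_invariant.

(** The endpoints are Lebesgue null. This absorbs the difference between velocity and effective
    velocity at the walls. *)
Lemma eq_Rintegral_itvoo (R : realType) (a b : R) (f g : R -> R) : a < b ->
  {in `]a, b[, f =1 g} -> lebesgue_measure.-integrable `[a, b] (EFin \o f) ->
  lebesgue_measure.-integrable `[a, b] (EFin \o g) ->
  \int[lebesgue_measure]_(x in `[a, b]) f x = \int[lebesgue_measure]_(x in `[a, b]) g x.
Proof.
move=> ab fg If Ig.
have E h : lebesgue_measure.-integrable `[a, b] (EFin \o h) ->
    \int[lebesgue_measure]_(x in `[a, b]) h x = \int[lebesgue_measure]_(x in `]a, b[) h x.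
  move=> Ih; rewrite -Rintegral_itv_obnd_cbnd.
    rewrite -Rintegral_itv_bndo_bndc//; apply: integrableS Ih => //.
    by move=> x /=; rewrite !in_itv/= => /andP[/ltW -> /ltW ->].
  by apply: integrableS Ih => // x /=; rewrite !in_itv/= => /andP[/ltW -> ->].
by rewrite !E//; apply: eq_Rintegral => x /set_mem/fg.
Qed.

(** * The generator of the jamming process on functions of the position *)

Section rtp_generator.
Context (R : realType) (omega L : {posnum R}) d (Omega : measurableType d)
  (Q : R -> probability Omega R) (v : R -> Omega -> R)
  (tau : nat -> Omega -> R) (x : R -> R -> Omega -> R).
Hypothesis hx : jamming_rtp omega%:num L%:num Q v tau x.
Let E1 := measurableTypeR R.
Let E := (measurableTypeR R * measurableTypeR R)%type.
Let S : set E1 := `[0, L%:num]%classic.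
Let V := rtp_velocities R.
Let Sh : set E := rtp_space L%:num.
Let muh := rtp_measure omega L.
Let P := rtp_transition Q v x.
Variable T : R -> (E -> R) -> (E -> R).
Hypothesis hT : L2_semigroup muh P T.
Let sT := proj1 hT.
Let clamp (y : R) : R := Num.max 0 (Num.min L%:num y).
Let st := rtp_stay omega%:num.
Let o0 : 0 < omega%:num. Proof. by []. Qed.
Let L0 : 0 < L%:num. Proof. by []. Qed.
Let mS : measurable S. Proof. exact: measurable_itv. Qed.
Let mSh : measurable Sh. Proof. exact: rtp_space_measurable. Qed.
Let muT : (muh setT < +oo)%E. Proof. exact: rtp_measure_lty. Qed.
Let bL (u : E -> R) : bounded_measurable u -> u \in Lfun muh 2%:E.
Proof. exact: bounded_measurable_Lfun. Qed.
Let bmc (f : E1 -> R) : {within S, continuous f} -> bounded_measurable (f \_ S).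
Proof. exact: bounded_measurable_continuous. Qed.
Let clampL a : clamp a \in `[0, L%:num]. Proof. exact/clamp_in/ltW. Qed.

Let velocity_le (c : R) : c \in V -> `|c| <= 2.
Proof. by rewrite !inE => /or3P[] /eqP ->; rewrite ?normrN ?normr0// ger0_norm. Qed.

(* The particle is at rest when it pushes against a wall. *)
Definition rtp_drift (z : R * R) : R :=
  if ((z.1 == 0) && (z.2 == - 2)) || ((z.1 == L%:num) && (z.2 == 2)) then 0 else z.2.

Let two0 : (2 == 0 :> R) = false. Proof. exact/negbTE. Qed.

(** A particle heading for a wall at distance r > 0 meets it only after time r/2, so the projection
    is inactive before; at the wall it cancels the whole displacement. The time range depends on
    [a]. *)
Lemma rtp_drift_near a c : a \in `[0, L%:num] -> c \in V ->
  \forall t \near 0^'+, clamp (a + c * t) - a = rtp_drift (a, c) * t.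
Proof.
rewrite in_itv/= => /andP[a0 aL]; rewrite /rtp_drift/= !inE => /or3P[] /eqP -> {c}.
- rewrite eqxx andbT (_ : 2 == - 2 = false) ?andbF/=; last first.
    by apply/negbTE; rewrite -subr_eq0 opprK -natrD pnatr_eq0.
  have [->|aL'] := eqVneq a L%:num.
    near=> t; have t0 : 0 < t by near: t; exact: nbhs_right_gt.
    by rewrite /clamp min_l ?max_r ?(ltW L0) ?subrr ?mul0r// lerDl mulr_ge0// ltW.
  have d0 : 0 < (L%:num - a) / 2 by rewrite divr_gt0// subr_gt0 lt_neqAle aL' aL.
  near=> t; have t0 : 0 < t by near: t; exact: nbhs_right_gt.
  have td : t < (L%:num - a) / 2 by near: t; exact: nbhs_right_lt.
  rewrite /clamp clamp_id; first by rewrite addrAC subrr add0r.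
  by rewrite in_itv/=; apply/andP; split; lra.
- near=> t; rewrite if_same !mul0r.
  by rewrite addr0 /clamp clamp_id ?subrr// in_itv/= a0 aL.
- rewrite eqxx andbT (_ : - 2 == 2 = false) ?andbF ?orbF/=; last first.
    by apply/negbTE; rewrite eq_sym -subr_eq0 opprK -natrD pnatr_eq0.
  have [->|a0'] := eqVneq a 0.
    near=> t; have t0 : 0 < t by near: t; exact: nbhs_right_gt.
    by rewrite /clamp max_l ?subrr ?mul0r// ge_min; apply/orP; right; lra.
  have d0 : 0 < a / 2 by rewrite divr_gt0// lt_neqAle eq_sym a0' a0.
  near=> t; have t0 : 0 < t by near: t; exact: nbhs_right_gt.
  have td : t < a / 2 by near: t; exact: nbhs_right_lt.
  rewrite /clamp clamp_id; first by rewrite addrAC subrr add0r.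
  by rewrite in_itv/=; apply/andP; split; lra.
Unshelve. all: by end_near. Qed.

Definition rtp_gradient (f1 : R -> R) : E -> R := (fun z => f1 z.1 * rtp_drift z) \_ Sh.

Section gradient.
Variables (f f1 : R -> R).
Hypotheses (df : derivative_on S f f1) (cf1 : {within S, continuous f1}).
Let cf : {within S, continuous f} := derivative_on_continuous df.
Let u : E -> R := (f \_ S) \o fst.
(** The part of the difference quotient in which no jump occurs. As [u] does not depend on the
    velocity, a jump does not change it at a frozen position, and [W t] differs from the full
    quotient by O(t). *)
Let W t : E -> R :=
  (fun z => st t * ((f (clamp (z.1 + z.2 * t)) - f z.1) / t)) \_ Sh.

Let lipschitz : exists M K : R, [/\ 0 <= K, forall a, S a -> `|f a| <= M,
  forall a b, a \in `[0, L%:num] -> b \in `[0, L%:num] -> `|f a - f b| <= K * `|a - b| &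
  lipschitz_slices L M K u].
Proof.
have [M fM] := within_continuous_bounded (ltW L0) cf.
have [K fK] := within_continuous_bounded (ltW L0) cf1.
have S0 : S 0 by rewrite /S/= in_itv/= lexx ltW.
have K0 : 0 <= K by rewrite (le_trans _ (fK 0 S0)).
have M0 : 0 <= M by rewrite (le_trans _ (fM 0 S0)).
have lip a b : a \in `[0, L%:num] -> b \in `[0, L%:num] -> `|f a - f b| <= K * `|a - b|.
  wlog ab : a b / a <= b.
    move=> H aS bS; have [/H|/ltW /H] := leP a b; first exact.
    by rewrite distrC [`|a - b|]distrC; apply.
  rewrite !in_itv/= => /andP[a0 aS] /andP[b0 bS].
  have [c /andP[ac cb] E'] := derivative_on_mvt df a0 ab bS.
  rewrite distrC E' normrM [`|a - b|]distrC ler_wpM2r// fK//.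
  by rewrite /S/= in_itv/= (le_trans a0 ac) (le_trans cb bS).
exists M, K; split => //; split.
- have [mf [N fN]] := bmc cf; split; last by exists N => z; exact: fN.
  exact: (measurableT_comp mf).
- move=> z; rewrite /u/= patchE; case: ifPn => [/set_mem/fM//|_].
  by rewrite normr0.
- by move=> y a b _ aS bS; rewrite /u/= !patchE !mem_set//; exact: lip.
Qed.

Let bW : exists K : R, forall t, 0 < t -> bounded_measurable (W t) /\ forall z, `|W t z| <= K.
Proof.
have [M [K [K0 _ fK _]]] := lipschitz; exists (2 * K) => t t0.
have st0 : 0 <= st t by exact: expR_ge0.
have [th0 _ _] := rtp_stay_bounds o0 (ltW t0); rewrite subr_ge0 in th0.
have WK z : Sh z -> `|st t * ((f (clamp (z.1 + z.2 * t)) - f z.1) / t)| <= 2 * K.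
  case: z => a c [/= aL cV]; rewrite normrM (ger0_norm st0) -[leRHS]mul1r ler_pM//.
  rewrite normrM normfV (gtr0_norm t0) ler_pdivrMr//.
  rewrite (le_trans (fK _ _ (clampL _) aL))// [2 * K]mulrC -mulrA ler_wpM2l//.
  rewrite -[X in `|_ - X|](clamp_id aL) (le_trans (ler_norm_clamp _ _ _ _))//.
  rewrite addrAC subrr add0r normrM (gtr0_norm t0) ler_wpM2r ?(ltW t0)//.
  exact: velocity_le.
split; last first.
  move=> z; rewrite /W patchE; case: ifPn => [/set_mem|_]; first exact: WK.
  by rewrite normr0 mulr_ge0.
apply: bounded_measurable_rtp WK => c cV.
have st1 : 0 <= st t * t^-1 by rewrite mulr_ge0// invr_ge0 ltW.
apply: (lipschitz_measurable (mulr_ge0 st1 (mulr_ge0 (ler0n R 2) K0))) => a b aS bS /=.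
have -> (k r s y : R) : st t * ((k - r) / t) - st t * ((s - y) / t) =
    st t * t^-1 * (k - s - (r - y)) by ring.
rewrite normrM (ger0_norm st1) -[leRHS]mulrA ler_wpM2l//.
apply: (le_trans (ler_normB _ _)).
have h1 : `|f (clamp (a + c * t)) - f (clamp (b + c * t))| <= K * `|a - b|.
  rewrite (le_trans (fK _ _ (clampL _) (clampL _)))// ler_wpM2l//.
  rewrite (le_trans (ler_norm_clamp _ _ _ _))// le_eqVlt; apply/orP; left; apply/eqP.
  by congr (`|_|); ring.
by rewrite (le_trans (lerD h1 (fK _ _ aS bS)))// -mulr2n mulr_natl -mulrnAl.
Qed.

Let st_cvg : st t @[t --> 0^'+] --> (1 : R).
Proof.
apply/cvgrPdist_le => e e0; have d0 : 0 < e / (2 * omega%:num) by rewrite divr_gt0.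
near=> t; have t0 : 0 < t by near: t; exact: nbhs_right_gt.
have [th0 th1 _] := rtp_stay_bounds o0 (ltW t0).
rewrite ger0_norm// (le_trans th1)// mulrC -ler_pdivlMr//; exact: ltW.
Unshelve. all: by end_near. Qed.

(** The convergence is established pointwise, with a time scale that shrinks near a wall. The
    passage to L^2 therefore uses the uniform bound [bW] and dominated convergence. *)
Let W_cvg z : W t z @[t --> 0^'+] --> rtp_gradient f1 z.
Proof.
rewrite /W /rtp_gradient; under eq_fun do rewrite patchE; rewrite patchE.
case: ifPn => [/set_mem|_]; last exact: cvg_cst.
case: z => a c [/= aL cV].
suff D : (f (clamp (a + c * t)) - f a) / t @[t --> 0^'+] --> f1 a * rtp_drift (a, c).
  have H : st t * ((f (clamp (a + c * t)) - f a) / t) @[t --> 0^'+] -->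
      1 * (f1 a * rtp_drift (a, c)) by apply: cvgM; [exact: st_cvg|exact: D].
  by rewrite mul1r in H.
apply/cvgrPdist_le => e e0; have e2 : 0 < e / 2 by rewrite divr_gt0.
(* Tolerance [e / 2] because the displacement in time [t] can be as large as [2 * t]. *)
have [r /= r0 Hr] := (nbhs_ballP _ _).1 (derivative_on_near df aL e2).
near=> t; have t0 : 0 < t by near: t; exact: nbhs_right_gt.
have tr : t < r / 2 by near: t; apply: nbhs_right_lt; rewrite divr_gt0.
have dE : clamp (a + c * t) - a = rtp_drift (a, c) * t.
  by near: t; exact: rtp_drift_near.
have d2 : `|clamp (a + c * t) - a| <= 2 * t.
  rewrite -[X in `|_ - X|](clamp_id aL) (le_trans (ler_norm_clamp _ _ _ _))//.
  rewrite addrAC subrr add0r normrM (gtr0_norm t0) ler_wpM2r ?(ltW t0)//.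
  exact: velocity_le.
have := Hr (clamp (a + c * t)); rewrite /ball/= distrC.
have lr : `|clamp (a + c * t) - a| < r by apply: (le_lt_trans d2); lra.
move=> /(_ lr (clampL _)) /le_trans /(_ (ler_wpM2l (ltW e2) d2)).
rewrite dE (_ : e / 2 * (2 * t) = e * t); last by field.
rewrite -ler_pdivrMr// -[X in _ / X](gtr0_norm t0) -normf_div distrC.
apply: le_trans; rewrite le_eqVlt; apply/orP; left; apply/eqP.
by congr (`|_|); field; exact: lt0r_neq0.
Unshelve. all: by end_near. Qed.

(** Inherited from the uniformly bounded measurable functions [W t] along [t = 1 / (n + 1)]. *)
Lemma bounded_measurable_rtp_gradient : bounded_measurable (rtp_gradient f1).
Proof.
have [K WK] := bW.
have t0 n : 0 < (n.+1%:R : R)^-1 by rewrite invr_gt0.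
apply: (@bounded_measurable_lim _ E R (fun n => W n.+1%:R^-1) _ K).
- by move=> n; case: (WK _ (t0 n)).
- by move=> n z; case: (WK _ (t0 n)).
move=> z; apply: ((cvg_at_rightP _ _ _).1 (@W_cvg z)); split => //.
exact: cvg_harmonic.
Qed.

Let bg := bounded_measurable_rtp_gradient.

Lemma rtp_generator : L2_generator muh T ((f \_ S) \o fst) (rtp_gradient f1).
Proof.
have [M [K [K0 fM fK uMK]]] := lipschitz; have [bu uM uK] := uMK.
have [KW WK] := bW.
have u2 := bL bu; have g2 := bL bg.
apply/(L2_generatorP sT); split => //.
(* The error of [rtp_one_step] with [2 * omega * t] for the jump probability, namely [2 * K * t * (2
   * omega * t) + 2 * M * (2 * omega * t) ^+ 2], is [C * t ^+ 2]. *)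
pose C : R := 4 * K * omega%:num + 8 * M * omega%:num ^+ 2.
have M0 : 0 <= M by rewrite (le_trans _ (uM (0, 0))).
have C0 : 0 <= C by rewrite addr_ge0// !mulr_ge0// ?sqr_ge0 ?ltW.
have qW t : 0 < t -> L2_rnorm muh (fun z => (T t u z - u z) / t - W t z) <= C * t.
  move=> t0; have [bWt _] := WK t t0.
  have [bPu _ _] := lipschitz_slices_transition hx K0 (ltW t0) uMK.
  have bus : bounded_measurable (u \_ Sh).
    have [mu_ _] := bu.
    exact: (bounded_measurable_restrict mSh (measurable_funTS mu_) (fun z _ => uM z)).
  pose H z := t^-1 * (((P t u) \_ Sh) z - (u \_ Sh) z) - W t z.
  have bH : bounded_measurable H.
    apply: bounded_measurableB => //; apply: bounded_measurableZ.
    exact: bounded_measurableB.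
  have HC z : `|H z| <= C * t.
    rewrite /H /W !patchE; case: ifPn => [/set_mem|_]; last first.
      by rewrite !subr0 mulr0 normr0 mulr_ge0// ltW.
    case: z => a c [/= aL cV].
    have := rtp_one_step o0 L0 hx aL cV (ltW t0) bu uM K0 uK.
    (* Averaging over the new velocity has no effect on a function of the position, so the jump term
       contributes no first-order part. *)
    have -> : \sum_(y <- rtp_velocities R) rtp_jump omega%:num c y * u (a, y) = f a.
      rewrite (eq_bigr (fun y => rtp_jump omega%:num c y * f a)).
        by rewrite -mulr_suml rtp_jump_sum1// mul1r.
      by move=> y _; rewrite /u/= patchE mem_set.
    have uE y b : b \in `[0, L%:num] -> u (b, y) = f b by move=> bS; rewrite /u/= patchE mem_set.
    rewrite !uE//; last exact: clampL.
    rewrite -/(P t u (a, c)) -/(clamp _) -/(st t) => h1.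
    have [th0 th1 _] := rtp_stay_bounds o0 (ltW t0); rewrite -/(st t) in th0 th1.
    rewrite (_ : _ - _ = (P t u (a, c) - (st t * f (clamp (a + c * t)) + (1 - st t) * f a)) / t); last by ring.
    rewrite normrM normfV (gtr0_norm t0) ler_pdivrMr// (le_trans h1)//.
    rewrite (_ : C * t * t = 2 * K * t * (2 * omega%:num * t) + 2 * M * (2 * omega%:num * t) ^+ 2); last first.
      by rewrite /C; ring.
    apply: lerD; first by rewrite ler_wpM2l// !mulr_ge0// ltW.
    rewrite ler_wpM2l ?mulr_ge0// lerXn2r// nnegrE//.
    by rewrite !mulr_ge0// ltW.
  rewrite (@ae_eq_L2_rnorm _ _ _ _ _ H).
  - apply: L2_rnorm_le_cst => //; [exact: rtp_measureT|by rewrite mulr_ge0// ltW|].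
    by case: bH.
  - by apply: LfunB; [exact: (L2_quotient_Lfun sT t0 u2)|exact: bL].
  - exact: bL.
  have [_ TP] := hT.
  have aeS : {ae muh, forall z, Sh z} by exact: rtp_aeS.
  move: aeS (TP t u (ltW t0) bu); apply: filterS2 => z Sz Tz _.
  by rewrite /H !patchE mem_set// Tz// mulrC.
have Wg : L2_rnorm muh (fun z => W t z - rtp_gradient f1 z) @[t --> 0^'+] --> 0.
  apply/cvg_at_rightP => s [s0 s_cvg].
  apply: (L2_rnorm_bounded_cvg muT (u := fun n => W (s n)) (M := KW)).
  - by move=> n; case: (WK _ (s0 n)).
  - by move=> n z; case: (WK _ (s0 n)).
  - by move=> z; apply: ((cvg_at_rightP _ _ _).1 (@W_cvg z)).
have H0 : C * t + L2_rnorm muh (fun z => W t z - rtp_gradient f1 z) @[t --> 0^'+] --> 0.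
  rewrite -[X in _ --> X]addr0; apply: cvgD => //.
  rewrite -[X in _ --> X](mulr0 C); apply: cvgM; first exact: cvg_cst.
  exact: cvg_within_filter (@cvg_id _ _).
apply: (squeeze_cvgr _ (cvg_cst 0) H0).
near=> t; have t0 : 0 < t by near: t; exact: nbhs_right_gt.
rewrite L2_rnorm_ge0/=.
have qL := L2_quotient_Lfun sT t0 u2; have WL := bL (WK t t0).1.
by rewrite (le_trans (ler_L2_rnormB qL WL g2))// lerD2r qW.
Unshelve. all: by end_near. Qed.

Let gradient_in a c : a \in `]0, L%:num[ -> c \in V -> rtp_gradient f1 (a, c) = c * f1 a.
Proof.
move=> /[dup] aL; rewrite in_itv/= => /andP[a0 aL'] cV.
rewrite /rtp_gradient patchE mem_set; last first.
  by split => //=; rewrite in_itv/= (ltW a0) (ltW aL').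
by rewrite /rtp_drift/= (gt_eqF a0) (lt_eqF aL')/= mulrC.
Qed.

Let gradient_wall a c : c = 0 \/ (a = 0 /\ c = - 2) \/ (a = L%:num /\ c = 2) ->
  rtp_gradient f1 (a, c) = 0.
Proof.
rewrite /rtp_gradient patchE /rtp_drift/=; case: ifP => // _.
by move=> [->|[[-> ->]|[-> ->]]]; rewrite ?if_same ?eqxx ?orbT/= mulr0.
Qed.

Lemma rtp_gradient_slice (k : E1 -> R) (N c : R) : measurable_fun S k ->
  (forall a, S a -> `|k a| <= N) -> c \in V ->
  \int[lebesgue_measure]_(a in `[0, L%:num]) (rtp_gradient f1 (a, c) * k a) =
  c * \int[lebesgue_measure]_(a in `[0, L%:num]) (f1 a * k a).
Proof.
move=> mk kN cV; have [M fM] := within_continuous_bounded (ltW L0) cf1.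
have [mg [G gG]] := bounded_measurable_slice c bg.
have lebS := lebesgue_itv_lty L0.
have If : lebesgue_measure.-integrable S (EFin \o (fun a => f1 a * k a)).
  apply: (integrable_le_cst mS lebS (M := M * N)) => [|a Sa].
    by apply: measurable_funM => //; exact: subspace_continuous_measurable_fun.
  by rewrite normrM ler_pM// ?fM// kN.
rewrite -RintegralZl//; apply: eq_Rintegral_itvoo => //.
- by move=> a aL; rewrite gradient_in// mulrA.
- apply: (integrable_le_cst mS lebS (M := G * N)) => [|a Sa].
    by apply: measurable_funM => //; exact: measurable_funTS.
  by rewrite normrM ler_pM// kN.
- by apply: eq_integrable (integrableZl mS c If) => // a _ /=; rewrite EFinM.
Qed.

(** The atoms disappear, the effective velocity being zero wherever there is mass on a wall. In the
    interior the velocities 2 and -2, each with weight [omega / 4], give the factor [omega / 2] and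
    the opposite signs. *)
Lemma rtp_gradient_inner (k : E -> R) : bounded_measurable k ->
  L2_inner muh (rtp_gradient f1) k = (2 + omega%:num * L%:num)^-1 * (omega%:num / 2 *
    (\int[lebesgue_measure]_(a in `[0, L%:num]) (f1 a * k (a, 2)) -
     \int[lebesgue_measure]_(a in `[0, L%:num]) (f1 a * k (a, - 2)))).
Proof.
move=> bk; have sliceE c : c \in V -> \int[lebesgue_measure]_(a in `[0, L%:num])
    (rtp_gradient f1 (a, c) * k (a, c)) =
    c * \int[lebesgue_measure]_(a in `[0, L%:num]) (f1 a * k (a, c)).
  have [mk [N kN]] := bounded_measurable_slice c bk.
  exact: (rtp_gradient_slice (measurable_funTS mk) (fun a _ => kN a)).
rewrite /L2_inner (rtp_Rintegral omega L (bounded_measurableM bg bk)) /rtp_mean !sliceE ?inE ?eqxx ?orbT//.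
rewrite (gradient_wall (or_introl erefl)) (gradient_wall (or_introl erefl)).
rewrite (gradient_wall (or_intror (or_introl (conj erefl erefl)))).
rewrite (gradient_wall (or_intror (or_intror (conj erefl erefl)))).
by congr (_ * _); field.
Qed.
End gradient.

Lemma rtp_gradient_centered f f1 g : derivative_on S f f1 -> {within S, continuous f1} ->
  bounded_measurable (g : E1 -> R) -> L2_inner muh (rtp_gradient f1) (g \o fst) = 0.
Proof.
move=> df cf1 [mg [N gN]]; rewrite (rtp_gradient_inner df cf1); last first.
  by split; [exact: (measurableT_comp mg)|exists N => z; exact: gN].
by rewrite subrr !mulr0.
Qed.

(** The slices at 2 and -2 now carry a second factor of the velocity and add up instead of
    cancelling; half the variance 2 is the factor 1. The right-hand side is that of
    [sticky_operator_form] with the opposite sign. *)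
Lemma rtp_gradient_form f f1 g g1 : derivative_on S f f1 -> {within S, continuous f1} ->
  derivative_on S g g1 -> {within S, continuous g1} ->
  2^-1 * L2_inner muh (rtp_gradient f1) (rtp_gradient g1) =
  (2 + omega%:num * L%:num)^-1 *
    (omega%:num * \int[lebesgue_measure]_(a in `[0, L%:num]) (f1 a * g1 a)).
Proof.
move=> df cf1 dg cg1; have bg := bounded_measurable_rtp_gradient dg cg1.
have [M fM] := within_continuous_bounded (ltW L0) cf1.
have mf : measurable_fun S f1 by exact: subspace_continuous_measurable_fun.
have sliceE c : c \in V -> \int[lebesgue_measure]_(a in `[0, L%:num])
    (f1 a * rtp_gradient g1 (a, c)) =
    c * \int[lebesgue_measure]_(a in `[0, L%:num]) (f1 a * g1 a).
  move=> cV.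
  have -> : \int[lebesgue_measure]_(a in `[0, L%:num]) (f1 a * g1 a) =
      \int[lebesgue_measure]_(a in `[0, L%:num]) (g1 a * f1 a).
    by apply: eq_Rintegral => a _; rewrite mulrC.
  rewrite -(rtp_gradient_slice dg cg1 mf fM cV).
  by apply: eq_Rintegral => a _; rewrite mulrC.
rewrite (rtp_gradient_inner df cf1 bg) !sliceE ?inE ?eqxx ?orbT//.
field; apply: lt0r_neq0; rewrite ltr_pwDl// mulr_ge0//.
Qed.
End rtp_generator.

(** * The lift *)

Lemma rtp_measure_fst (R : realType) (omega L : {posnum R})
    (B : set (measurableTypeR R)) : measurable B ->
  rtp_measure omega L (fst @^-1` B) = sticky_measure omega L B.
Proof.
move=> mB; have L0 : 0 < L%:num by [].
have mfB : measurable ((fst : measurableTypeR R * measurableTypeR R -> _) @^-1` B).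
  by rewrite -[X in measurable X]setTI; exact: measurable_fst.
rewrite [LHS](rtp_measureE omega L mfB) [RHS](sticky_measureE omega L mB).
have IE (c : R) : \int[lebesgue_measure]_(a in `[0, L%:num])
    (\1_((fst : measurableTypeR R * measurableTypeR R -> _) @^-1` B) (a, c) : R) =
    fine (lebesgue_measure (B `&` `[0, L%:num]%classic)).
  by rewrite /Rintegral -integral_indic.
by congr EFin; rewrite /rtp_mean !IE !indicE; field.
Qed.

Section rtp_lift.
Context (R : realType) (omega L : {posnum R})
  (p : R -> R -> probability (measurableTypeR R) R) d (Omega : measurableType d)
  (Q : R -> probability Omega R) (v : R -> Omega -> R)
  (tau : nat -> Omega -> R) (x : R -> R -> Omega -> R).
Let E1 := measurableTypeR R.
Let E := (measurableTypeR R * measurableTypeR R)%type.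
Let S : set E1 := `[0, L%:num]%classic.
Let Sh : set E := rtp_space L%:num.
Let mu := sticky_measure omega L.
Let muh := rtp_measure omega L.
Let P := transition S p.
Let Ph := rtp_transition Q v x.
Variables (T : R -> (E1 -> R) -> (E1 -> R)) (Th : R -> (E -> R) -> (E -> R)).
Hypotheses (hp : sticky_brownian_motion omega%:num L%:num p) (hT : L2_semigroup mu P T).
Hypotheses (hx : jamming_rtp omega%:num L%:num Q v tau x) (hTh : L2_semigroup muh Ph Th).
Let L0 : 0 < L%:num. Proof. by []. Qed.
Let muhT : (muh setT < +oo)%E. Proof. exact: rtp_measure_lty. Qed.
Let muT : (mu setT < +oo)%E. Proof. exact: sticky_measure_lty. Qed.

(** The core is the cut-off C^0-domain. The identities are required for every representative of a
    generator image, so uniqueness almost everywhere first replaces these by [rtp_gradient] and by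
    the second derivative. *)
Lemma rtp_second_order_lift : second_order_lift muh Sh Ph (L2_generator muh Th)
  mu S P (L2_generator mu T) fst.
Proof.
split.
- exact: rtp_invariant hx _ hTh.
- exact: sticky_invariant.
- exact: sticky_reversible.
- by move=> B mB; exact: rtp_measure_fst.
have cd (f : E1 -> R) : (exists g, C0_generator S p f g) -> exists f1 f2,
    [/\ derivative_on S f f1, derivative_on S f1 f2, {within S, continuous f1},
     C0_generator S p f f2 & {within S, continuous f2} /\
     f2 0 = omega%:num * f1 0 /\ f2 L%:num = - omega%:num * f1 L%:num].
  move=> [f2 Cf]; have /(hp.2 _ _).1 [f1 [df df1 cf2 f20 f2L]] := Cf.
  by exists f1, f2; split => //; exact: derivative_on_continuous df1.
have bmc (f f1 : E1 -> R) : derivative_on S f f1 -> bounded_measurable (f \_ S).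
  by move=> /derivative_on_continuous; exact: bounded_measurable_continuous.
have bfst (f : E1 -> R) : bounded_measurable f -> bounded_measurable (f \o fst : E -> R).
  by move=> [mf [N fN]]; split; [exact: (measurableT_comp mf)|exists N => z; exact: fN].
have bLh (k : E -> R) : bounded_measurable k -> k \in Lfun muh 2%:E.
  exact: bounded_measurable_Lfun.
exists [set (f : E1 -> R) \_ S | f in [set f : E1 -> R | exists g : E1 -> R, C0_generator S p f g]]; split.
- exact (sticky_core hp hT).
- move=> _ [f /cd[f1 [f2 [df _ cf1 _ _]]] <-]; exists (rtp_gradient L f1).
  exact: (rtp_generator hx hTh df cf1).
- move=> _ _ h [f /cd[f1 [f2 [df _ cf1 _ _]]] <-] [g /cd[g1 [g2 [dg _ _ _ _]]] <-] Ah.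
  have Af := rtp_generator hx hTh df cf1; have [_ h2 _] := Ah.
  have bh := bounded_measurable_rtp_gradient omega df cf1.
  have bg := bmc _ _ dg.
  rewrite (ae_eq_L2_inner h2 (bLh _ bh) (bLh _ (bfst _ bg)) (L2_generator_unique hTh.1 Ah Af)).
  exact: (rtp_gradient_centered omega df cf1 bg).
- move=> _ _ hf hg Ag [f /cd[f1 [f2 [df _ cf1 _ _]]] <-] [g /cd[g1 [g2 [dg dg1 cg1 Cg [cg2 [g20 g2L]]]]] <-] Ahf Ahg AAg.
  have Af := rtp_generator hx hTh df cf1; have Ag' := rtp_generator hx hTh dg cg1.
  have [_ hf2 _] := Ahf; have [_ hg2 _] := Ahg; have [_ Ag2 _] := AAg.
  have bf := bmc _ _ df.
  have bdf := bounded_measurable_rtp_gradient omega df cf1.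
  have bdg := bounded_measurable_rtp_gradient omega dg cg1.
  rewrite (ae_eq_L2_inner hf2 (bLh _ bdf) hg2 (L2_generator_unique hTh.1 Ahf Af)).
  rewrite L2_innerC (ae_eq_L2_inner hg2 (bLh _ bdg) (bLh _ bdf) (L2_generator_unique hTh.1 Ahg Ag')).
  rewrite L2_innerC (rtp_gradient_form omega df cf1 dg cg1).
  have bg2 : bounded_measurable (g2 \_ S) by exact: bounded_measurable_continuous.
  have bL (k : E1 -> R) : bounded_measurable k -> k \in Lfun mu 2%:E.
    exact: bounded_measurable_Lfun.
  rewrite L2_innerC (ae_eq_L2_inner Ag2 (bL _ bg2) (bL _ bf)
    (L2_generator_unique hT.1 AAg (L2_generator_C0 hp hT Cg))).
  have -> : L2_inner mu (g2 \_ S) (f \_ S) = \int[mu]_(a in S) (g2 a * f a).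
    rewrite [RHS]Rintegral_mkcond; apply: eq_Rintegral => a _; rewrite !patchE.
    by case: ifP => // _; rewrite mulr0.
  rewrite [X in - X](sticky_operator_form dg1 cg2 g20 g2L df cf1) mulNr opprK.
  by congr (_ * (_ * _)); apply: eq_Rintegral => a _; rewrite mulrC.
Qed.
End rtp_lift.

Theorem theorem7 (R : realType) (omega L : {posnum R})
    (p : R -> R -> probability (measurableTypeR R) R)
    (hp : sticky_brownian_motion omega%:num L%:num p) :
  let S : set (measurableTypeR R) := `[0, L%:num]%classic in
  let P := transition S p in
  let mu := sticky_measure omega L in
  let muh := rtp_measure omega L in
  [/\ (* (i) *)
      invariant_probability S mu P /\
      (forall nu : probability (measurableTypeR R) R,
         invariant_probability S nu P ->
         forall B : set (measurableTypeR R), measurable B -> nu B = mu B),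
      (* (ii) *)
      forall T, L2_semigroup mu P T ->
        (forall f g, C0_generator S p f g ->
           L2_generator mu T (f \* \1_S) (g \* \1_S)) /\
        is_core mu (L2_generator mu T)
          [set f \* \1_S | f in [set f | exists g, C0_generator S p f g]] &
      (* (iii) *)
      forall T, L2_semigroup mu P T ->
      forall (d : measure_display) (Omega : measurableType d)
        (Q : R -> probability Omega R) (v : R -> Omega -> R)
        (tau : nat -> Omega -> R) (x : R -> R -> Omega -> R),
        jamming_rtp omega%:num L%:num Q v tau x ->
      forall Th, L2_semigroup muh (rtp_transition Q v x) Th ->
        second_order_lift
          muh (rtp_space L%:num) (rtp_transition Q v x) (L2_generator muh Th)
          mu S P (L2_generator mu T) fst].
Proof.
move=> S P mu muh; split.
- by split; [exact: sticky_invariant hp|exact: sticky_invariant_unique hp].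
- move=> T hT; split=> [f g Cfg|].
    by have := L2_generator_C0 hp hT Cfg; rewrite !patch_indic.
  have := sticky_core hp hT; congr is_core.
  by apply/seteqP; split => _ [f Df <-]; exists f => //; rewrite patch_indic.
- move=> T hT d Omega Q v tau x hx Th hTh; exact: (rtp_second_order_lift hp hT hx hTh).
Qed.
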